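(* Let $(X,\sigma)$ be a (one-sided or two-sided) shift space whose language $\mathcal L$ admits a decomposition $\mathcal L=\mathcal C^p\mathcal G\mathcal C^s$ satisfying the following conditions: (I) $\mathcal G$ has (S)-specification. (II$'$) $h(\mathcal C^p\cup\mathcal C^s)=0$. (III) For every $M\in\mathbb N$ there exists $\tau$ such that given $v\in\mathcal G(M)$, there exist words $u,w$ with $|u|\le\tau$, $|w|\le\tau$ for which $uvw\in\mathcal G$. Then every subshift factor $(\tilde X,\sigma)$ of $(X,\sigma)$ is intrinsically ergodic. If moreover $\mathcal G$ has (Per)-specification, then for every subshift factor $(\tilde X,\sigma)$ the sequence of probability measures $$\mu_n=\frac{1}{\#\mathrm{Per}(n)}\sum_{x\in\mathrm{Per}(n)}\delta_x,\qquad \mathrm{Per}(n)=\{x\in\tilde X \mid \sigma^k(x)=x\text{ for some }1\le k\le n\},$$ converges in the weak* topology to the unique measure of maximal entropy for $(\tilde X,\sigma)$.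
   Context: $\mathbb N=\{0,1,2,\dots\}$. A shift space is a nonempty closed shift-invariant subset $X$ of $\{1,\dots,p\}^{\mathbb N}$ (one-sided) or $\{1,\dots,p\}^{\mathbb Z}$ (two-sided); $\sigma$ is the left shift. Its language $\mathcal L$ is the set of all finite words appearing in sequences of $X$ (including the empty word, of length $0$). $|w|$ is the length of $w$; juxtaposition is concatenation; for $\mathcal D\subset\mathcal L$, $\mathcal D_n$ is the set of words of length $n$ in $\mathcal D$, and $h(\mathcal D)=\varlimsup_{n\to\infty}\frac1n\log\#\mathcal D_n$. For $\mathcal A,\mathcal B\subset\mathcal L$, $\mathcal A\mathcal B=\{vw\in\mathcal L \mid v\in\mathcal A,w\in\mathcal B\}$ (only concatenations lying in $\mathcal L$ are included). A decomposition $\mathcal L=\mathcal C^p\mathcal G\mathcal C^s$ consists of collections $\mathcal C^p,\mathcal G,\mathcal C^s\subset\mathcal L$ (which may contain the empty word) such that every word of $\mathcal L$ can be written (possibly non-uniquely) as $uvw$ with $u\in\mathcal C^p$, $v\in\mathcal G$, $w\in\mathcal C^s$. For $M\in\mathbb N$, $\mathcal G(M)=\{uvw\in\mathcal L \mid u\in\mathcal C^p, v\in\mathcal G, w\in\mathcal C^s, |u|\le M,|w|\le M\}$. (S)-specification for $\mathcal G\subset\mathcal L$, with gap size $t\in\mathbb N$: for all $m\ge1$ and $w^1,\dots,w^m\in\mathcal G$ there exist $v^1,\dots,v^{m-1}\in\mathcal L$ with $|v^i|=t$ for all $i$ such that $x:=w^1v^1w^2v^2\cdots v^{m-1}w^m\in\mathcal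 L$. (Per)-specification: (S)-specification holds (with some gap size $t$) and in addition the cylinder $[x]$ (the sequences having $x$ as the word in coordinates $1,\dots,|x|$) contains a point $y$ with $\sigma^{|x|+t}(y)=y$. A subshift factor of $(X,\sigma)$ is a shift space $(\tilde X,\sigma)$ over a finite alphabet (one- or two-sided according to $X$) for which there is a continuous surjective map $\pi:X\to\tilde X$ with $\pi\circ\sigma=\sigma\circ\pi$. A measure of maximal entropy is a $\sigma$-invariant Borel probability measure whose entropy equals the topological entropy; a system is intrinsically ergodic if it has exactly one. *)

(* Defs.v *)
From HB Require Import structures.
From mathcomp Require Import all_boot all_order all_algebra finmap.
From mathcomp Require Import all_classical all_reals all_analysis.

Set Implicit Arguments.
Unset Strict Implicit.
Unset Printing Implicit Defensive.

Import Order.TTheory GRing.Theory Num.Theory.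
Import numFieldNormedType.Exports.
Local Open Scope classical_set_scope.
Local Open Scope ring_scope.

Variant sidedness := one_sided | two_sided.

(* The coordinate set, nat or int, with the semiring structure that makes
   [i + 1] and [i + k%:R] meaningful in both cases. *)
Definition position (s : sidedness) : nzSemiRingType :=
  match s with one_sided => nat : nzSemiRingType | two_sided => int end.

(* The full shift with the product of the discrete topologies and its Borel
   sigma-algebra.  Measurable types are pointed, hence the alphabet 'I_p.+1;
   the empty alphabet carries no shift space anyway. *)
Definition fullshift (s : sidedness) (p : nat) : Type :=
  prod_topology (fun _ : position s => discrete_topology 'I_p.+1).

HB.instance Definition _ s p := Topological.on (fullshift s p).
HB.instance Definition _ s p := isPointed.Build (fullshift s p) (fun=> ord0).
HB.instance Definition _ s p :=
  Measurable.copy (fullshift s p) (g_sigma_algebraType (@open (fullshift s p))).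

Definition left_shift {s p} (x : fullshift s p) : fullshift s p :=
  fun i => x (i + 1).

(* For one-sided sequences shift-invariance is forward invariance; for
   two-sided ones the shift is a homeomorphism and maps X onto itself. *)
Definition shift_invariant {s p} : set (fullshift s p) -> Prop :=
  match s return set (fullshift s p) -> Prop with
  | one_sided => fun X => left_shift @` X `<=` X
  | two_sided => fun X => left_shift @` X = X
  end.

Definition shift_space {s p} (X : set (fullshift s p)) : Prop :=
  [/\ X !=set0, closed X & shift_invariant X].

Definition word (p : nat) := seq 'I_p.+1.

Definition subword {s p} (x : fullshift s p) (i : position s) (n : nat) : word p :=
  mkseq (fun k => x (i + k%:R)) n.

Definition language {s p} (X : set (fullshift s p)) : set (word p) :=
  [set w | exists2 x, X x & exists i, subword x i (size w) = w].

(* w is read at coordinates 1, ..., |w|, also for one-sided sequences, which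
   start at coordinate 0. *)
Definition cylinder {s p} (X : set (fullshift s p)) (w : word p) :
    set (fullshift s p) :=
  X `&` [set x | subword x 1 (size w) = w].

Definition count_words {p} (D : set (word p)) (n : nat) : nat :=
  #|[pred w : n.-tuple 'I_p.+1 | `[< D (tval w) >]]|.

(* Since [ln 0 = 0], lengths n at which D has no word contribute 0 rather than
   -oo; thus a finite D has [word_entropy D = 0], and [word_entropy D = 0] says
   that D grows subexponentially. *)
Definition word_entropy (R : realType) {p} (D : set (word p)) : \bar R :=
  limn_esup (fun n => (n%:R^-1 * ln (count_words D n)%:R)%:E).

Definition decomposition {p} (L Cp G Cs : set (word p)) : Prop :=
  [/\ Cp `<=` L, G `<=` L, Cs `<=` L &
    forall x, L x ->
      exists u v w, [/\ Cp u, G v, Cs w & x = u ++ v ++ w]].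

Definition thickening {p} (L Cp G Cs : set (word p)) (M : nat) : set (word p) :=
  [set x | L x /\ exists u v w, [/\ [/\ Cp u, G v & Cs w],
    (size u <= M)%N, (size w <= M)%N & x = u ++ v ++ w]].

(* [glue w1 [:: v1; ...; v_(m-1)] [:: w2; ...; wm]] is w1 v1 w2 ... v_(m-1) wm. *)
Definition glue {p} (w1 : word p) (vs ws : seq (word p)) : word p :=
  w1 ++ flatten [seq vw.1 ++ vw.2 | vw <- zip vs ws].

Definition gap_words {p} (L : set (word p)) (t : nat) (vs : seq (word p)) :=
  forall v, v \in vs -> L v /\ size v = t.

Definition S_specification {p} (L G : set (word p)) : Prop :=
  exists t : nat, forall (w1 : word p) (ws : seq (word p)),
    (forall w, w \in w1 :: ws -> G w) ->
    exists vs : seq (word p),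
      [/\ size vs = size ws, gap_words L t vs & L (glue w1 vs ws)].

Definition Per_specification {s p} (X : set (fullshift s p))
    (G : set (word p)) : Prop :=
  exists t : nat, forall (w1 : word p) (ws : seq (word p)),
    (forall w, w \in w1 :: ws -> G w) ->
    exists vs : seq (word p),
      [/\ size vs = size ws, gap_words (language X) t vs,
          language X (glue w1 vs ws) &
          exists2 y, cylinder X (glue w1 vs ws) y &
            iter (size (glue w1 vs ws) + t) left_shift y = y].

Definition subshift_factor {s p q} (X : set (fullshift s p))
    (Y : set (fullshift s q)) : Prop :=
  shift_space Y /\
  exists pi : fullshift s p -> fullshift s q,
    [/\ {within X, continuous pi}, pi @` X = Y &
        forall x, X x -> pi (left_shift x) = left_shift (pi x)].

Section Entropy.
Context {R : realType} {s : sidedness} {p : nat}.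
Implicit Types (mu : probability (fullshift s p) R) (X : set (fullshift s p)).

Definition finite_partition (k : nat) (P : 'I_k -> set (fullshift s p)) : Prop :=
  [/\ forall i, measurable (P i), trivIset setT P & \bigcup_i P i = setT].

(* The cells of the join of P, sigma^-1 P, ..., sigma^-(n-1) P. *)
Definition join_cell (k : nat) (P : 'I_k -> set (fullshift s p)) (n : nat)
    (a : {ffun 'I_n -> 'I_k}) : set (fullshift s p) :=
  \bigcap_(j : 'I_n) (iter j left_shift @^-1` P (a j)).

Definition partition_entropy mu (I : finType) (P : I -> set (fullshift s p)) : R :=
  - \sum_i fine (mu (P i)) * ln (fine (mu (P i))).

Definition entropy_wrt mu (k : nat) (P : 'I_k -> set (fullshift s p)) : \bar R :=
  limn (fun n => (n%:R^-1 * partition_entropy mu (@join_cell k P n))%:E).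

Definition measure_entropy mu : \bar R :=
  ereal_sup [set h | exists k (P : 'I_k -> set (fullshift s p)),
    finite_partition P /\ h = entropy_wrt mu P].

Definition topological_entropy X : \bar R := word_entropy R (language X).

Definition shift_invariant_measure mu : Prop :=
  forall B, measurable B -> mu (left_shift @^-1` B) = mu B.

(* Borel probability measures on X are represented by the Borel probability
   measures on the full shift that give X full mass. *)
Definition max_entropy_measure X mu : Prop :=
  [/\ mu X = 1%E, shift_invariant_measure mu &
      measure_entropy mu = topological_entropy X].

(* Measures are compared on Borel sets, since they are total functions on all
   sets with unspecified values outside the sigma-algebra. *)
Definition unique_max_entropy_measure X mu : Prop :=
  max_entropy_measure X mu /\
  forall nu, max_entropy_measure X nu -> forall B, measurable B -> nu B = mu B.

End Entropy.

Definition intrinsically_ergodic (R : realType) {s p}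
    (X : set (fullshift s p)) : Prop :=
  exists mu : probability (fullshift s p) R, unique_max_entropy_measure X mu.

Definition Per {s p} (X : set (fullshift s p)) (n : nat) : set (fullshift s p) :=
  [set x | X x /\ exists k, (1 <= k <= n)%N /\ iter k left_shift x = x].

(* Uniform measure on Per X n.  That set is finite, a point of period k being
   determined by k coordinates, so [fset_set] loses nothing; if it is empty the
   result is the zero measure. *)
Definition per_measure (R : realType) {s p} (X : set (fullshift s p))
    (n : nat) : {measure set (fullshift s p) -> \bar R} :=
  let F := fset_set (Per X n) in
  mscale ((#|` F|)%:R^-1)%:nng (msum (fun i => \d_(nth point F i)) #|` F|).

Definition weak_star_cvg {R : realType} {s p} (X : set (fullshift s p))
    (mu_ : nat -> {measure set (fullshift s p) -> \bar R})
    (mu : {measure set (fullshift s p) -> \bar R}) : Prop :=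
  forall f : fullshift s p -> R, {within X, continuous f} ->
    (fun n => \int[mu_ n]_(x in X) f x) @ \oo --> \int[mu]_(x in X) f x.

(* Main.v *)
(* A factor map is a sliding block code, so the words of the factor Y that come
   from G(M) can be glued with gaps of length bounded in terms of M, and by (II')
   all but a small fraction of the words of each length n are of this kind for M
   large. If h(Y) > 0, the number of words of length n lies between e^(nh) and
   C e^(nh). Limits of averages of the uniform distributions on words then give a
   shift-invariant m with m(w) <= C e^(-|w|h) for all words, m(w) >= c e^(-|w|h)
   for good words, and the same lower bound for pairs of good words at some
   bounded distance.
   If h(Y) = 0, then Y is a finite union of periodic orbits, and gluing forces all
   the properties above with every word good.

   Uniqueness is quantitative. The mean ergodic theorem makes the frequencies of a
   word s in two blocks at bounded distance close on average, so the lower bound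
   on pairs makes the frequency of s in a block of length l close to m(s) with
   m-probability near 1. By the lower bound on good words, the words of length l
   with atypical frequency number at most eta e^(lh). An invariant measure whose
   l-block entropy is at least lh - 1 gives them small mass, whence
   |nu(s) - m(s)| <= e.

   A point of period at most n is determined by its period and its first n
   letters, so the uniform measure on Per(n) has n-block entropy at least
   log #Per(n) - log n. By (Per)-specification #Per(n) >= c e^(nh), and
   subadditivity brings this back to l-block entropy at least lh - 1 for n large;
   equidistribution follows from the quantitative uniqueness. *)
From HB Require Import structures.
Require Import Defs.
From mathcomp Require Import all_boot all_order all_algebra finmap.
From mathcomp Require Import all_classical all_reals all_analysis.
From mathcomp Require Import ring lra zify.

Set Implicit Arguments.
Unset Strict Implicit.
Unset Printing Implicit Defensive.

Import Order.TTheory GRing.Theory Num.Theory.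
Import numFieldNormedType.Exports.
Local Open Scope classical_set_scope.
Local Open Scope ring_scope.

(** * Words and shift-invariant weights on words *)

(** The case h(Y) = 0 stands apart because (II') only makes prefixes and suffixes subexponential:
    there are at most D e^(ih/2) of length i, shortening the middle by i letters gains e^(-ih), and
    the sum over i converges thanks to h > 0. This h belongs to Y and may be smaller than the
    entropy of X, so what gets counted are the images of words of G, not these words; the bound
    comes from concatenating m of them and taking m-th roots. The bound on pairs replaces
    ergodicity. For good u, v the product m(u)m(v) is at most a constant times the sum of m(ugv)
    over short g. The variance of a frequency is half its mean square difference over two
    independent blocks, so it is controlled by blocks at bounded distance in one sequence. Up to
    that point a measure is a function on words, additive on both sides, and every estimate is a
    finite sum; the same estimates then apply to the uniform measures on Per(n). A measure with
    prescribed weights is the image of the uniform law on [0,1) under the map that sends u to the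
    sequence coded by the nested intervals around u. *)

Section Lists.
Variable T : eqType.
Implicit Types (s : seq T) (n : nat).

Fixpoint allseqs s n : seq (seq T) :=
  if n is n'.+1 then [seq a :: w | a <- s, w <- allseqs s n'] else [:: [::]].

Lemma mem_allseqs s n w : (w \in allseqs s n) = (size w == n) && all (mem s) w.
Proof.
elim: n w => [|n IH] [|a w] //=.
  by apply/allpairsP => -[] [x y] [].
apply/allpairsP/idP => [[[b v] /= [bs vs [-> ->]]]|].
  by move: vs; rewrite IH bs eqSS.
rewrite eqSS => /andP[sw /andP[as_ aw]].
by exists (a, w); split => //=; rewrite IH sw.
Qed.

Lemma allseqs_uniq s n : uniq s -> uniq (allseqs s n).
Proof.
move=> us; elim: n => //= n IH; apply: allpairs_uniq => //.
by move=> [a u] [b v] _ _ /= [-> ->].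
Qed.

Lemma size_allseqs s n : size (allseqs s n) = (size s ^ n)%N.
Proof. by elim: n => //= n IH; rewrite size_allpairs IH expnS. Qed.

Lemma big_allseqs_cat (R : nmodType) s m n (F : seq T -> R) :
  \sum_(w <- allseqs s (m + n)) F w =
  \sum_(u <- allseqs s m) \sum_(v <- allseqs s n) F (u ++ v).
Proof.
elim: m F => [|m IH] F /=; first by rewrite big_seq1.
by rewrite !big_allpairs_dep; apply: eq_bigr => a _; rewrite IH.
Qed.

End Lists.

(** The counting bounds on good words, glued words and periodic points are injective codings of this
    form. *)
Lemma size_le_inj (T U : eqType) (s : seq T) (t : seq U) (f : T -> U) :
  uniq s -> {in s &, injective f} -> {in s, forall x, f x \in t} ->
  (size s <= size t)%N.
Proof.
move=> us fi ft; rewrite -(size_map f); apply: uniq_leq_size.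
  by rewrite map_inj_in_uniq.
by move=> _ /mapP[x xs ->]; apply: ft.
Qed.

Section Words.
Variable A : finType.
Implicit Types (w u v : seq A).

(** Sequences rather than tuples: a weight is then one function for all lengths, and words can be
    concatenated and cut without casts. *)
Definition words n : seq (seq A) := allseqs (enum A) n.

Lemma mem_words n w : (w \in words n) = (size w == n).
Proof.
rewrite mem_allseqs; case: eqP => //= _.
by apply/allP => a _; rewrite /= mem_enum.
Qed.

Lemma words_uniq n : uniq (words n).
Proof. by apply: allseqs_uniq; rewrite enum_uniq. Qed.

Lemma size_words n : size (words n) = (#|A| ^ n)%N.
Proof. by rewrite size_allseqs cardE. Qed.

Lemma big_words_cat (R : nmodType) m n (F : seq A -> R) :
  \sum_(w <- words (m + n)) F w =
  \sum_(u <- words m) \sum_(v <- words n) F (u ++ v).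
Proof. exact: big_allseqs_cat. Qed.

Lemma big_words0 (R : nmodType) (F : seq A -> R) :
  \sum_(w <- words 0) F w = F [::].
Proof. by rewrite big_seq1. Qed.

Lemma big_words1 (R : nmodType) (F : seq A -> R) :
  \sum_(w <- words 1) F w = \sum_a F [:: a].
Proof.
rewrite (_ : words 1 = [seq a :: w | a <- enum A, w <- [:: [::]]]) //.
rewrite big_allpairs_dep big_enum /=.
by apply: eq_bigr => a _; rewrite big_seq1.
Qed.

Lemma eq_big_words (R : nmodType) n (F G : seq A -> R) :
  (forall w, size w = n -> F w = G w) ->
  \sum_(w <- words n) F w = \sum_(w <- words n) G w.
Proof. by move=> FG; apply: eq_big_seq => w; rewrite mem_words => /eqP/FG. Qed.

Lemma ler_sum_words (R : numDomainType) n (F G : seq A -> R) :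
  (forall w, size w = n -> F w <= G w) ->
  \sum_(w <- words n) F w <= \sum_(w <- words n) G w.
Proof.
move=> FG; rewrite big_seq [leRHS]big_seq; apply: ler_sum => w.
by rewrite mem_words => /eqP/FG.
Qed.

(** A nonempty [s] that would run past the end of [w] does not occur, since the truncated block is
    shorter than [s]. *)
Definition occ (i : nat) (s w : seq A) : bool := take (size s) (drop i w) == s.

Definition occf {R : realType} (s : seq A) (i : nat) (w : seq A) : R :=
  (occ i s w)%:R.

Lemma big_words_eq (R : nmodType) n u (F : seq A -> R) :
  size u = n -> \sum_(w <- words n) (if w == u then F w else 0) = F u.
Proof.
move=> un; rewrite (bigD1_seq u) /= ?words_uniq ?mem_words ?un // eqxx big1 ?addr0 //.
by move=> w /negbTE ->.
Qed.

End Words.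

(* The cylinder weights of shift-invariant probability measures. *)
Section WMeasure.
Variables (R : realType) (A : finType).
Implicit Types (m nu : seq A -> R).

Definition wmeasure m : Prop :=
  [/\ forall w, 0 <= m w, m [::] = 1,
      forall w, \sum_a m (rcons w a) = m w &
      forall w, \sum_a m (a :: w) = m w].

Variables (m : seq A -> R) (mP : wmeasure m).

Let m0 w : 0 <= m w. Proof. by case: mP. Qed.

Lemma wm_sumr w n : \sum_(g <- words A n) m (w ++ g) = m w.
Proof.
case: mP => _ _ mr _.
elim: n w => [|n IH] w; first by rewrite big_words0 cats0.
rewrite -addn1 big_words_cat -[RHS]IH; apply: eq_bigr => u _.
by rewrite big_words1 -mr; apply: eq_bigr => a _; rewrite cats1 rcons_cat.
Qed.

Lemma wm_suml w n : \sum_(g <- words A n) m (g ++ w) = m w.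
Proof.
case: mP => _ _ _ ml.
elim: n => [|n IH]; first by rewrite big_words0.
rewrite -add1n big_words_cat exchange_big -[RHS]IH; apply: eq_bigr => u _.
by rewrite big_words1 -ml; apply: eq_bigr.
Qed.

Lemma wm_sum1 n : \sum_(w <- words A n) m w = 1.
Proof. by case: (mP) => _ <- _ _; rewrite -(wm_sumr [::] n). Qed.

Lemma wm_le_catl u v : m (u ++ v) <= m u.
Proof.
rewrite -(wm_sumr u (size v)) (bigD1_seq v) /= ?words_uniq ?mem_words //.
by rewrite lerDl; apply: sumr_ge0.
Qed.

Lemma wm_le_catr u v : m (u ++ v) <= m v.
Proof.
rewrite -(wm_suml v (size u)) (bigD1_seq u) /= ?words_uniq ?mem_words //.
by rewrite lerDl; apply: sumr_ge0.
Qed.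

Lemma wm_le1 w : m w <= 1.
Proof. by case: mP => _ <- _ _; exact: (wm_le_catl [::] w). Qed.

Definition wE n (F : seq A -> R) := \sum_(w <- words A n) m w * F w.

(** Summing out the letters on both sides of a block leaves the weight of the block itself; this is
    how shift-invariance enters the ergodic estimates. *)
Lemma wE_shift a n b (F G : seq A -> R) :
  (forall u v z, size u = a -> size v = n -> size z = b ->
     G (u ++ v ++ z) = F v) ->
  wE (a + (n + b)) G = wE n F.
Proof.
move=> GF; rewrite /wE big_words_cat.
under eq_bigr do rewrite big_words_cat.
rewrite exchange_big /=; apply: eq_big_words => v sv.
transitivity (\sum_(u <- words A a) m (u ++ v) * F v).
  apply: eq_big_words => u su.
  rewrite -(wm_sumr _ b) mulr_suml; apply: eq_big_words => z sz.
  by rewrite GF // catA.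
by rewrite -mulr_suml wm_suml.
Qed.

Lemma wE_ge0 n F : (forall w, size w = n -> 0 <= F w) -> 0 <= wE n F.
Proof.
move=> F0; rewrite /wE big_seq; apply: sumr_ge0 => w.
by rewrite mem_words => /eqP/F0; apply: mulr_ge0.
Qed.

Lemma wE_le n F G : (forall w, size w = n -> F w <= G w) -> wE n F <= wE n G.
Proof. by move=> FG; apply: ler_sum_words => w /FG; apply: ler_wpM2l. Qed.

Lemma wE_cst n c : wE n (fun=> c) = c.
Proof. by rewrite /wE -mulr_suml wm_sum1 mul1r. Qed.

Lemma wED n F G : wE n (fun w => F w + G w) = wE n F + wE n G.
Proof. by rewrite /wE -big_split; apply: eq_bigr => w _; rewrite mulrDr. Qed.

Lemma wEB n F G : wE n (fun w => F w - G w) = wE n F - wE n G.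
Proof.
rewrite /wE -sumrB; apply: eq_bigr => w _; exact: mulrBr.
Qed.

Lemma wEZ n c F : wE n (fun w => c * F w) = c * wE n F.
Proof. by rewrite /wE mulr_sumr; apply: eq_bigr => w _; rewrite mulrCA. Qed.

Lemma wE_sum n (I : Type) (s : seq I) (F : I -> seq A -> R) :
  wE n (fun w => \sum_(i <- s) F i w) = \sum_(i <- s) wE n (F i).
Proof.
rewrite /wE exchange_big /=; apply: eq_bigr => w _; exact: mulr_sumr.
Qed.

Lemma wE_occ i s n : (i + size s <= n)%N -> wE n (occf s i) = m s.
Proof.
move=> /subnKC <-; rewrite -addnA.
rewrite (@wE_shift i (size s) _ (fun v => (v == s)%:R)).
  rewrite /wE -(@big_words_eq _ _ (size s) s m) //.
  by apply: eq_bigr => w _; case: eqP => _; rewrite ?mulr1 ?mulr0.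
by move=> u v z su sv _; rewrite /occf /occ -su drop_size_cat // -sv take_size_cat.
Qed.

End WMeasure.

Lemma nat_above (R : realType) (x : R) : exists n : nat, x <= n%:R.
Proof.
exists (Num.bound `|x|); exact: le_trans (ler_norm x) (ltW (archi_boundP (normr_ge0 x))).
Qed.

(** * Frequencies of a word and the mean ergodic theorem *)

Section Frequency.
Variables (R : realType) (A : finType) (m : seq A -> R) (mP : wmeasure m).
Variable s : seq A.
Let d := size s.

Lemma occ_cat a u v z i : size u = a -> (i + d <= size v)%N ->
  occ (a + i) s (u ++ v ++ z) = occ i s v.
Proof.
move=> <- iv; rewrite /occ addnC -drop_drop drop_size_cat // drop_cat.
case: ltnP => [iv'|vi].
  by rewrite takel_cat // size_drop; move: iv; rewrite /d; lia.
have d0 : size s = 0%N by move: iv vi; rewrite /d; lia.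
by rewrite d0 !take0.
Qed.

Definition freq (N k : nat) (w : seq A) : R :=
  (N%:R : R)^-1 * \sum_(i < N) occf s (k + i) w.

Lemma occf01 i w : 0 <= occf (R := R) s i w <= 1.
Proof. by rewrite /occf ler0n lern1; case: occ. Qed.

Lemma freq01 N k w : 0 <= freq N k w <= 1.
Proof.
rewrite /freq; have [->|N0] := posnP N; first by rewrite invr0 mul0r lexx ler01.
apply/andP; split.
  by rewrite mulr_ge0 // sumr_ge0 // => i _; case/andP: (occf01 (k + i) w).
rewrite ler_pdivrMl ?ltr0n // mulr1 -[leRHS](_ : \sum_(i < N) (1 : R) = _).
  by apply: ler_sum => i _; case/andP: (occf01 (k + i) w).
by rewrite sumr_const card_ord.
Qed.

(** The last of the N places is k + N - 1, which explains the [+ 1]. *)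
Lemma freq_cat a N k u v z : size u = a -> (k + N + d <= size v + 1)%N ->
  freq N (a + k) (u ++ v ++ z) = freq N k v.
Proof.
move=> ua kN; rewrite /freq; congr (_ * _); apply: eq_bigr => i _.
rewrite /occf -addnA occ_cat //; have := ltn_ord i; lia.
Qed.

(** Each unit of shift exchanges one term of the sum for another, and two values in [0, 1] differ by
    at most 1. *)
Lemma sum_shift (f : nat -> R) c n : (forall i, 0 <= f i <= 1) ->
  `|\sum_(i < n) f (c + i)%N - \sum_(i < n) f i| <= c%:R.
Proof.
move=> f01; elim: c => [|c IH]; first by rewrite subrr normr0.
have E : \sum_(i < n) f (c.+1 + i)%N = \sum_(i < n) f (c + i)%N + (f (c + n)%N - f c).
  have E : \sum_(i < n.+1) f (c + i)%N = \sum_(i < n) f (c + i)%N + f (c + n)%N.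
    by rewrite big_ord_recr.
  rewrite big_ord_recl /= addn0 in E.
  transitivity (f c + \sum_(i < n) f (c + bump 0 i)%N - f c); last by rewrite E; ring.
  by rewrite addrAC subrr add0r; apply: eq_bigr => i _; rewrite addSnnS.
rewrite E addrAC; apply: le_trans (ler_normD _ _) _.
rewrite -natr1 lerD // ler_norml.
by have /andP[? ?] := f01 (c + n)%N; have /andP[? ?] := f01 c; apply/andP; split; lra.
Qed.

(** After exchanging the sums, each of the N inner sums is the sum over n places shifted by c + j
    with j < N. *)
Lemma freq_sum c N n w : (0 < N)%N -> (0 < n)%N ->
  `|\sum_(i < n) freq N (c + i) w - n%:R * freq n 0 w| <= (N + c)%:R.
Proof.
move=> N0 n0.
rewrite [freq n 0 w]/freq (mulrA (n%:R : R)) divff ?mul1r ?pnatr_eq0 -?lt0n //.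
pose f i : R := occf s i w.
have -> : \sum_(i < n) freq N (c + i) w - \sum_(i < n) f (0 + i)%N =
    N%:R^-1 * \sum_(j < N) (\sum_(i < n) f (c + j + i)%N - \sum_(i < n) f i).
  rewrite sumrB mulrBr; congr (_ - _).
    rewrite -mulr_sumr; congr (_ * _); rewrite exchange_big; apply: eq_bigr => j _.
    by apply: eq_bigr => i _; rewrite /f addnAC.
  rewrite sumr_const card_ord -[X in _ * X]mulr_natl mulrA mulVf ?mul1r //.
  by rewrite pnatr_eq0 -lt0n.
rewrite normrM ger0_norm // ler_pdivrMl ?ltr0n //.
apply: le_trans (ler_norm_sum _ _ _) _.
rewrite mulr_natl -[leRHS](_ : \sum_(j < N) (N + c)%:R = _); last first.
  by rewrite sumr_const card_ord.
apply: ler_sum => j _; apply: le_trans (sum_shift _ _ _) _.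
  by move=> i; apply: occf01.
by rewrite ler_nat addnC leq_add2r ltnW.
Qed.

(** Second moment of the frequency over N places. It almost decreases in N, and its decrease bounds
    mean square deviations. *)
Let V N := wE m (N + d) (fun w => freq N 0 w ^+ 2).
Let W N k := wE m (k + N + d) (fun w => (freq N 0 w - freq N k w) ^+ 2).

(** Pythagoras: when the square is expanded, [freq_sum] turns the cross term into -2n times the
    square of the long frequency, with an error of order N + c. *)
Lemma freq_dev c k N n : (0 < N)%N -> (0 < n)%N -> (c <= k)%N ->
  wE m (n + k + N + d) (fun w => \sum_(i < n) (freq N (c + i) w - freq n 0 w) ^+ 2)
  <= n%:R * (V N - V n) + 2 * (N + c)%:R.
Proof.
move=> N0 n0 ck.
apply: (@le_trans _ _ (wE m (n + k + N + d) (fun w =>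
    \sum_(i < n) freq N (c + i) w ^+ 2 - n%:R * freq n 0 w ^+ 2 + 2 * (N + c)%:R))).
  apply: wE_le => // w _.
  have -> : \sum_(i < n) (freq N (c + i) w - freq n 0 w) ^+ 2 =
     \sum_(i < n) freq N (c + i) w ^+ 2 - 2 * freq n 0 w * (\sum_(i < n) freq N (c + i) w)
     + n%:R * freq n 0 w ^+ 2.
    rewrite mulr_sumr -sumrB.
    rewrite -[X in _ = _ + X](_ : \sum_(i < n) freq n 0 w ^+ 2 = _); last first.
      by rewrite sumr_const card_ord mulr_natl.
    rewrite -big_split; apply: eq_bigr => i _ /=; ring.
  have := freq_sum c w N0 n0; rewrite ler_norml => /andP[+ _].
  have /andP[f0 f1] := freq01 n 0 w.
  set S := \sum_(i < n) freq N (c + i) w; set a := freq n 0 w in f0 f1 *.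
  set b := (N + c)%:R; set Q := \sum_(i < n) _.
  have b0 : 0 <= b by rewrite /b.
  move=> Sb; have : a * (n%:R * a - b) <= a * S by apply: ler_wpM2l => //; lra.
  have : a * b <= b by apply: ler_piMl.
  nra.
rewrite wED ?wEB // wE_cst // lerD2r wE_sum wEZ mulrBr lerB //.
  rewrite -[leRHS](_ : \sum_(i < n) V N = _); last by rewrite sumr_const card_ord mulr_natl.
  apply: ler_sum => i _; have iN := ltn_ord i.
  have E : (n + k + N + d = (c + i) + ((N + d) + (n + k - (c + i))))%N by lia.
  rewrite E (@wE_shift _ _ _ mP _ (N + d) _ (fun w => freq N 0 w ^+ 2)) // => u v z su sv sz.
  by rewrite -{1}[(c + i)%N]addn0 (freq_cat _ su) // sv; lia.
apply: ler_wpM2l => //.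
have E : (n + k + N + d = 0 + ((n + d) + (k + N)))%N by lia.
rewrite E (@wE_shift _ _ _ mP _ (n + d) _ (fun w => freq n 0 w ^+ 2)) // => u v z su sv sz.
by rewrite -{1}[0%N](addn0 0) (freq_cat _ su) // sv; lia.
Qed.

(** The left side of [freq_dev] with c = k = 0 is nonnegative. *)
Lemma V_decr N n : (0 < N)%N -> (0 < n)%N -> V n <= V N + 2 * N%:R / n%:R.
Proof.
move=> N0 n0; have := @freq_dev 0 0 N n N0 n0 isT.
have /le_trans H : 0 <= wE m (n + 0 + N + d)
    (fun w => \sum_(i < n) (freq N (0 + i) w - freq n 0 w) ^+ 2).
  by apply: wE_ge0 => // w _; apply: sumr_ge0 => i _; apply: sqr_ge0.
move=> /H; rewrite addn0 => {}H.
rewrite -(ler_pM2l (_ : 0 < n%:R)) ?ltr0n // mulrDr mulrCA divff ?pnatr_eq0 -?lt0n //.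
lra.
Qed.

(** Both blocks are compared with the frequency over one long stretch of n places, by (a - b)^2 <=
    2(a - c)^2 + 2(b - c)^2. The distance k enters only through a term that vanishes as n grows. *)
Lemma W_le N k n : (0 < N)%N -> (0 < n)%N ->
  W N k <= 4 * (V N - V n) + (8 * N + 4 * k)%:R / n%:R.
Proof.
move=> N0 n0.
have h1 := @freq_dev 0 k N n N0 n0 (leq0n _).
have h2 := @freq_dev k k N n N0 n0 (leqnn _).
have h : n%:R * W N k <= 2 * (n%:R * (V N - V n) + 2 * (N + 0)%:R)
    + 2 * (n%:R * (V N - V n) + 2 * (N + k)%:R).
  apply: le_trans (lerD (ler_wpM2l _ h1) (ler_wpM2l _ h2)) => //.
  rewrite -[leLHS](_ : \sum_(i < n) W N k = _); last by rewrite sumr_const card_ord mulr_natl.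
  rewrite -!wEZ -wED.
  apply: (@le_trans _ _ (wE m (n + k + N + d)
     (fun w => \sum_(i < n) (freq N i w - freq N (k + i) w) ^+ 2))).
    rewrite wE_sum; apply: ler_sum => i _; have iN := ltn_ord i.
    have E : (n + k + N + d = i + ((k + N + d) + (n - i)))%N by lia.
    rewrite E (@wE_shift _ _ _ mP i (k + N + d) _
      (fun w => (freq N 0 w - freq N k w) ^+ 2)) // => u v z su sv sz.
    rewrite [(k + i)%N]addnC (freq_cat _ su); last by rewrite sv; lia.
    by rewrite -{1}[nat_of_ord i]addn0 (freq_cat _ su) // sv; lia.
  apply: wE_le => // w _; rewrite !mulr_sumr -big_split.
  apply: ler_sum => i _ /=; rewrite add0n.
  set a := freq N i w; set b := freq N _ w; set c := freq n 0 w.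
  have := sqr_ge0 (a + b - 2 * c); rewrite !expr2; nra.
rewrite -(ler_pM2l (_ : 0 < n%:R)) ?ltr0n // mulrDr (mulrCA _ (8 * N + 4 * k)%:R) divff ?pnatr_eq0 -?lt0n //.
move: h; rewrite addn0 !natrD; lra.
Qed.

(* Mean ergodic theorem, uniformly in the distance k of the two blocks. *)
Lemma W_small e : 0 < e -> exists N0, forall N k, (N0 <= N)%N -> W N k <= e.
Proof.
move=> e0.
pose S : set R := [set V N.+1 | N in [set: nat]]%classic.
have lbS : lbound S 0.
  by move=> _ [N _ <-]; apply: wE_ge0 => // w _; apply: sqr_ge0.
have hiS : has_inf S by split; [exists (V 1), 0%N | exists 0].
(* By [V_decr], one value near the infimum keeps all later ones near it, so V N - V n is small for
   all large N and every n. *)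
have [_ [N1 _ <-] VN1] := inf_adherent (divr_gt0 e0 (ltr0n _ 32)) hiS.
have vle n : (0 < n)%N -> inf S <= V n.
  by case: n => // n _; apply: ge_inf; [exists 0 | exists n].
have [N2 N2P] := nat_above (64 * N1.+1%:R / e).
exists (maxn N2 1) => N k; rewrite geq_max => /andP[NN2 N0].
have VN : V N <= inf S + e / 16.
  apply: (le_trans (@V_decr N1.+1 N isT N0)).
  have : 2 * N1.+1%:R / N%:R <= e / 32.
    rewrite ler_pdivrMr ?ltr0n // mulrAC ler_pdivlMr ?ltr0n //.
    move: N2P; rewrite ler_pdivrMr // => N2P.
    have : e * N2%:R <= e * N%:R by rewrite ler_wpM2l ?ler_nat // ltW.
    lra.
  lra.
(* The auxiliary n may depend on k; the threshold for N does not. *)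
have [n nP] := nat_above (2 * (8 * N + 4 * k)%:R / e).
have /(_ N0 isT) := @W_le N k n.+1 => /le_trans; apply.
have : (8 * N + 4 * k)%:R / n.+1%:R <= e / 2.
  rewrite ler_pdivrMr ?ltr0n //.
  move: nP; rewrite ler_pdivrMr // -(natr1 n); set c := (_ + _)%:R; nra.
have vn := vle n.+1 isT; move: (_ / _) => c ce; move: (V N) (V n.+1) (inf S) VN vn => x y z ?? ; lra.
Qed.

End Frequency.

(** * Entropy of weights and uniqueness *)

Section Entropy.
Variable R : realType.

(** This is ln x <= x - 1 at x = q / p. *)
Lemma gibbs_pointwise (p q : R) : 0 <= p -> 0 <= q -> (q = 0 -> p = 0) ->
  - (p * ln p) <= - (p * ln q) + q - p.
Proof.
rewrite le_eqVlt => /orP[/eqP <-|p0] q0 qp; first by rewrite !mul0r; lra.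
have {q0}qpos : 0 < q.
  by rewrite lt_neqAle q0 andbT; apply/eqP => /esym/qp p0'; rewrite p0' ltxx in p0.
have : ln (q / p) <= q / p - 1.
  rewrite -{1}(subrK 1 (q / p)) addrC; apply: le_ln1Dx.
  by rewrite ltrBrDl subrr divr_gt0.
rewrite ln_div ?posrE // => H.
have := ler_wpM2l (ltW p0) H; rewrite !mulrBr mulrCA divff ?gt_eqF //; lra.
Qed.

Lemma gibbs_sum (I : Type) (r : seq I) (p q : I -> R) :
  (forall i, 0 <= p i) -> (forall i, 0 <= q i) -> (forall i, q i = 0 -> p i = 0) ->
  \sum_(i <- r) - (p i * ln (p i)) <=
  \sum_(i <- r) - (p i * ln (q i)) + \sum_(i <- r) q i - \sum_(i <- r) p i.
Proof.
move=> p0 q0 qp; rewrite -big_split -sumrB /=.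
by apply: ler_sum => i _; apply: gibbs_pointwise => //; apply: qp.
Qed.

Variable A : finType.
Implicit Types (m : seq A -> R).

Definition wH m n : R := \sum_(w <- words A n) - (m w * ln (m w)).

Lemma wH_le m (q : seq A -> R) n : wmeasure m ->
  (forall w, 0 <= q w) -> (forall w, q w = 0 -> m w = 0) ->
  \sum_(w <- words A n) q w <= 1 ->
  wH m n <= \sum_(w <- words A n) - (m w * ln (q w)).
Proof.
move=> mP q0 qm q1; have m0 w : 0 <= m w by case: mP.
rewrite /wH; apply: le_trans (gibbs_sum _ m0 q0 qm) _.
by rewrite (wm_sum1 mP) // lerBlDr lerD2l.
Qed.

(** Gibbs inequality against the product weight m u * m v, which vanishes only where m (u ++ v)
    does. *)
Lemma wH_add m a b : wmeasure m -> wH m (a + b) <= wH m a + wH m b.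
Proof.
move=> mP; have m0 w : 0 <= m w by case: mP.
rewrite {1}/wH big_words_cat.
pose r := [seq (u, v) | u <- words A a, v <- words A b].
have E F : \sum_(u <- words A a) \sum_(v <- words A b) F u v =
    \sum_(i <- r) F i.1 i.2 :> R by rewrite big_allpairs.
rewrite (E (fun u v => - (m (u ++ v) * ln (m (u ++ v))))).
apply: le_trans (@gibbs_sum _ r (fun i => m (i.1 ++ i.2)) (fun i => m i.1 * m i.2)
  (fun i => m0 _) (fun i => mulr_ge0 (m0 _) (m0 _)) _) _.
  move=> [u v] /= /eqP; rewrite mulf_eq0 => /orP[] /eqP H; apply/eqP;
    rewrite eq_le m0 andbT -H; [exact: wm_le_catl|exact: wm_le_catr].
rewrite -(E (fun u v => m u * m v)) -(E (fun u v => m (u ++ v))) -big_words_cat (wm_sum1 mP) /=.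
rewrite (_ : \sum_(u <- words A a) \sum_(v <- words A b) m u * m v = 1); last first.
  by under eq_bigr do rewrite -mulr_sumr (wm_sum1 mP) mulr1; rewrite (wm_sum1 mP).
rewrite addrK -(E (fun u v => - (m (u ++ v) * ln (m u * m v)))).
rewrite le_eqVlt; apply/orP; left; apply/eqP.
transitivity (\sum_(u <- words A a) \sum_(v <- words A b) - (m (u ++ v) * ln (m u))
   + \sum_(u <- words A a) \sum_(v <- words A b) - (m (u ++ v) * ln (m v))).
  rewrite -big_split; apply: eq_bigr => u _; rewrite -big_split; apply: eq_bigr => v _ /=.
  have [mu0|mu] := eqVneq (m u) 0.
    have -> : m (u ++ v) = 0 by apply/eqP; rewrite eq_le m0 andbT -mu0 wm_le_catl.
    by rewrite !mul0r oppr0 addr0.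
  have [mv0|mv] := eqVneq (m v) 0.
    have -> : m (u ++ v) = 0 by apply/eqP; rewrite eq_le m0 andbT -mv0 wm_le_catr.
    by rewrite !mul0r oppr0 addr0.
  by rewrite lnM ?posrE ?lt_neqAle ?(eq_sym 0) ?mu ?mv ?m0 // mulrDr opprD.
congr (_ + _).
  apply: eq_bigr => u _; rewrite sumrN -mulr_suml wm_sumr //.
rewrite exchange_big; apply: eq_bigr => v _; rewrite sumrN -mulr_suml wm_suml //.
Qed.

Lemma wH0 m : wmeasure m -> wH m 0 = 0.
Proof. by case=> _ m1 _ _; rewrite /wH big_words0 m1 ln1 mulr0 oppr0. Qed.

Lemma wH_ge0 m n : wmeasure m -> 0 <= wH m n.
Proof.
move=> mP; apply: sumr_ge0 => w _.
rewrite oppr_ge0 mulr_ge0_le0 ?ln_le0 ?(wm_le1 mP) //; by case: mP.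
Qed.

Lemma wH_mul m n k : wmeasure m -> wH m (k * n) <= k%:R * wH m n.
Proof.
move=> mP; elim: k => [|k IH]; first by rewrite mul0n wH0 // mul0r.
rewrite mulSn -natr1 mulrDl mul1r addrC.
exact: le_trans (wH_add _ _ mP) (lerD _ IH).
Qed.

Lemma wH_le_card m n : wmeasure m -> (0 < #|A|)%N -> wH m n <= n%:R * ln #|A|%:R.
Proof.
move=> mP A0.
have qpos : 0 < (#|A|%:R ^+ n)^-1 :> R by rewrite invr_gt0 exprn_gt0 // ltr0n.
apply: le_trans (@wH_le _ (fun=> (#|A|%:R ^+ n)^-1) n mP _ _ _) _.
- by move=> _; apply: ltW.
- by move=> w H; move: qpos; rewrite H ltxx.
- rewrite big_const_seq count_predT size_words iter_addr addr0 -[X in X <= _]mulr_natl natrX mulfV //.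
  by rewrite expf_neq0 // pnatr_eq0 -lt0n.
rewrite sumrN -mulr_suml (wm_sum1 mP) mul1r lnV ?posrE ?exprn_gt0 ?ltr0n //.
by rewrite opprK lnXn ?ltr0n // mulr_natl.
Qed.

(** Passes from long blocks to short ones: n letters are cut into n %/ l blocks of length l and a
    remainder whose entropy is at most l ln #|A|. *)
Lemma wH_down m n l : wmeasure m -> (0 < #|A|)%N -> (0 < l)%N ->
  l%:R * wH m n <= n%:R * wH m l + l%:R ^+ 2 * ln #|A|%:R.
Proof.
move=> mP A0 l0.
have lnA : 0 <= ln #|A|%:R :> R by rewrite ln_ge0 // ler1n.
have := wH_add (n %/ l * l) (n %% l) mP; rewrite -divn_eq => H.
have H1 := wH_mul l (n %/ l) mP.
have H2 := wH_le_card (n %% l) mP A0.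
have H3 : (n %% l)%:R * ln #|A|%:R <= l%:R * ln #|A|%:R :> R.
  by rewrite ler_wpM2r // ler_nat ltnW // ltn_mod.
have H4 : wH m n <= (n %/ l)%:R * wH m l + l%:R * ln #|A|%:R by lra.
apply: le_trans (ler_wpM2l (ler0n _ l) H4) _.
rewrite mulrDr mulrA lerD //; last by rewrite expr2 mulrA.
by rewrite ler_wpM2r ?wH_ge0 // -natrM ler_nat mulnC leq_trunc_div.
Qed.

End Entropy.

(** * Quantitative uniqueness *)

Section Uniqueness.
Variables (R : realType) (A : finType) (L : pred (seq A)) (h : R).
Variable good : nat -> pred (seq A).

Definition cnt (P : pred (seq A)) n : R := (count P (words A n))%:R.

Lemma cntE P n : cnt P n = \sum_(w <- words A n | P w) 1.
Proof. by rewrite /cnt -sum1_count natr_sum. Qed.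

(** Since there are at least e^(nh) words of length n, this leaves at least half of e^(nh) good ones
    at every length. *)
Definition plenty M := forall n, cnt (fun w => L w && ~~ good M w) n <= 2^-1 * expR (n%:R * h).

Hypothesis L_upper : exists C, forall n, cnt L n <= C * expR (n%:R * h).
Hypothesis good_L : forall M w, good M w -> L w.
Hypothesis good_exhaust : forall d : R, 0 < d -> exists M, forall n,
  cnt (fun w => L w && ~~ good M w) n <= d * expR (n%:R * h).

Variable m : seq A -> R.
Hypothesis mP : wmeasure m.
Hypothesis m_supp : forall w, ~~ L w -> m w = 0.
Hypothesis m_upper : exists C, forall w, m w <= C * expR (- ((size w)%:R * h)).
Hypothesis m_lower : forall M, plenty M -> exists2 c, 0 < c & forall w, good M w ->
  c * expR (- ((size w)%:R * h)) <= m w.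
Hypothesis m_lower2 : forall M, plenty M -> exists T, exists2 c, 0 < c &
  forall u v, good M u -> good M v ->
  c * expR (- ((size u + size v)%:R * h)) <=
  \sum_(i < T) \sum_(g <- words A i) m (u ++ g ++ v).

Let m0 w : 0 <= m w. Proof. by case: mP. Qed.

Lemma exists_good d : 0 < d -> exists2 M, plenty M & forall n,
  cnt (fun w => L w && ~~ good M w) n <= d * expR (n%:R * h).
Proof.
move=> d0; have [|M MP] := good_exhaust (_ : 0 < Num.min d 2^-1).
  by rewrite lt_min d0 invr_gt0 ltr0n.
by exists M => n; apply: le_trans (MP n) _;
  rewrite ler_wpM2r ?expR_ge0 // ge_min lexx ?orbT.
Qed.

(** At most d e^(nh) words of the language are bad, each of weight at most C e^(-nh); words outside
    the language weigh nothing. *)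
Lemma bad_mass C M d n : (forall w, m w <= C * expR (- ((size w)%:R * h))) ->
  0 <= C ->
  cnt (fun w => L w && ~~ good M w) n <= d * expR (n%:R * h) ->
  \sum_(w <- words A n) (~~ good M w)%:R * m w <= C * d.
Proof.
move=> mC C0; rewrite cntE => H.
have -> : C * d = C * expR (- (n%:R * h)) * (d * expR (n%:R * h)).
  by rewrite mulrACA -expRD addNr expR0 mulr1.
apply: le_trans (ler_wpM2l _ H); last by rewrite mulr_ge0 ?expR_ge0.
rewrite mulr_sumr [leRHS]big_mkcond; apply: ler_sum_words => w wn.
have [Lw|Lw] := boolP (L w); last by rewrite m_supp // mulr0.
by case: (good M w); rewrite /= ?mul0r // mul1r mulr1 -wn.
Qed.

Section Var.
Variable s : seq A.
Let F N := freq R s N 0.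

(** For good u and v, m u * m v <= C^2 e^(-(|u|+|v|)h) <= (C^2 / c) times the sum of m (u ++ g ++ v)
    over short g. So independent pairs are dominated by pairs at bounded distance, to which
    [W_small] applies; bad words are discarded by their mass. *)
Lemma pair_var e : 0 < e -> exists N0, forall N, (N0 <= N)%N ->
  \sum_(u <- words A (N + size s)) \sum_(v <- words A (N + size s))
    m u * m v * (F N u - F N v) ^+ 2 <= e.
Proof.
move=> e0.
have [C' mC'] := m_upper.
pose C := Num.max 1 C'.
have C1 : 1 <= C by rewrite le_max lexx.
have C0 : 0 < C by apply: lt_le_trans C1.
have mC w : m w <= C * expR (- ((size w)%:R * h)).
  by apply: le_trans (mC' w) _; rewrite ler_wpM2r ?expR_ge0 // le_max lexx orbT.
(* Bad [u] and bad [v] then contribute at most e / 4 each. *)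
have [|M plM badM] := @exists_good (e / (4 * C)); first by rewrite divr_gt0 // mulr_gt0.
have [T [c c0 lowM]] := m_lower2 plM.
(* The second block starts N + size s + i places after the first, a lag that grows with N; this is
   why [W_small] has to be uniform in the lag. The constant makes the T lags contribute at most e /
   2. *)
have [|N0 N0P] := @W_small _ _ _ mP s (e * c / (2 * C ^+ 2 * T.+1%:R)).
  by rewrite divr_gt0 ?mulr_gt0 ?exprn_gt0.
exists N0 => N /N0P NW; set l := (N + size s)%N.
pose K := C ^+ 2 / c.
have pointwise u v : size u = l -> size v = l ->
  m u * m v * (F N u - F N v) ^+ 2 <=
    K * (\sum_(i < T) \sum_(g <- words A i) m (u ++ g ++ v) * (F N u - F N v) ^+ 2)
    + ((~~ good M u)%:R * m u * m v + m u * ((~~ good M v)%:R * m v)).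
  move=> ul vl.
  have sq0 : 0 <= (F N u - F N v) ^+ 2 by apply: sqr_ge0.
  have sq1 : (F N u - F N v) ^+ 2 <= 1.
    have /andP[? ?] := freq01 R s N 0 u; have /andP[? ?] := freq01 R s N 0 v.
    by rewrite /F expr2; nra.
  have S0 : 0 <= K * (\sum_(i < T) \sum_(g <- words A i) m (u ++ g ++ v) * (F N u - F N v) ^+ 2).
    apply: mulr_ge0; first by rewrite divr_ge0 ?sqr_ge0 // ltW.
    by apply: sumr_ge0 => i _; apply: sumr_ge0 => g _; apply: mulr_ge0.
  have mm1 : m u * m v * (F N u - F N v) ^+ 2 <= m u * m v.
    by apply: ler_piMr => //; apply: mulr_ge0.
  have mm0 : 0 <= m u * m v by apply: mulr_ge0.
  have [gu|gu] := boolP (good M u); last first.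
    have : 0 <= m u * ((~~ good M v)%:R * m v) by rewrite !mulr_ge0.
    rewrite mul1r; lra.
  have [gv|gv] := boolP (good M v); last by rewrite /= !mul0r mul1r; lra.
  rewrite /= !mul0r mulr0 !addr0.
  under [in leRHS]eq_bigr do rewrite -mulr_suml.
  rewrite -mulr_suml [leRHS]mulrA; apply: ler_wpM2r => //.
  rewrite /K mulrAC ler_pdivlMr //.
  apply: (@le_trans _ _ (C ^+ 2 * (c * expR (- ((size u + size v)%:R * h))))); last first.
    by apply: ler_wpM2l; [apply: sqr_ge0 | exact: lowM].
  rewrite mulrCA mulrC; apply: ler_wpM2l; first exact: ltW.
  rewrite natrD mulrDl opprD expRD expr2 mulrACA.
  by apply: ler_pM.
apply: (@le_trans _ _ (\sum_(u <- words A l) \sum_(v <- words A l)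
    (K * (\sum_(i < T) \sum_(g <- words A i) m (u ++ g ++ v) * (F N u - F N v) ^+ 2)
    + ((~~ good M u)%:R * m u * m v + m u * ((~~ good M v)%:R * m v))))).
  by apply: ler_sum_words => u ul; apply: ler_sum_words => v vl; apply: pointwise.
under eq_bigr do rewrite big_split /=.
rewrite big_split /= [e](splitr e) lerD //.
  under eq_bigr do rewrite -mulr_sumr.
  rewrite -mulr_sumr.
  have -> : \sum_(u <- words A l) \sum_(v <- words A l) \sum_(i < T)
      \sum_(g <- words A i) m (u ++ g ++ v) * (F N u - F N v) ^+ 2 =
      \sum_(i < T) wE m (l + i + N + size s)
         (fun w => (freq R s N 0 w - freq R s N (l + i) w) ^+ 2).
    under eq_bigr do rewrite exchange_big /=.
    rewrite exchange_big /=; apply: eq_bigr => i _.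
    rewrite /wE -(addnA (l + i)) -addnA (big_words_cat l).
    apply: eq_big_words => u ul; rewrite (big_words_cat i) exchange_big /=.
    apply: eq_big_words => g gi; apply: eq_big_words => v vl.
    congr (_ * (_ - _) ^+ 2).
      by rewrite -{1}[0%N]addn0 -[u ++ _]cat0s (@freq_cat _ _ _ 0 N 0 [::] u) // ul /l; lia.
    rewrite -[v in u ++ g ++ v]cats0 catA -[(l + i)%N]addn0 (@freq_cat _ _ _ (l + i)%N N 0) //.
      by rewrite size_cat ul gi.
    by rewrite vl /l; lia.
  apply: (@le_trans _ _ (K * (\sum_(i < T) (e * c / (2 * C ^+ 2 * T.+1%:R))))).
    apply: ler_wpM2l; first by rewrite divr_ge0 ?sqr_ge0 // ltW.
    by apply: ler_sum => i _; apply: NW.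
  rewrite sumr_const card_ord /K -[X in _ * X]mulr_natl.
  have -> : C ^+ 2 / c * (T%:R * (e * c / (2 * C ^+ 2 * T.+1%:R))) = e / 2 * (T%:R / T.+1%:R).
    by field; rewrite !gt_eqF ?ltr0n.
  apply: ler_piMr; first by rewrite divr_ge0 // ltW.
  by rewrite ler_pdivrMr ?ltr0n // mul1r ler_nat.
under eq_bigr do rewrite big_split /=.
rewrite big_split /=.
have bad := @bad_mass C M _ l mC (ltW C0) (badM l).
have bad2 : C * (e / (4 * C)) = e / 4 by field; rewrite gt_eqF.
rewrite bad2 in bad.
have -> : \sum_(i <- words A l) \sum_(v <- words A l) (~~ good M i)%:R * m i * m v
   = \sum_(w <- words A l) (~~ good M w)%:R * m w.
  by apply: eq_bigr => u _; rewrite -mulr_sumr (wm_sum1 mP) mulr1.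
have -> : \sum_(i <- words A l) \sum_(v <- words A l) m i * ((~~ good M v)%:R * m v)
   = \sum_(w <- words A l) (~~ good M w)%:R * m w.
  by rewrite exchange_big; apply: eq_bigr => u _; rewrite -mulr_suml (wm_sum1 mP) mul1r.
lra.
Qed.

Lemma freq_mean nu N : wmeasure nu -> (0 < N)%N -> wE nu (N + size s) (F N) = nu s.
Proof.
move=> nuP N0; rewrite /F /freq wEZ wE_sum.
transitivity (N%:R^-1 * \sum_(i < N) nu s).
  congr (_ * _); apply: eq_bigr => i _; rewrite add0n wE_occ //.
  by rewrite leq_add2r ltnW.
by rewrite sumr_const card_ord -[X in _ * X]mulr_natl mulrA mulVf ?mul1r // pnatr_eq0 -lt0n.
Qed.

(** For two independent copies, the mean of (F u - F v)^2 is twice the variance of F. *)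
Lemma freq_var e : 0 < e -> exists N0, forall N, (N0 <= N)%N -> (0 < N)%N ->
  wE m (N + size s) (fun w => (F N w - m s) ^+ 2) <= e.
Proof.
move=> e0; have [N0 N0P] := pair_var e0; exists N0 => N NN0 Npos.
apply: le_trans _ (N0P N NN0).
set l := (N + size s)%N.
have -> : \sum_(u <- words A l) \sum_(v <- words A l) m u * m v * (F N u - F N v) ^+ 2
  = 2 * wE m l (fun w => (F N w - m s) ^+ 2).
  have mean := freq_mean mP Npos; rewrite -/l in mean.
  have H u : \sum_(v <- words A l) m u * m v * (F N u - F N v) ^+ 2 =
     m u * ((F N u - m s) ^+ 2 + wE m l (fun w => (F N w - m s) ^+ 2)
            + 2 * (F N u - m s) * (m s - wE m l (F N))).
    transitivity (m u * wE m l (fun v => (F N u - m s) ^+ 2 + (F N v - m s) ^+ 2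
       + 2 * (F N u - m s) * (m s - F N v))).
      rewrite /wE mulr_sumr; apply: eq_bigr => v _; ring.
    by rewrite !wED wEZ wEB !(wE_cst mP).
  under eq_bigr do rewrite H mean subrr mulr0 addr0 mulrDr.
  by rewrite big_split /= -mulr_suml (wm_sum1 mP) mul1r mulr_natl mulr2n.
rewrite mulr_natl mulr2n lerDl; apply: wE_ge0 => // w _; exact: sqr_ge0.
Qed.

End Var.

(** [l] is chosen before [nu], and an entropy defect of 1 is allowed, so that the bound also reaches
    measures whose entropy is only nearly maximal. If [nu] charged the few atypical words too much,
    its entropy would drop by more than 1. *)
Lemma wm_unique s e : 0 < e -> exists2 l, (0 < l)%N & forall nu, wmeasure nu ->
  (forall w, ~~ L w -> nu w = 0) -> l%:R * h - 1 <= wH nu l -> `|nu s - m s| <= e.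
Proof.
move=> e0; have [C' LC'] := L_upper.
pose C := Num.max 1 C'.
have C1 : 1 <= C by rewrite le_max lexx.
have C0 : 0 < C by apply: lt_le_trans C1.
have LC n : cnt L n <= C * expR (n%:R * h).
  by apply: le_trans (LC' n) _; rewrite ler_wpM2r ?expR_ge0 // le_max lexx orbT.
pose B := 1 + ln (2 * C).
have B0 : 0 < B by rewrite ltr_pwDl // ln_ge0 //; lra.
(* Then - ln (2 * eta) = 2B / e, and the final bound nD * (2B / e) <= B becomes nD <= e / 2. *)
pose eta := expR (- (2 * B / e)) / 2.
have eta0 : 0 < eta by rewrite divr_gt0 ?expR_gt0.
have [|M plM badM] := @exists_good (eta / 2); first by rewrite divr_gt0.
have [c c0 lowM] := m_lower plM.
(* Chebyshev: a good word weighs at least c e^(-lh) and an atypical one deviates by more than e / 2,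
   so at most (eta / 2) e^(lh) good words are atypical. *)
have [|N0 N0P] := @freq_var s (c * eta * e ^+ 2 / 8).
  by apply: divr_gt0 => //; apply: mulr_gt0; [exact: mulr_gt0 | exact: exprn_gt0].
pose N := N0.+1; have {N0P}var := N0P N (leqnSn _) isT.
exists (N + size s)%N => //; set l := (N + size s)%N in var *.
move=> nu nuP nu_supp Hnu; have nu0 w : 0 <= nu w by case: nuP.
pose D w := e / 2 < `|freq R s N 0 w - m s|.
have cntD : cnt (fun w => L w && D w) l <= eta * expR (l%:R * h).
  have cheb : \sum_(w <- words A l | good M w && D w) 1 <= eta / 2 * expR (l%:R * h).
    have E : 0 < c * (e ^+ 2 / 4) * expR (- (l%:R * h)).
      by rewrite !mulr_gt0 ?expR_gt0 ?exprn_gt0.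
    rewrite -(ler_pM2l E).
    have -> : c * (e ^+ 2 / 4) * expR (- (l%:R * h)) * (eta / 2 * expR (l%:R * h))
      = c * eta * e ^+ 2 / 8 * (expR (- (l%:R * h)) * expR (l%:R * h)) by field.
    rewrite -expRD addNr expR0 mulr1; apply: le_trans var.
    rewrite mulr_sumr [leLHS]big_mkcond; apply: ler_sum_words => w wl.
    case: ifP => [/andP[gw Dw]|_]; last by rewrite mulr_ge0 ?sqr_ge0.
    rewrite mulr1 mulrAC; apply: ler_pM.
    - by rewrite mulr_ge0 ?expR_ge0 // ltW.
    - by rewrite divr_ge0 ?sqr_ge0.
    - by rewrite -wl; exact: lowM.
    rewrite -[leRHS]real_normK ?num_real // -[leLHS](_ : (e / 2) ^+ 2 = _); last by field.
    by rewrite lerXn2r ?nnegrE ?normr_ge0 ?divr_ge0 // ltW.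
  rewrite cntE; have := badM l; rewrite cntE => bad.
  apply: le_trans (_ : _ <= eta / 2 * expR (l%:R * h) + eta / 2 * expR (l%:R * h)) _; last by lra.
  apply: le_trans (lerD bad cheb).
  rewrite [leLHS]big_mkcond [X in _ <= X + _]big_mkcond [X in _ <= _ + X]big_mkcond -big_split /=.
  apply: ler_sum => w _; case: (boolP (L w)) => Lw /=; last by case: ifP => _; lra.
  by case: (good M w); case: (D w) => /=; lra.
(* Test weight for Gibbs: the atypical words and the whole language receive total weight at most 1/2
   each, so atypical words are cheap only in proportion to their small number. *)
pose q w := if D w then expR (- (l%:R * h)) / (2 * eta) else expR (- (l%:R * h)) / (2 * C).
pose q' w := if L w then q w else 0.
have q0 w : 0 < q w.
  by rewrite /q; case: ifP => _; apply: divr_gt0; rewrite ?expR_gt0 // mulr_gt0.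
have q1 : \sum_(w <- words A l) q' w <= 1.
  rewrite -[leRHS](_ : expR (- (l%:R * h)) / (2 * eta) * (eta * expR (l%:R * h)) +
     expR (- (l%:R * h)) / (2 * C) * (C * expR (l%:R * h)) = 1); last first.
    rewrite (_ : _ + _ = expR (- (l%:R * h)) * expR (l%:R * h)).
      by rewrite -expRD addNr expR0.
    by field; rewrite !gt_eqF.
  have e1 : 0 <= expR (- (l%:R * h)) / (2 * eta) by rewrite divr_ge0 ?expR_ge0 // mulr_ge0 // ltW.
  have e2 : 0 <= expR (- (l%:R * h)) / (2 * C) by rewrite divr_ge0 ?expR_ge0 // mulr_ge0 // ltW.
  apply: le_trans (lerD (ler_wpM2l e1 cntD) (ler_wpM2l e2 (LC l))).
  rewrite !cntE !mulr_sumr [X in _ <= X + _]big_mkcond [X in _ <= _ + X]big_mkcond -big_split /=.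
  apply: ler_sum => w _; rewrite /q' /q; case: (L w) => /=; last by rewrite addr0.
  by case: (D w); rewrite ?mulr1; lra.
have wHle : wH nu l <= \sum_(w <- words A l) - (nu w * ln (q w)).
  apply: le_trans (wH_le (q := q') nuP _ _ q1) _.
  - by move=> w; rewrite /q'; case: ifP => // _; apply: ltW.
  - move=> w; rewrite /q'; case: ifPn => [_ qw|Lw _]; last exact: nu_supp.
    by have := q0 w; rewrite qw ltxx.
  apply: ler_sum => w _; rewrite /q'; case: ifPn => // Lw.
  by rewrite nu_supp // !mul0r.
pose nD := \sum_(w <- words A l) (D w)%:R * nu w.
have wHD : wH nu l <= l%:R * h + ln (2 * C) - nD * (ln (2 * C) - ln (2 * eta)).
  apply: le_trans wHle _.
  have lq w : ln (q w) = - (l%:R * h) - ln (2 * C) + (D w)%:R * (ln (2 * C) - ln (2 * eta)).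
    have lnq (x : R) : 0 < x -> ln (expR (- (l%:R * h)) / x) = - (l%:R * h) - ln x.
      by move=> x0; rewrite ln_div ?posrE ?expR_gt0 // expRK.
    by rewrite /q; case: (D w) => /=; rewrite lnq; [lra|exact: mulr_gt0|lra|exact: mulr_gt0].
  under eq_bigr do rewrite lq.
  rewrite sumrN lerNl le_eqVlt; apply/orP; left; apply/eqP.
  transitivity (\sum_(w <- words A l) nu w * (- (l%:R * h) - ln (2 * C)) +
    nD * (ln (2 * C) - ln (2 * eta))).
    by rewrite -mulr_suml (wm_sum1 nuP) mul1r; ring.
  rewrite /nD mulr_suml -big_split; apply: eq_bigr => w _ /=; ring.
have nD0 : 0 <= nD by apply: sumr_ge0 => w _; rewrite mulr_ge0.
have nDe : nD <= e / 2.
  have lneta : ln (2 * eta) = - (2 * B / e).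
    by rewrite /eta mulrCA divff ?pnatr_eq0 // mulr1 expRK.
  have lC : 0 <= ln (2 * C) by rewrite ln_ge0 //; lra.
  have : nD * (2 * B / e) <= B.
    have := mulr_ge0 nD0 lC; rewrite lneta in wHD; rewrite /B in wHD *; nra.
  have -> : nD * (2 * B / e) = B * (nD / (e / 2)) by field; rewrite gt_eqF.
  by rewrite ger_pMr // ler_pdivrMr ?divr_gt0 // mul1r.
have -> : nu s - m s = wE nu l (fun w => freq R s N 0 w - m s).
  by rewrite wEB (wE_cst nuP) /l freq_mean.
(* The deviation is at most e / 2 on typical words and at most 1 on the others. *)
apply: (@le_trans _ _ (wE nu l (fun w => e / 2 + (D w)%:R))).
  apply: le_trans (ler_norm_sum _ _ _) _; apply: ler_sum => w _.
  rewrite normrM ger0_norm //; apply: ler_wpM2l => //.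
  rewrite /D; case: ltP => H /=; last by rewrite addr0.
  apply: le_trans (_ : 1 <= _); last by lra.
  have /andP[? ?] := freq01 R s N 0 w.
  have := m0 s; have := wm_le1 mP s => ? ?.
  by rewrite ler_norml; apply/andP; split; lra.
rewrite wED (wE_cst nuP) (_ : wE nu l _ = nD); first lra.
by apply: eq_bigr => w _; rewrite mulrC.
Qed.

End Uniqueness.

(** * Existence of a weight of maximal entropy *)

(** Limits along one ultrafilter finer than the eventual filter exist for all [j] at once, and
    finitely many of them are approximated at a common, arbitrarily large n. *)
Lemma common_limits (R : realType) (J : eqType) (x : J -> nat -> R) :
  (forall j n, 0 <= x j n <= 1) ->
  exists l : J -> R, forall (s : seq J) e n0, 0 < e ->
    exists2 n, (n0 <= n)%N & {in s, forall j, `|l j - x j n| <= e}.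
Proof.
move=> x01; have [F [FU ooF]] := ultraFilterLemma eventually_filter.
have PF : ProperFilter F by apply: ultra_proper.
have xl j : exists l : R, x j @ F --> l.
  have [|l [_ lc]] := @segment_compact R 0 1 (x j @ F) _.
    by apply: (@filterS _ F _ setT _ _ filterT) => n _; rewrite /= in_itv /= x01.
  exists l => U Ul; have [//|FU'] := in_ultra_setVsetC (x j @^-1` U) FU.
  by have [y [/= ?]] := lc (~` U) U FU' Ul.
have [l lP] := choice xl; exists l => s e n0 e0.
have FA : F (\bigcap_(j in [set` s]) [set n | `|l j - x j n| <= e]).
  elim: s => [|j s IH].
    by apply: filterS filterT => n _ j.
  have Fj : F [set n | `|l j - x j n| <= e] by move/cvgrPdist_le : (lP j); exact.
  apply: filterS (filterI Fj IH) => n [nj ns] i /=; rewrite inE => /orP[/eqP->//|].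
  exact: ns.
have Fn : F [set n | (n0 <= n)%N] by apply: ooF; exists n0.
have [n [nn nA]] := filter_ex (filterI Fn FA).
by exists n => // j js; apply: nA.
Qed.

Section Existence.
Variables (R : realType) (A : finType) (L : pred (seq A)) (h : R).
Variable good : nat -> pred (seq A).
Let N n : R := cnt R L n.

Hypothesis L_sub : forall u v w, L (u ++ v ++ w) -> L v.
Hypothesis L_lower : forall n, expR (n%:R * h) <= N n.
Hypothesis L_upper : exists C, forall n, N n <= C * expR (n%:R * h).
Hypothesis good_L : forall M w, good M w -> L w.
Hypothesis good_glue : forall M, exists T, forall a u v c,
  good M a -> good M u -> good M v -> good M c ->
  exists g1 g2 g3, [/\ (size g1 <= T)%N, (size g2 <= T)%N, (size g3 <= T)%N &
    L (a ++ g1 ++ u ++ g2 ++ v ++ g3 ++ c)].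

Let N_gt0 n : 0 < N n.
Proof. exact: lt_le_trans (expR_gt0 _) (L_lower n). Qed.

(** Words of length 2n are read only at places j < n, which leaves n letters to the right of each
    place. *)
Let kap n j w : R := cnt R (fun v => L v && occ j w v) (2 * n) / N (2 * n).
Let av n w : R := n%:R^-1 * \sum_(j < n) kap n j w.

Let kap01 n j w : 0 <= kap n j w <= 1.
Proof.
rewrite /kap divr_ge0 ?ler0n //= ler_pdivrMr // mul1r /N /cnt ler_nat.
by apply: sub_count => v /andP[].
Qed.

Let av01 n w : 0 <= av n w <= 1.
Proof.
rewrite /av; have [->|n0] := posnP n; first by rewrite big_ord0 mulr0 lexx ler01.
rewrite mulr_ge0 ?sumr_ge0 //=; last by move=> j _; case/andP: (kap01 n j w).
rewrite ler_pdivrMl ?ltr0n // mulr1 -[leRHS](_ : \sum_(j < n) (1 : R) = _).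
  by apply: ler_sum => j _; case/andP: (kap01 n j w).
by rewrite sumr_const card_ord.
Qed.

Lemma cnt_sum_occ (P : pred (seq A)) (I : finType) (F : I -> pred (seq A)) (G : pred (seq A)) n :
  (forall v, size v = n -> \sum_i (F i v)%:R = (G v)%:R :> R) ->
  \sum_i cnt R (fun v => P v && F i v) n = cnt R (fun v => P v && G v) n.
Proof.
move=> FG; rewrite cntE (eq_bigr (fun i => \sum_(w <- words A n) (P w && F i w)%:R)).
  rewrite exchange_big [RHS]big_mkcond /=; apply: eq_big_words => v vn.
  case: (P v) => /=; last by rewrite big1.
  by rewrite (FG v vn); case: (G v).
by move=> i _; rewrite cntE big_mkcond; apply: eq_bigr => w _; case: ifP.
Qed.

Lemma sum_pred1 (x : A) (b : bool) : \sum_a ((a == x) && b)%:R = b%:R :> R.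
Proof.
rewrite (bigD1 x) //= eqxx big1 ?addr0 //.
by move=> a /negbTE ->.
Qed.

Let kap_r n j w : (j + size w < 2 * n)%N -> \sum_a kap n j (rcons w a) = kap n j w.
Proof.
move=> jw; rewrite /kap -mulr_suml; congr (_ / _); apply: cnt_sum_occ => v vn.
have : (size w < size (drop j v))%N by rewrite size_drop vn; lia.
rewrite /occ; move: (drop j v) => y wv.
case: y wv => // x0 y; set v' := x0 :: y => wv.
rewrite -(sum_pred1 (nth x0 v' (size w))); apply: eq_bigr => a _.
by rewrite size_rcons (take_nth x0) // eqseq_rcons (eq_sym a) andbC.
Qed.

Let kap_l n j w : (j < 2 * n)%N -> \sum_a kap n j (a :: w) = kap n j.+1 w.
Proof.
move=> jn; rewrite /kap -mulr_suml; congr (_ / _); apply: cnt_sum_occ => v vn.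
have : (0 < size (drop j v))%N by rewrite size_drop vn; lia.
rewrite /occ -[j.+1]add1n -drop_drop; move: (drop j v) => y.
case: y => // x0 y _ /=; rewrite drop0 -(sum_pred1 x0); apply: eq_bigr => a _.
by rewrite eqseq_cons eq_sym.
Qed.

Lemma split_occ i s (v : seq A) : occ i s v ->
  v = take i v ++ s ++ drop (i + size s) v.
Proof.
move=> /eqP; rewrite /occ addnC -drop_drop => {1}<-.
by rewrite cat_take_drop cat_take_drop.
Qed.

Let kap0 n j w : ~~ L w -> kap n j w = 0.
Proof.
move=> Lw; rewrite /kap /cnt (eq_count (a2 := pred0)) ?count_pred0 ?mul0r //.
move=> v /=; apply/negP => /andP[Lv ov]; move/negP: Lw; apply.
by move: Lv; rewrite (split_occ ov) => /L_sub.
Qed.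

(** A word of length 2n with [w] at place j is determined by its first j and last k letters, where j
    + |w| + k = 2n. Hence there are at most N j * N k <= C^2 e^(-|w|h) e^(2nh) of them. *)
Let kap_upper C n j w : (forall n, N n <= C * expR (n%:R * h)) ->
  (j + size w <= 2 * n)%N -> kap n j w <= C ^+ 2 * expR (- ((size w)%:R * h)).
Proof.
move=> NC jw.
have C0 : 0 <= C by have := le_trans (ltW (N_gt0 0)) (NC 0%N); rewrite mul0r expR0 mulr1.
pose k := (2 * n - j - size w)%N.
have kE : (2 * n = j + (size w + k))%N by rewrite /k; lia.
rewrite /kap ler_pdivrMr //.
apply: (@le_trans _ _ (N j * N k)).
  rewrite /N !cntE mulr_suml [leRHS]big_mkcond [leLHS]big_mkcond kE big_words_cat /=.
  apply: ler_sum_words => u uj; rewrite big_words_cat.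
  rewrite (_ : \sum_(u0 <- _) _ = \sum_(v <- words A k) (L (u ++ w ++ v))%:R); last first.
    rewrite -(@big_words_eq _ _ (size w) w (fun x => \sum_(v <- words A k) (L (u ++ x ++ v))%:R)) //.
    apply: eq_big_words => x xw; case: eqP => [->|/eqP xnw].
      apply: eq_big_words => v vk.
      by rewrite /occ -uj drop_size_cat // take_size_cat // eqxx andbT; case: ifP.
    rewrite big1 // => v _.
    by rewrite /occ -uj drop_size_cat // take_size_cat // (negbTE xnw) andbF.
  case: ifP => Lu; last first.
    rewrite big1 // => v _; case: (boolP (L _)) => // /(@L_sub [::]).
    by rewrite Lu.
  rewrite mul1r [leRHS]big_mkcond; apply: ler_sum => v _.
  case: (boolP (L (u ++ _))) => [|_]; last by case: ifP.
  by rewrite catA -[v in X in L X]cats0 => /L_sub ->.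
apply: (@le_trans _ _ ((C * expR (j%:R * h)) * (C * expR (k%:R * h)))).
  by apply: ler_pM; rewrite ?ler0n // ltW.
have -> : C * expR (j%:R * h) * (C * expR (k%:R * h)) =
   C ^+ 2 * expR (- ((size w)%:R * h)) * expR ((2 * n)%:R * h).
  rewrite -[in RHS]mulrA -expRD mulrACA -expRD expr2; congr (_ * expR _).
  by rewrite kE !natrD; ring.
by apply: ler_wpM2l; rewrite ?mulr_ge0 ?expR_ge0.
Qed.

(* The number of words that can be lost at the end when a glued word is cut to
   its first 2n letters. *)
Let tails T := flatten [seq words A i | i <- iota 0 (3 * T).+1].
(** The 4 pays for the two halves lost when only good [a] and [c] are used, T.+1 for the length of
    the second gap, the last factor for the letters cut off. *)
Let K T : R := 4 * T.+1%:R * (size (tails T)).+1%:R.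

Let mem_tails T v : (size v <= 3 * T)%N -> v \in tails T.
Proof.
move=> vT; apply/flattenP; exists (words A (size v)); last by rewrite mem_words.
by apply/mapP; exists (size v); rewrite // mem_iota add0n leq0n ltnS.
Qed.

Let cnt_good M n : plenty L h good M -> 2^-1 * expR (n%:R * h) <= cnt R (good M) n.
Proof.
move=> /(_ n); have := L_lower n; rewrite /N.
have -> : cnt R L n = cnt R (fun w => L w && ~~ good M w) n + cnt R (good M) n.
  rewrite !cntE [LHS]big_mkcond [X in _ = X + _]big_mkcond [X in _ = _ + X]big_mkcond.
  rewrite -big_split; apply: eq_bigr => w _ /=.
  case: (boolP (good M w)) => [/good_L ->|_]; first by rewrite andbF add0r.
  by rewrite andbT addr0.
lra.
Qed.

(** Common source of both lower bounds: Z is a single word, or all words u g v with a short gap.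
    Good [a] of length j and [c] of length k, with j + l + k = 2n, are glued around some z in Z; the
    result has between 2n and 2n + 3T letters, and cut to 2n letters it still contains z, at a place
    within T of j. *)
Let glue_count M T l n j (Z : seq (seq A)) : plenty L h good M ->
  {in Z, forall z, (l <= size z <= l + T)%N} ->
  (forall a c, good M a -> good M c -> exists z g1 g2,
     [/\ z \in Z, (size g1 <= T)%N, (size g2 <= T)%N & L (a ++ g1 ++ z ++ g2 ++ c)]) ->
  (j + l + T + T <= 2 * n)%N ->
  expR ((2 * n)%:R * h - l%:R * h) / K T <=
  \sum_(z <- Z) \sum_(0 <= i < T.+1) cnt R (fun v => L v && occ (j + i) z v) (2 * n).
Proof.
move=> plM Zl Zg jl; pose k := (2 * n - l - j)%N.
have kE : (2 * n = j + k + l)%N by rewrite /k; lia.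
have /choice[f fP] : forall x : seq A * seq A, exists y : seq A * seq A * seq A,
    good M x.1 -> good M x.2 ->
    [/\ y.1.1 \in Z, (size y.1.2 <= T)%N, (size y.2 <= T)%N &
        L (x.1 ++ y.1.2 ++ y.1.1 ++ y.2 ++ x.2)].
  move=> [a c] /=; case: (pselect (good M a /\ good M c)) => [[ga gc]|H].
    by have [z [g1 [g2 ?]]] := Zg a c ga gc; exists (z, g1, g2).
  by exists ([::], [::], [::]) => ga gc; case: H.
pose W x := x.1 ++ (f x).1.2 ++ (f x).1.1 ++ (f x).2 ++ x.2.
pose src := [seq (a, c) | a <- seq.filter (good M) (words A j), c <- seq.filter (good M) (words A k)].
pose t1 := [seq x | z <- Z, x <- [seq (z, i, v) | i <- iota 0 T.+1,
  v <- seq.filter (fun v => L v && occ (j + i) z v) (words A (2 * n))]].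
pose t2 := [seq (i, v) | i <- iota 0 T.+1, v <- tails T].
pose tgt := [seq (x, y) | x <- t1, y <- t2].
(* The cut word and its tail give back the glued word, and the gap lengths together with z locate
   [a] and [c] in it. *)
pose code x := ((((f x).1.1, size (f x).1.2), take (2 * n) (W x)),
  (size (f x).2, drop (2 * n) (W x))).
have srcP x : x \in src -> [/\ size x.1 = j, size x.2 = k, good M x.1 & good M x.2].
  case/allpairsP => -[a c] /= []; rewrite !mem_filter !mem_words.
  by move=> /andP[? /eqP ?] /andP[? /eqP ?] ->.
have sz : (size src <= size tgt)%N.
  apply: (@size_le_inj _ _ _ _ code).
  - apply: allpairs_uniq; rewrite ?filter_uniq ?words_uniq //.
    by move=> [? ?] [? ?] _ _ /= [-> ->].
  - move=> x y /srcP[x1 x2 gx1 gx2] /srcP[y1 y2 gy1 gy2] [ez e1 et e2 ed].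
    have eW : W x = W y by rewrite -(cat_take_drop (2 * n) (W x)) et ed cat_take_drop.
    have eq1 : x.1 = y.1.
      transitivity (take j (W x)); first by rewrite /W take_size_cat.
      by rewrite eW /W take_size_cat.
    have cutc u : size u.1 = j -> u.2 = drop (j + size (f u).1.2 + size (f u).1.1 + size (f u).2) (W u).
      by move=> <-; rewrite /W !catA drop_size_cat // !size_cat.
    have eq2 : x.2 = y.2 by rewrite (cutc x x1) (cutc y y1) eW ez e1 e2.
    by move: eq1 eq2; case: x {x1 x2 gx1 gx2 ez e1 et e2 ed eW} => ? ?; case: (y) => ? ? /= -> ->.
  - move=> x /srcP[x1 x2 gx1 gx2]; have [zZ s1 s2 LW] := fP x gx1 gx2.
    rewrite -/(W x) in LW.
    have /andP[zl1' zl2'] := Zl _ zZ.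
    have zl1 : (l <= size (f x).1.1)%N := zl1'.
    have zl2 : (size (f x).1.1 <= l + T)%N := zl2'.
    have sW : size (W x) = (j + size (f x).1.2 + size (f x).1.1 + size (f x).2 + k)%N.
      by rewrite /W !size_cat x1 x2; lia.
    apply/allpairsP; eexists (_, _); split; last by [].
    + apply/allpairsPdep; exists (f x).1.1; eexists; split; [exact: zZ| |by []].
      apply/allpairsPdep; exists (size (f x).1.2), (take (2 * n) (W x)); split => //.
        by rewrite mem_iota add0n leq0n ltnS.
      rewrite mem_filter mem_words size_takel ?eqxx ?andbT; last by rewrite sW; lia.
      apply/andP; split.
        by move: LW; rewrite -{1}(cat_take_drop (2 * n) (W x)) => /(@L_sub [::]).
      have WE : W x = (x.1 ++ (f x).1.2) ++ (f x).1.1 ++ ((f x).2 ++ x.2) by rewrite /W !catA.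
      have sX : size (x.1 ++ (f x).1.2) = (j + size (f x).1.2)%N by rewrite size_cat x1.
      rewrite WE take_cat ltnNge sX (_ : (_ <= 2 * n)%N) /=; last by lia.
      rewrite take_cat ltnNge (_ : (size (f x).1.1 <= _)%N) /=; last by lia.
      by rewrite /occ -sX drop_size_cat // take_size_cat.
    + apply/allpairsPdep; exists (size (f x).2), (drop (2 * n) (W x)); split => //.
        by rewrite mem_iota add0n leq0n ltnS.
      by apply: mem_tails; rewrite size_drop sW; lia.
have szt1 : (size t1)%:R =
    \sum_(z <- Z) \sum_(0 <= i < T.+1) cnt R (fun v => L v && occ (j + i) z v) (2 * n).
  rewrite size_allpairs_dep sumnE big_map natr_sum; apply: eq_bigr => z _.
  rewrite size_allpairs_dep sumnE big_map natr_sum /index_iota subn0.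
  by apply: eq_bigr => i _; rewrite size_filter.
rewrite -szt1 ler_pdivrMr; last by rewrite /K !mulr_gt0.
have gj := cnt_good j plM; have gk := cnt_good k plM.
have : 2^-1 * expR (j%:R * h) * (2^-1 * expR (k%:R * h)) <= (size src)%:R.
  rewrite size_allpairs natrM !size_filter.
  by apply: ler_pM => //; rewrite mulr_ge0 ?expR_ge0.
rewrite -mulrACA -expRD -mulrDl -natrD.
have -> : expR ((j + k)%:R * h) = expR ((2 * n)%:R * h - l%:R * h).
  by congr expR; rewrite kE (natrD _ (j + k)%N); ring.
have sztgt : size tgt = (size t1 * (T.+1 * size (tails T)))%N.
  by rewrite /tgt size_allpairs /t2 size_allpairs size_iota.
move: sz; rewrite sztgt -(ler_nat R) 2!natrM => sz H.
have := le_trans H sz; rewrite /K.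
have t0 : 0 <= (size t1)%:R * T.+1%:R :> R by rewrite mulr_ge0.
rewrite -(natr1 (size (tails T))).
move: t0; set a := (size t1)%:R; set b := T.+1%:R; set c := (size _)%:R => t0.
by lra.
Qed.

Lemma exists_wmeasure : exists m : seq A -> R, [/\ wmeasure m,
  forall w, ~~ L w -> m w = 0,
  exists C, forall w, m w <= C * expR (- ((size w)%:R * h)),
  forall M, plenty L h good M -> exists2 c, 0 < c & forall w, good M w ->
    c * expR (- ((size w)%:R * h)) <= m w &
  forall M, plenty L h good M -> exists T, exists2 c, 0 < c &
    forall u v, good M u -> good M v ->
    c * expR (- ((size u + size v)%:R * h)) <=
    \sum_(i < T) \sum_(g <- words A i) m (u ++ g ++ v)].
Proof.
have [m mlim] := common_limits (x := fun w n => av n w) (fun w n => av01 n w).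
have [C NC] := L_upper.
have close w e n0 : 0 < e -> exists2 n, (n0 <= n)%N & `|m w - av n w| <= e.
  by move=> /(mlim [:: w] _ n0) [n nn H]; exists n => //; apply: H; rewrite inE.
have m0 w : 0 <= m w.
  apply/ler_addgt0Pr => e e0; have [n _] := close w e 0%N e0.
  by have /andP[? _] := av01 n w; rewrite ler_norml => /andP[? ?]; lra.
have eq_of_close (x y : R) : (forall e, 0 < e -> `|x - y| <= e) -> x = y.
  move=> H; apply/eqP; rewrite -subr_eq0 -normr_le0.
  by apply/ler_addgt0Pr => e e0; rewrite add0r; apply: H.
have sum_close (Z : seq (seq A)) e n0 : 0 < e ->
    exists2 n, (n0 <= n)%N & `|\sum_(z <- Z) m z - \sum_(z <- Z) av n z| <= e.
  move=> e0; have [|n nn nP] := mlim Z (e / (size Z).+1%:R) n0; first exact: divr_gt0.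
  exists n => //; rewrite -sumrB; apply: le_trans (ler_norm_sum _ _ _) _.
  apply: (@le_trans _ _ (\sum_(z <- Z) (e / (size Z).+1%:R))).
    by rewrite big_seq [leRHS]big_seq; apply: ler_sum.
  rewrite big_const_seq count_predT iter_addr addr0 -[X in X <= _]mulr_natr mulrAC.
  by rewrite ler_pdivrMr // ler_pM2l // ler_nat.
exists m.
have lower M : plenty L h good M -> forall T, exists2 c, 0 < c &
    forall l (Z : seq (seq A)), {in Z, forall z, (l <= size z <= l + T)%N} ->
    (forall a c, good M a -> good M c -> exists z g1 g2,
     [/\ z \in Z, (size g1 <= T)%N, (size g2 <= T)%N & L (a ++ g1 ++ z ++ g2 ++ c)]) ->
    c * expR (- (l%:R * h)) <= \sum_(z <- Z) m z.
  move=> plM T; have C0 : 0 < C.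
    by have := lt_le_trans (N_gt0 0) (NC 0%N); rewrite mul0r expR0 mulr1.
  have K0 : 0 < K T by rewrite /K !mulr_gt0.
  exists ((K T * C * T.+1%:R)^-1); first by rewrite invr_gt0 !mulr_gt0.
  move=> l Z Zl Zg; apply/ler_addgt0Pr => e e0.
  have e20 : 0 < e / 2 by rewrite divr_gt0.
  (* The gap before z displaces it by at most T places, which by [sum_shift] changes the n-fold
     averages over Z by at most T * size Z in all; n makes this at most n e / 2. *)
  have [n1 n1P] := nat_above ((T * size Z)%:R * 2 / e).
  have [n nn nP] := sum_close Z (e / 2) (maxn n1 (l + T + T).+1) e20.
  move: nn; rewrite geq_max => /andP[nn1 nn2].
  have n0 : (0 < n)%N by apply: leq_trans nn2.
  apply: (@le_trans _ _ (\sum_(z <- Z) av n z + e / 2)); last first.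
    by move: nP; rewrite ler_norml => /andP[? ?]; lra.
  have step j : (j < n)%N -> expR (- (l%:R * h)) / (K T * C) <=
      \sum_(z <- Z) \sum_(0 <= i < T.+1) kap n (j + i) z.
    move=> jn; have := glue_count plM Zl Zg (_ : (j + l + T + T <= 2 * n)%N).
    move=> /(_ ltac:(lia)) H.
    rewrite /kap; under eq_bigr do rewrite -mulr_suml.
    rewrite -mulr_suml ler_pdivlMr //; apply: le_trans H.
    apply: (@le_trans _ _ (expR (- (l%:R * h)) / (K T * C) * (C * expR ((2 * n)%:R * h)))).
      by rewrite ler_wpM2l // divr_ge0 ?expR_ge0 // mulr_ge0 // ltW.
    rewrite expRD (_ : _ / (K T * C) * _ = expR ((2 * n)%:R * h) * expR (- (l%:R * h)) / K T) //.
    by field; rewrite !gt_eqF.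
  have : n%:R * (expR (- (l%:R * h)) / (K T * C)) <=
      \sum_(z <- Z) \sum_(0 <= i < T.+1) (n%:R * av n z + T%:R).
    rewrite -[leLHS](_ : \sum_(j < n) (expR (- (l%:R * h)) / (K T * C)) = _); last first.
      by rewrite sumr_const card_ord [RHS]mulr_natl.
    apply: (le_trans (ler_sum _ (fun (j : 'I_n) _ => step j (ltn_ord j)))).
    rewrite exchange_big; apply: ler_sum => z _; rewrite exchange_big /=.
    rewrite [leLHS]big_seq [leRHS]big_seq; apply: ler_sum => i.
    rewrite mem_index_iota /= ltnS => iT.
    have := @sum_shift R (fun j => kap n j z) i n (fun j => kap01 n j z).
    rewrite /av mulrA divff ?mul1r ?pnatr_eq0 -?lt0n // ler_norml => /andP[_].
    have : i%:R <= T%:R :> R by rewrite ler_nat.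
    under eq_bigr do rewrite addnC.
    by lra.
  have -> : \sum_(z <- Z) \sum_(0 <= i < T.+1) (n%:R * av n z + T%:R) =
      T.+1%:R * (n%:R * \sum_(z <- Z) av n z + (T * size Z)%:R).
    transitivity (\sum_(z <- Z) T.+1%:R * (n%:R * av n z + T%:R)).
      by apply: eq_bigr => z _; rewrite sumr_const_nat subn0 [RHS]mulr_natl.
    rewrite -mulr_sumr big_split /= -mulr_sumr big_const_seq count_predT iter_addr addr0.
    by rewrite (natrM _ T) mulr_natr.
  move=> H.
  have np : 0 < n%:R :> R by rewrite ltr0n.
  rewrite -(ler_pM2l (_ : 0 < n%:R * T.+1%:R)) ?mulr_gt0 //.
  have -> : n%:R * T.+1%:R * ((K T * C * T.+1%:R)^-1 * expR (- (l%:R * h))) =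
      n%:R * (expR (- (l%:R * h)) / (K T * C)) by field; rewrite !gt_eqF.
  apply: le_trans H _.
  rewrite [n%:R * T.+1%:R]mulrC -mulrA ler_pM2l // mulrDr lerD2l.
  move: n1P; rewrite ler_pdivrMr // => n1P.
  have : e * n1%:R <= e * n%:R by rewrite ler_wpM2l ?ler_nat // ltW.
  lra.
split.
- split=> // [|w|w].
  + apply: eq_of_close => e e0; have [n n0] := close [::] e 1%N e0.
    suff -> : av n [::] = 1 by [].
    rewrite /av (eq_bigr (fun=> 1)).
      by rewrite sumr_const card_ord mulVf // pnatr_eq0 -lt0n.
    move=> j _; rewrite /kap (_ : cnt _ _ _ = N (2 * n)) ?divff ?gt_eqF //.
    by congr _%:R; apply: eq_count => v; rewrite /occ take0 eqxx andbT.
  + apply: eq_of_close => e e0.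
    have [n nn nP] := mlim (w :: [seq rcons w a | a <- enum A]) (e / #|A|.+1%:R) (size w).+1
      (divr_gt0 e0 (ltr0Sn _ _)).
    have avr : \sum_a av n (rcons w a) = av n w.
      rewrite /av -mulr_sumr exchange_big; congr (_ * _); apply: eq_bigr => j _ /=.
      by rewrite kap_r //; have := ltn_ord j; lia.
    have -> : \sum_a m (rcons w a) - m w =
        \sum_a (m (rcons w a) - av n (rcons w a)) - (m w - av n w).
      by rewrite sumrB avr; ring.
    apply: le_trans (ler_normB _ _) _.
    have -> : e = \sum_(a : A) (e / #|A|.+1%:R) + e / #|A|.+1%:R.
      by rewrite sumr_const -mulrSr -[RHS]mulr_natr divfK // pnatr_eq0.
    apply: lerD; last by apply: nP; rewrite inE eqxx.
    apply: le_trans (ler_norm_sum _ _ _) _; apply: ler_sum => a _.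
    by apply: nP; rewrite inE map_f ?mem_enum ?orbT.
  + apply: eq_of_close => e e0.
    have [n1 n1P] := nat_above (2 / e).
    have [n nn nP] := mlim (w :: [seq a :: w | a <- enum A]) (e / 2 / #|A|.+1%:R)
      (maxn n1 1) (divr_gt0 (divr_gt0 e0 (ltr0Sn _ _)) (ltr0Sn _ _)).
    move: nn; rewrite geq_max => /andP[nn1 npos].
    (* Prefixing a letter moves every place by one, so the average over j < n changes by at most 1 /
       n: invariance on the left holds in the limit only. *)
    have avl : `|\sum_a av n (a :: w) - av n w| <= e / 2.
      have -> : \sum_a av n (a :: w) = n%:R^-1 * \sum_(j < n) kap n (1 + j) w.
        rewrite /av -mulr_sumr exchange_big; congr (_ * _); apply: eq_bigr => j _ /=.
        by rewrite kap_l ?add1n //; have := ltn_ord j; lia.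
      rewrite /av -mulrBr normrM ger0_norm // ler_pdivrMl ?ltr0n //.
      apply: le_trans (sum_shift _ _ (fun j => kap01 n j w)) _.
      move: n1P; rewrite ler_pdivrMr // => n1P.
      have : n1%:R * e <= n%:R * e by rewrite ler_wpM2r ?ler_nat // ltW.
      lra.
    have -> : \sum_a m (a :: w) - m w =
        (\sum_a (m (a :: w) - av n (a :: w)) - (m w - av n w)) + (\sum_a av n (a :: w) - av n w).
      by rewrite sumrB; ring.
    rewrite [e]splitr; apply: le_trans (ler_normD _ _) (lerD _ avl).
    apply: le_trans (ler_normB _ _) _.
    have -> : e / 2 = \sum_(a : A) (e / 2 / #|A|.+1%:R) + e / 2 / #|A|.+1%:R.
      by rewrite sumr_const -mulrSr -[RHS]mulr_natr divfK // pnatr_eq0.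
    apply: lerD; last by apply: nP; rewrite inE eqxx.
    apply: le_trans (ler_norm_sum _ _ _) _; apply: ler_sum => a _.
    by apply: nP; rewrite inE map_f ?mem_enum ?orbT.
- move=> w Lw; apply: eq_of_close => e e0; have [n _] := close w e 0%N e0.
  by rewrite /av big1 ?mulr0 // => j _; apply: kap0.
- exists (C ^+ 2) => w; apply/ler_addgt0Pr => e e0.
  have [n nn] := close w e (size w).+1 e0.
  have : av n w <= C ^+ 2 * expR (- ((size w)%:R * h)).
    rewrite /av ler_pdivrMl ?ltr0n; last exact: leq_trans nn.
    rewrite -[leRHS](_ : \sum_(j < n) (C ^+ 2 * expR (- ((size w)%:R * h))) = _); last first.
      by rewrite sumr_const card_ord [RHS]mulr_natl.
    by apply: ler_sum => j _; apply: kap_upper => //; have := ltn_ord j; lia.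
  by rewrite ler_norml => ? /andP[? ?]; lra.
- move=> M plM; have [T TP] := good_glue M; have [c c0 cP] := lower M plM T.
  exists c => // w gw; have := cP (size w) [:: w]; rewrite big_seq1; apply.
    by move=> z; rewrite inE => /eqP ->; rewrite leqnn leq_addr.
  move=> a b ga gb; have [g1 [g2 [g3 [s1 s2 s3 LW]]]] := TP a w b b ga gw gb gb.
  exists w, g1, g2; rewrite inE eqxx; split => //.
  by apply: (@L_sub [::] _ (g3 ++ b)); rewrite cat0s -!catA.
- move=> M plM; have [T TP] := good_glue M; have [c c0 cP] := lower M plM T.
  exists T.+1, c => // u v gu gv.
  (* Gaps of length at most T between [u] and [v], hence T.+1 summands over the gap length. *)
  pose Z := [seq u ++ g ++ v | i <- iota 0 T.+1, g <- words A i].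
  have -> : \sum_(i < T.+1) \sum_(g <- words A i) m (u ++ g ++ v) = \sum_(z <- Z) m z.
    rewrite big_allpairs_dep /= -(big_mkord xpredT (fun i => \sum_(g <- words A i) m (u ++ g ++ v))).
    by rewrite /index_iota subn0.
  apply: cP => [z /allpairsPdep [i [g []]]|a b ga gb].
    rewrite mem_iota add0n leq0n ltnS mem_words /= => iT /eqP gi ->.
    by rewrite !size_cat gi; lia.
  have [g1 [g2 [g3 [s1 s2 s3 LW]]]] := TP a u v b ga gu gv gb.
  exists (u ++ g2 ++ v), g1, g3; split => //; last by rewrite -!catA.
  apply/allpairsPdep; exists (size g2), g2; split => //; last by rewrite mem_words.
  by rewrite mem_iota add0n leq0n ltnS.
Qed.

End Existence.

(** * Images of languages under block maps *)

Section BlockMap.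
Variables (A B : Type) (r : nat) (phi : seq A -> B).

Definition block_map (x : seq A) : seq B :=
  [seq phi (take r.+1 (drop i x)) | i <- iota 0 (size x - r)].

Lemma size_block_map x : size (block_map x) = (size x - r)%N.
Proof. by rewrite size_map size_iota. Qed.

Lemma block_map_drop i x : block_map (drop i x) = drop i (block_map x).
Proof.
rewrite /block_map -map_drop drop_iota size_drop subnAC add0n -[i in RHS]addn0 iotaDl -map_comp.
by rewrite addn0; apply: eq_map => j /=; rewrite drop_drop addnC.
Qed.

Lemma block_map_take n x : (n <= size x)%N ->
  block_map (take n x) = take (n - r) (block_map x).
Proof.
move=> nx; rewrite /block_map -map_take take_iota size_takel //.
have -> : minn (n - r) (size x - r) = (n - r)%N by lia.
apply/eq_in_map => i; rewrite mem_iota add0n leq0n /= => ir; congr phi.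
rewrite -[n](@subnK i); last by lia.
by rewrite -take_drop take_takel //; lia.
Qed.

Lemma block_map_catl x y :
  block_map x = take (size x - r) (block_map (x ++ y)).
Proof. by rewrite -block_map_take ?take_size_cat // size_cat leq_addr. Qed.

Lemma block_map_catr x y : block_map y = drop (size x) (block_map (x ++ y)).
Proof. by rewrite -block_map_drop drop_size_cat. Qed.

Lemma block_map_cat x y : (r <= size x)%N ->
  block_map (x ++ y) = block_map x ++ block_map (drop (size x - r) x ++ y).
Proof.
move=> rx; rewrite -[LHS](cat_take_drop (size x - r)) -block_map_catl; congr (_ ++ _).
rewrite -block_map_drop drop_cat; case: ltnP => // H; rewrite [drop _ x]drop_oversize //.
by rewrite (_ : (size x - r - size x)%N = 0%N) ?drop0 //; lia.
Qed.

Lemma block_map_catD x y : (r <= size y)%N ->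
  block_map (x ++ y) = block_map (x ++ take r y) ++ block_map y.
Proof.
move=> ry; rewrite -[LHS](cat_take_drop (size x)) -block_map_catr; congr (_ ++ _).
have -> : x ++ take r y = take (size x + r) (x ++ y).
  by rewrite takeD take_size_cat // drop_size_cat.
by rewrite block_map_take ?addnK // size_cat leq_add2l.
Qed.

(** The windows that start in the last r letters of [x] or in [g] make up the new gap, which is r
    letters longer. *)
Lemma block_map_gap x g z : (r <= size x)%N -> (r <= size z)%N ->
  exists2 g', size g' = (size g + r)%N &
    block_map (x ++ g ++ z) = block_map x ++ g' ++ block_map z.
Proof.
move=> rx rz; pose y := drop (size x - r) x.
have sy : size y = r by rewrite size_drop; lia.
exists (block_map (y ++ g ++ take r z)).
  by rewrite size_block_map !size_cat size_takel // sy; lia.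
by rewrite block_map_cat // catA (block_map_catD _ rz) -catA.
Qed.

End BlockMap.

Section Coded.
Variables (T : Type) (A : Type) (t : nat).

(** [Bl a x] says that x is a block labelled a. It is a relation because a block may contain gap
    words that its label does not determine. *)
Fixpoint coded (Bl : T -> seq A -> Prop) (s : seq T) (a : T) (z : seq A) : Prop :=
  if s is b :: s' then
    exists x v z', [/\ Bl a x, size v = t, z = x ++ v ++ z' & coded Bl s' b z']
  else Bl a z.

Lemma size_coded Bl l s a z : (forall b x, Bl b x -> (size x + t)%N = l) ->
  coded Bl s a z -> (size z + t = (size s).+1 * l)%N.
Proof.
move=> sB; elim: s a z => [|b s IH] a z /=; first by move=> /sB; rewrite mul1n.
move=> [x [v [z' [/sB xl vt -> /IH]]]]; rewrite !size_cat vt; lia.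
Qed.

(** All blocks have the same length, so the image of each one sits at a known place of the image of
    z and reveals its label. *)
Lemma coded_decode (B : Type) r (phi : seq A -> B) Bl l s a z s' a' z' :
  (forall b x, Bl b x -> (size x + t)%N = l) ->
  (forall b b' x x', Bl b x -> Bl b' x' ->
     block_map r phi x = block_map r phi x' -> b = b') ->
  size s = size s' -> coded Bl s a z -> coded Bl s' a' z' ->
  block_map r phi z = block_map r phi z' -> a :: s = a' :: s'.
Proof.
move=> sB dB; elim: s s' a a' z z' => [|b s IH] [|b' s'] a a' z z' //=.
  by move=> _ az a'z' /(dB _ _ _ _ az a'z') ->.
move=> [ss] [x [v [y [ax vt -> sy]]]] [x' [v' [y' [ax' vt' -> sy']]]] E.
have xx : size x = size x' by have := sB _ _ ax; have := sB _ _ ax'; lia.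
have aa : a = a'.
  apply: (dB _ _ _ _ ax ax'); rewrite (block_map_catl r phi x (v ++ y)).
  by rewrite (block_map_catl r phi x' (v' ++ y')) E xx.
rewrite aa; congr (_ :: _); apply: (IH _ _ _ _ _ ss sy sy').
rewrite (block_map_catr r phi (x ++ v) y) (block_map_catr r phi (x' ++ v') y').
by rewrite -!catA E !size_cat xx vt vt'.
Qed.

End Coded.

(** * Submultiplicative word counts *)

Section Subexp.
Variable R : realType.

Lemma pow_bounded_le1 (x D : R) : 0 <= x -> (forall m, (0 < m)%N -> x ^+ m <= D) -> x <= 1.
Proof.
move=> x0 xD; rewrite leNgt; apply/negP => x1.
have lx : 0 < ln x by rewrite ln_gt0.
have xpos : 0 < x by lra.
have D0 : 0 < D by apply: lt_le_trans (xD 1%N isT); rewrite expr1.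
have [m mP] := nat_above (ln D / ln x).
have := xD m.+1 isT; rewrite -ler_ln ?posrE ?exprn_gt0 // lnXn //.
rewrite ler_pdivrMr // in mP.
rewrite -mulr_natl -natr1; lra.
Qed.

Variables (B : finType) (L : pred (seq B)).
Hypothesis L_sub : forall u v w, L (u ++ v ++ w) -> L v.
Hypothesis L_nonempty : forall n, exists2 w, size w = n & L w.
Let N n : R := cnt R L n.

Lemma cnt_ge1 n : 1 <= N n.
Proof.
have [w wn Lw] := L_nonempty n; rewrite /N /cnt ler1n -has_count.
by apply/hasP; exists w; rewrite ?mem_words ?wn.
Qed.

Lemma cnt_add a b : N (a + b) <= N a * N b.
Proof.
rewrite /N !cntE [leLHS]big_mkcond big_words_cat mulr_suml [leRHS]big_mkcond /=.
apply: ler_sum => u _; rewrite mul1r; case: ifPn => Lu; last first.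
  rewrite big1 // => v _; case: ifP => // /(@L_sub [::]); by rewrite (negbTE Lu).
rewrite [leRHS]big_mkcond; apply: ler_sum => v _.
case: ifP => [|_]; last by case: ifP.
by rewrite -[u ++ v]cats0 -catA => /L_sub ->.
Qed.

(** By subadditivity this infimum is also the limit of ln (N n) / n. As an infimum it gives e^(nh)
    <= N n at once. *)
Definition entropy_rate : R := inf [set ln (N n.+1) / n.+1%:R | n in [set: nat]]%classic.
Let h := entropy_rate.

Let rate_lb : lbound [set ln (N n.+1) / n.+1%:R | n in [set: nat]]%classic 0.
Proof. by move=> _ [n _ <-]; rewrite divr_ge0 // ln_ge0 // cnt_ge1. Qed.

Lemma entropy_rate_ge0 : 0 <= h.
Proof.
apply: lb_le_inf rate_lb.
by exists (ln (N 1) / 1%:R); exists 0%N.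
Qed.

Lemma cnt_lower n : expR (n%:R * h) <= N n.
Proof.
case: n => [|n]; first by rewrite mul0r expR0 cnt_ge1.
have N0 : 0 < N n.+1 by apply: lt_le_trans (cnt_ge1 _).
rewrite -(lnK N0) ler_expR -ler_pdivlMl // mulrC.
by apply: ge_inf; [exists 0; apply: rate_lb | exists n].
Qed.

(** The other half of Fekete's lemma: n is cut into pieces of one length l with rate below h + e,
    and D bounds the counts of the remainders. *)
Lemma cnt_subexp e : 0 < e -> exists2 D, 0 < D & forall n, N n <= D * expR (n%:R * (h + e)).
Proof.
move=> e0.
have hi : has_inf [set ln (N n.+1) / n.+1%:R | n in [set: nat]]%classic.
  by split; [exists (ln (N 1) / 1%:R), 0%N | exists 0; apply: rate_lb].
have [_ [k _ <-] kP] := inf_adherent e0 hi; rewrite -/h in kP.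
set l := k.+1 in kP.
have Nl : N l <= expR (l%:R * (h + e)).
  have N0 : 0 < N l by apply: lt_le_trans (cnt_ge1 _).
  rewrite -(lnK N0) ler_expR -ler_pdivrMl // mulrC; exact: ltW.
pose D := \sum_(i < l) N i.
have ND i : (i < l)%N -> N i <= D.
  move=> il; rewrite /D (bigD1 (Ordinal il)) //= lerDl; apply: sumr_ge0 => j _.
  by apply: le_trans (cnt_ge1 _).
have D1 : 1 <= D by apply: le_trans (cnt_ge1 0) (ND _ _).
exists D => [|n]; first exact: lt_le_trans D1.
have he : 0 <= h + e by rewrite addr_ge0 ?entropy_rate_ge0 // ltW.
have H q : N (q * l) <= expR ((q * l)%:R * (h + e)).
  elim: q => [|q IH]; first by rewrite mul0n mul0r expR0 /N cntE big_mkcond big_words0; case: ifP.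
  rewrite mulSn natrD mulrDl expRD; apply: le_trans (cnt_add _ _) _.
  by apply: ler_pM; rewrite ?ler0n.
rewrite {1}(divn_eq n l) addnC; apply: le_trans (cnt_add _ _) _.
apply: ler_pM; rewrite ?ler0n ?ND ?ltn_mod //.
apply: le_trans (H _) _; rewrite ler_expR ler_wpM2r // ler_nat; exact: leq_trunc_div.
Qed.

End Subexp.

(* [good M] plays the role of the words of G(M). *)
Definition gluing_language (R : realType) (A : finType) (L : pred (seq A))
    (good : nat -> pred (seq A)) (h : R) : Prop :=
  [/\ forall n, expR (n%:R * h) <= cnt R L n,
      exists C, forall n, cnt R L n <= C * expR (n%:R * h),
      forall M w, good M w -> L w,
      forall d : R, 0 < d -> exists M, forall n,
        cnt R (fun w => L w && ~~ good M w) n <= d * expR (n%:R * h) &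
      forall M, exists T, forall a u v c,
        good M a -> good M u -> good M v -> good M c ->
        exists g1 g2 g3, [/\ (size g1 <= T)%N, (size g2 <= T)%N, (size g3 <= T)%N &
          L (a ++ g1 ++ u ++ g2 ++ v ++ g3 ++ c)]].

(** * Gluing in the language of a factor *)

Section Factor.
Variables (R : realType) (A B : finType) (LX : seq A -> Prop) (LY : pred (seq B)).
Variables (r : nat) (phi : seq A -> B).
Let Phi := block_map r phi.
Hypothesis LX_sub : forall u v w, LX (u ++ v ++ w) -> LX v.
Hypothesis LX_nonempty : forall n, exists2 w, size w = n & LX w.
Hypothesis LY_sub : forall u v w, LY (u ++ v ++ w) -> LY v.
Hypothesis LY_Phi : forall x, LX x -> LY (Phi x).
Hypothesis Phi_LY : forall y, LY y -> exists x, [/\ LX x, size x = (size y + r)%N & Phi x = y].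

Variables (Cp G Cs : seq A -> Prop) (t : nat).
Hypothesis dec : forall x, LX x ->
  exists u v w, [/\ Cp u, G v, Cs w & x = u ++ v ++ w].
Hypothesis spec : forall (w : seq A) (ws : seq (seq A)), {in w :: ws, forall g, G g} ->
  exists2 z, LX z & coded t (fun g x => x = g) ws w z.
Definition thick M x := LX x /\ exists u v w, [/\ [/\ Cp u, G v & Cs w],
  (size u <= M)%N, (size w <= M)%N & x = u ++ v ++ w].
Hypothesis ext : forall M, exists tau, forall x, thick M x ->
  exists u w, [/\ (size u <= tau)%N, (size w <= tau)%N & G (u ++ x ++ w)].

Let N n : R := cnt R LY n.
Let h : R := entropy_rate R LY.

Let LY_nonempty n : exists2 w, size w = n & LY w.
Proof.
have [x xn /LY_Phi Lx] := LX_nonempty (n + r); exists (Phi x) => //.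
by rewrite size_block_map xn addnK.
Qed.

(** Every word belongs to G(M) for M its own length. Nothing is said about the lengths of [u] and
    [w]. *)
Lemma extend_to_G x : LX x -> exists u w, G (u ++ x ++ w).
Proof.
move=> Lx; have [u [v [w [Cu Gv Cw xE]]]] := dec Lx.
have [tau tauP] := ext (size x); have [|u' [w' [_ _ Gx]]] := tauP x.
  by split=> //; exists u, v, w; split; rewrite // xE !size_cat; lia.
by exists u', w'.
Qed.

(** Power trick: m labels in a row give (size bs)^m distinct words of Y of length at most ml, hence
    (size bs)^m <= D e^(ml(h+e)). Letting m grow removes D, then e tends to 0. *)
Lemma block_bound (T : eqType) (bs : seq T) (Bl : T -> seq A -> Prop) l : uniq bs ->
  (forall a s, {subset a :: s <= bs} -> exists2 z, LX z & coded t Bl s a z) ->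
  (forall b x, Bl b x -> (size x + t)%N = l) ->
  (forall b b' x x', Bl b x -> Bl b' x' -> Phi x = Phi x' -> b = b') ->
  (size bs)%:R <= expR (l%:R * h).
Proof.
move=> ubs ex sB dB.
have main (e : R) : 0 < e -> exists2 D, 0 < D &
   forall m, (0 < m)%N -> (size bs)%:R ^+ m <= D * expR (l%:R * (h + e)) ^+ m.
  move=> e0; have [D D0 DP] := cnt_subexp LY_sub LY_nonempty e0.
  exists D => // m m0; case: m m0 => // m _.
  have /choice[f fP] : forall s : seq T, exists z, size s = m.+1 -> {subset s <= bs} ->
      if s is a :: s' then LX z /\ coded t Bl s' a z else False.
    move=> [|a s]; first by exists [::].
    case: (pselect ({subset a :: s <= bs})) => [/ex[z Lz cz]|H]; first by exists z.
    by exists [::] => _ /H.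
  pose k := (m.+1 * l - t - r)%N.
  have fs s : s \in allseqs bs m.+1 -> [/\ size (Phi (f s)) = k & LY (Phi (f s))].
    rewrite mem_allseqs => /andP[/eqP sm /allP sb]; have := fP s sm sb.
    case: s sm sb => // a s [sm] sb [Lz cz]; split; last exact: LY_Phi.
    by have := size_coded sB cz; rewrite size_block_map sm /k; lia.
  have : (size (allseqs bs m.+1) <= count LY (words B k))%N.
    rewrite -size_filter; apply: (@size_le_inj _ _ _ _ (Phi \o f)).
    - exact: allseqs_uniq.
    - move=> s s'; rewrite !mem_allseqs => /andP[/eqP sm /allP sb] /andP[/eqP sm' /allP sb'].
      have := fP s sm sb; have := fP s' sm' sb' => /=.
      case: s sm sb => // a s [sm] sb; case: s' sm' sb' => // a' s' [sm'] sb'.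
      move=> [_ c'] [_ c] /=; apply: (coded_decode sB dB _ c c'); by rewrite sm sm'.
    - by move=> s /fs [/= sk Ls]; rewrite mem_filter mem_words sk eqxx andbT.
  rewrite size_allseqs -(ler_nat R) natrX => /le_trans; apply; apply: le_trans (DP k) _.
  rewrite ler_pM2l // -expRM_natl mulrA -natrM ler_expR ler_wpM2r //.
    by rewrite addr_ge0 ?entropy_rate_ge0 // ltW.
  by rewrite ler_nat /k; lia.
have [->|bs0] := posnP (size bs); first exact: expR_ge0.
have b0 : 0 < (size bs)%:R :> R by rewrite ltr0n.
rewrite -(lnK b0) ler_expR; apply/ler_addgt0Pr => e e0.
have e'0 : 0 < e / l.+1%:R by rewrite divr_gt0.
have [D D0 DP] := main _ e'0.
have : (size bs)%:R / expR (l%:R * (h + e / l.+1%:R)) <= 1.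
  apply: (@pow_bounded_le1 _ _ D) => [|m m0]; first by rewrite divr_ge0 ?expR_ge0.
  by rewrite expr_div_n ler_pdivrMr ?exprn_gt0 ?expR_gt0 // DP.
rewrite ler_pdivrMr ?expR_gt0 // mul1r -{1}(lnK b0) ler_expR => /le_trans; apply.
rewrite mulrDr lerD2l mulrCA; apply: ler_piMr; first exact: ltW.
by rewrite ler_pdivrMr // mul1r ler_nat; lia.
Qed.

Let imG j := [seq y <- words B (j - r) | `[< exists g, [/\ G g, size g = j & Phi g = y] >]].

Lemma coded_map (T : eqType) (f : T -> seq A) (Bl : T -> seq A -> Prop) s a z :
  {in a :: s, forall b, Bl b (f b)} ->
  coded t (fun g x => x = g) [seq f b | b <- s] (f a) z -> coded t Bl s a z.
Proof.
elim: s a z => [|b s IH] a z /= H; first by move=> ->; apply: H; rewrite inE.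
move=> [x [v [z' [-> vt -> cz]]]]; exists (f a), v, z'; split => //.
  by apply: H; rewrite inE eqxx.
by apply: IH cz => c cs; apply: H; rewrite inE cs orbT.
Qed.

(** The labels are the images, each with one chosen preimage in G. Counting the preimages themselves
    would bring in the entropy of X. *)
Lemma imG_bound j : (size (imG j))%:R <= expR ((j + t)%:R * h).
Proof.
have /choice[f fP] : forall y, exists g, y \in imG j -> [/\ G g, size g = j & Phi g = y].
  move=> y; case: (boolP (y \in imG j)) => [|_]; last by exists [::].
  by rewrite mem_filter => /andP[/asboolP[g gP] _]; exists g.
apply: (@block_bound _ (imG j) (fun y x => size x = j /\ Phi x = y)).
- by rewrite filter_uniq // words_uniq.
- move=> a s sub; have [|z Lz cz] := @spec (f a) [seq f b | b <- s].
    by rewrite -map_cons => _ /mapP[b /sub /fP [? _ _] ->].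
  by exists z => //; apply: coded_map cz => b /sub /fP [].
- by move=> b x [-> _].
- by move=> b b' x x' [_ <-] [_ <-].
Qed.

(* Equal entropy on both orders of two blocks a, b forces the images of the two
   orders to agree, which makes the image of b periodic. *)
Lemma zero_entropy_periodic : h = 0 ->
  exists2 l, (0 < l)%N & forall y, LY y -> forall (b : B) i, (i + l < size y)%N ->
    nth b y (i + l) = nth b y i.
Proof.
move=> h0.
have [a Ga a0] : exists2 a, G a & (0 < size a)%N.
  have [x x1 /extend_to_G [u [w Gx]]] := LX_nonempty 1.
  by exists (u ++ x ++ w) => //; rewrite !size_cat x1; lia.
exists (size a + t)%N; first by lia.
have perG g : G g -> forall b i, (i + (size a + t) < size g - r)%N ->
    nth b (Phi g) (i + (size a + t)) = nth b (Phi g) i.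
  move=> Gg.
  have [v [v' [vt v't E]]] : exists v v', [/\ size v = t, size v' = t &
      Phi (a ++ v ++ g) = Phi (g ++ v' ++ a)].
    (* Otherwise the orders a v g and g v a are told apart by their images, whatever the gap words,
       and can be concatenated freely: two labels, against the bound e^0 = 1. *)
    apply: contrapT => noE.
    pose first (c : bool) := if c then a else g.
    pose second (c : bool) := if c then g else a.
    pose Bl c x := exists2 v, size v = t & x = first c ++ v ++ second c.
    suff : (size [:: true; false])%:R <= expR ((size a + size g + t + t)%:R * h).
      by rewrite h0 mulr0 expR0 (ler_nat R 2 1).
    apply: (@block_bound _ _ Bl) => //.
    - move=> c s _; pose fl := flatten [seq [:: first d; second d] | d <- s].
      have [|z Lz cz] := @spec (first c) (second c :: fl).
        move=> w; rewrite !inE => /orP[/eqP->|/orP[/eqP->|/flattenP[_ /mapP[d _ ->]]]].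
        + by rewrite /first; case: c.
        + by rewrite /second; case: c.
        + by rewrite !inE /first /second => /orP[] /eqP ->; case: d.
      exists z => //; rewrite {}/fl {Lz} in cz.
      elim: s c z cz => [|d s IH] c z /=.
        by move=> [x [v [z' [-> vt -> ->]]]]; exists v.
      move=> [x [v [z' [-> vt -> [x' [v' [z'' [-> vt' -> /IH cz]]]]]]]].
      exists (first c ++ v ++ second c), v', z''; split => //; last by rewrite -!catA.
      by exists v.
    - by move=> c x [v vt ->]; rewrite !size_cat vt /first /second; case: c; lia.
    - move=> [] [] x x' // [v vt ->] [v' vt' ->] /= E; case: noE.
        by exists v, v'.
      by exists v', v.
  (* The image of g is read at place |a| + t in the first word and at place 0 in the second, so it
     agrees with its own shift by |a| + t, a number that does not depend on g. *)
  move=> b i il; have P1 : Phi g = drop (size a + t) (Phi (a ++ v ++ g)).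
    by rewrite catA /Phi {1}(block_map_catr r phi (a ++ v) g) size_cat vt.
  have P2 : Phi g = take (size g - r) (Phi (g ++ v' ++ a)).
    by rewrite /Phi -block_map_catl.
  rewrite {1}P2 nth_take // P1 nth_drop E addnC //.
move=> y Ly b i iy; have [x [Lx xy xE]] := Phi_LY Ly.
have [u [w Gx]] := extend_to_G Lx.
have yE : y = take (size y) (drop (size u) (Phi (u ++ x ++ w))).
  rewrite -{1}xE /Phi (block_map_catl r phi x w) (block_map_catr r phi u (x ++ w)).
  by congr take; lia.
have ny j : (j < size y)%N -> nth b y j = nth b (Phi (u ++ x ++ w)) (size u + j).
  by move=> jy; rewrite {1}yE nth_take // nth_drop.
rewrite !ny //; last by lia.
rewrite addnA perG // !size_cat xy; lia.
Qed.

(** Four words, because the lower bound on pairs counts words in which a pair stands between two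
    further good words. *)
Lemma glue_images u1 x1 w1 u2 x2 w2 u3 x3 w3 u4 x4 w4 :
  G (u1 ++ x1 ++ w1) -> G (u2 ++ x2 ++ w2) -> G (u3 ++ x3 ++ w3) -> G (u4 ++ x4 ++ w4) ->
  (r <= size x1)%N -> (r <= size x2)%N -> (r <= size x3)%N -> (r <= size x4)%N ->
  exists e1 e2 e3, [/\ size e1 = (size w1 + t + size u2 + r)%N,
    size e2 = (size w2 + t + size u3 + r)%N, size e3 = (size w3 + t + size u4 + r)%N &
    LY (Phi x1 ++ e1 ++ Phi x2 ++ e2 ++ Phi x3 ++ e3 ++ Phi x4)].
Proof.
move=> G1 G2 G3 G4 r1 r2 r3 r4.
have [|z Lz] := @spec (u1 ++ x1 ++ w1) [:: u2 ++ x2 ++ w2; u3 ++ x3 ++ w3; u4 ++ x4 ++ w4].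
  by move=> g; rewrite !inE => /orP[/eqP->//|/orP[/eqP->//|/orP[/eqP->//|/eqP->//]]].
move=> /= [x1' [v1 [z1 [-> s1 zE [x2' [v2 [z2 [-> s2 z1E [x3' [v3 [z3 [-> s3 z2E z3E]]]]]]]]]]]].
rewrite {}z1E {}z2E {}z3E in zE.
pose g1 := w1 ++ v1 ++ u2; pose g2 := w2 ++ v2 ++ u3; pose g3 := w3 ++ v3 ++ u4.
have Lx : LX (x1 ++ g1 ++ x2 ++ g2 ++ x3 ++ g3 ++ x4).
  by apply: (@LX_sub u1 _ w4); move: Lz; rewrite zE /g1 /g2 /g3 -!catA.
have [e3 se3 E3] := @block_map_gap _ _ r phi x3 g3 x4 r3 r4.
have [|e2 se2 E2] := @block_map_gap _ _ r phi x2 g2 (x3 ++ g3 ++ x4) r2.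
  by rewrite size_cat; lia.
have [|e1 se1 E1] := @block_map_gap _ _ r phi x1 g1 (x2 ++ g2 ++ x3 ++ g3 ++ x4) r1.
  by rewrite size_cat; lia.
exists e1, e2, e3; split; rewrite ?se1 ?se2 ?se3 /g1 /g2 /g3 ?size_cat ?s1 ?s2 ?s3; try lia.
by have := LY_Phi Lx; rewrite /Phi E1 E2 E3.
Qed.

(** A word of Y is determined by its first l letters, so the counts are bounded. Extending to G
    gives no bound on the gaps, but periodicity allows them to be shortened. *)
Lemma zero_entropy_gluing : h = 0 -> gluing_language LY (fun=> LY) h.
Proof.
move=> h0; have [l l0 per] := zero_entropy_periodic h0.
have [[|b ?] // _ _] := LY_nonempty 1.
have inj w w' : LY w -> LY w' -> size w = size w' -> take l w = take l w' -> w = w'.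
  move=> Lw Lw' ww tw; apply: (@eq_from_nth _ b) => //.
  elim/ltn_ind => i IH iw; have [il|li] := ltnP i l.
    by rewrite -(nth_take b il) tw nth_take.
  by rewrite -(subnK li) !per ?subnK -?ww // IH //; lia.
(* By periodicity, deleting l letters from the gap leaves a prefix of the original word. *)
have shorten a e c : LY (a ++ e ++ c) -> exists2 e', (size e' <= l)%N & LY (a ++ e' ++ c).
  have [n] := ubnP (size e); elim: n e => // n IH e en Le.
  have [?|le] := leqP (size e) l; first by exists e.
  apply: (IH (drop l e)); first by rewrite size_drop; lia.
  pose z := a ++ e ++ c.
  rewrite (_ : a ++ _ = take (size z - l) z).
    by apply: (@LY_sub [::] _ (drop (size z - l) z)); rewrite cat_take_drop.
  apply: (@eq_from_nth _ b).
    by rewrite size_takel ?leq_subr // /z !size_cat size_drop; lia.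
  move=> i; rewrite !size_cat size_drop => iz.
  rewrite nth_take; last by lia.
  have [ia|ai] := ltnP i (size a); first by rewrite /z !nth_cat ia.
  rewrite -[RHS]per // -/z; last by rewrite /z !size_cat; lia.
  rewrite /z !nth_cat; have -> : (i < size a)%N = false by lia.
  have -> : (i + l < size a)%N = false by lia.
  rewrite size_drop.
  rewrite nth_drop.
  have -> : (l + (i - size a) = i + l - size a)%N by lia.
  case: ltnP => ie; case: ltnP => ie' //; try lia.
  by congr nth; lia.
split.
- exact: cnt_lower.
- exists (size (flatten [seq words B i | i <- iota 0 l.+1]))%:R => n.
  rewrite h0 mulr0 expR0 mulr1 /N /cnt ler_nat -size_filter.
  apply: (@size_le_inj _ _ _ _ (take l)); first by rewrite filter_uniq // words_uniq.
    move=> w w'; rewrite !mem_filter !mem_words => /andP[Lw /eqP wn] /andP[Lw' /eqP w'n].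
    by apply: inj => //; rewrite wn w'n.
  move=> w _; apply/flattenP; exists (words B (size (take l w))); last by rewrite mem_words.
  apply/mapP; exists (size (take l w)) => //.
  by rewrite mem_iota add0n leq0n ltnS size_take_min geq_minl.
- by [].
- move=> d d0; exists 0%N => n; rewrite /cnt (eq_count (a2 := pred0)) ?count_pred0.
    by rewrite mulr_ge0 ?expR_ge0 // ltW.
  by move=> w /=; rewrite andbN.
- move=> _; exists l => y1 y2 y3 y4.
  move=> /Phi_LY [x1 [L1 s1 <-]] /Phi_LY [x2 [L2 s2 <-]].
  move=> /Phi_LY [x3 [L3 s3 <-]] /Phi_LY [x4 [L4 s4 <-]].
  have [u1 [w1 G1]] := extend_to_G L1; have [u2 [w2 G2]] := extend_to_G L2.
  have [u3 [w3 G3]] := extend_to_G L3; have [u4 [w4 G4]] := extend_to_G L4.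
  have [||||e1 [e2 [e3 [_ _ _ Le]]]] := glue_images G1 G2 G3 G4; try lia.
  have [e1' se1 {}Le] := shorten _ _ _ Le.
  have [|e2' se2 {}Le] := shorten (Phi x1 ++ e1' ++ Phi x2) e2 (Phi x3 ++ e3 ++ Phi x4).
    by rewrite -!catA.
  have [|e3' se3 {}Le] := shorten (Phi x1 ++ e1' ++ Phi x2 ++ e2' ++ Phi x3) e3 (Phi x4).
    by rewrite -!catA; rewrite -!catA in Le.
  by exists e1', e2', e3'; split => //; rewrite -!catA in Le.
Qed.

(** The bound r <= size x is the one [block_map_gap] requires; a word of Y with n letters lifts to n
    + r letters, so all lifts satisfy it. *)
Definition good M : pred (seq B) := fun y =>
  `[< exists x, [/\ thick M x, (r <= size x)%N & Phi x = y] >].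

Lemma goodP M y : reflect (exists x, [/\ thick M x, (r <= size x)%N & Phi x = y]) (good M y).
Proof. exact: asboolP. Qed.

Lemma good_LY M y : good M y -> LY y.
Proof. by move=> /goodP [x [[Lx _] _ <-]]; apply: LY_Phi. Qed.

Lemma good_glue M : exists T, forall a u v c,
  good M a -> good M u -> good M v -> good M c ->
  exists g1 g2 g3, [/\ (size g1 <= T)%N, (size g2 <= T)%N, (size g3 <= T)%N &
    LY (a ++ g1 ++ u ++ g2 ++ v ++ g3 ++ c)].
Proof.
have [tau tauP] := ext M; exists (2 * tau + t + r)%N => y1 y2 y3 y4.
move=> /goodP [x1 [T1 r1 <-]] /goodP [x2 [T2 r2 <-]].
move=> /goodP [x3 [T3 r3 <-]] /goodP [x4 [T4 r4 <-]].
have [u1 [w1 [su1 sw1 G1]]] := tauP x1 T1.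
have [u2 [w2 [su2 sw2 G2]]] := tauP x2 T2.
have [u3 [w3 [su3 sw3 G3]]] := tauP x3 T3.
have [u4 [w4 [su4 sw4 G4]]] := tauP x4 T4.
have [e1 [e2 [e3 [s1 s2 s3 Le]]]] := glue_images G1 G2 G3 G4 r1 r2 r3 r4.
by exists e1, e2, e3; split; rewrite ?s1 ?s2 ?s3 //; lia.
Qed.

(** Prepares the periodic points: a periodic point through g alone has an image that contains y,
    with a period exceeding |y| by a bounded amount. *)
Lemma good_in_G M : exists T, forall y, good M y -> exists g j,
  [/\ G g, (size g <= size y + T)%N, (j <= T)%N, (j + size y + r <= size g)%N &
    y = take (size y) (drop j (Phi g))].
Proof.
have [tau tauP] := ext M; exists (2 * tau + r)%N => y /goodP [x [Tx rx <-]].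
have [u [w [su sw Gx]]] := tauP x Tx; exists (u ++ x ++ w), (size u).
rewrite !size_cat size_block_map; split => //; try lia.
by rewrite /Phi -block_map_catr -block_map_catl.
Qed.

(** * Positive entropy: counting by prefix, core and suffix *)

Section Positive.
Hypothesis h_gt0 : 0 < h.
Hypothesis small : forall e : R, 0 < e -> exists D : R, forall n,
  cnt R (fun w => `[< Cp w \/ Cs w >]) n <= D * expR (n%:R * e).

(** At most D e^(ih/2) prefixes of length i, times the gain e^(-ih) from a core shorter by i
    letters: the net factor is x^i, summable since h > 0. *)
Let x : R := expR (- (h / 2)).

Let short : seq (seq A) := flatten [seq words A i | i <- iota 0 r.+1].
Let mem_short v : (size v <= r)%N -> v \in short.
Proof.
move=> vr; apply/flattenP; exists (words A (size v)); last by rewrite mem_words.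
by apply/mapP; exists (size v); rewrite // mem_iota add0n leq0n ltnS.
Qed.

(** Recovers the image of u v w from u, w, the image of v and the first and last r letters a, b of
    v. If v has fewer than r letters, a is v itself. *)
Let decode (c : seq A * seq A * seq B * (seq A * seq A)) : seq B :=
  let: (u, w, z, (a, b)) := c in
  if (size a < r)%N then Phi (u ++ a ++ w) else Phi (u ++ a) ++ z ++ Phi (b ++ w).

Let piece (C : seq A -> Prop) i := [seq w <- words A i | `[< C w >]].

(** P constrains the lengths of prefix and suffix: always true for counting all words, one of them
    above M for the words that are not good. *)
Let cover (P : nat -> nat -> bool) n (y : seq B) := exists u v w,
  [/\ [/\ Cp u, G v & Cs w], P (size u) (size w),
      (size u + size v + size w = n + r)%N & y = Phi (u ++ v ++ w)].

Let geom M n : \sum_(i < n) (M <= i)%:R * x ^+ i <= x ^+ M / (1 - x).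
Proof.
have x1 : x < 1 by rewrite expR_lt1 oppr_lt0 divr_gt0.
have x0 : 0 < x by apply: expR_gt0.
rewrite ler_pdivlMr ?subr_gt0 //.
suff -> : (\sum_(i < n) (M <= i)%:R * x ^+ i) * (1 - x) = x ^+ M - x ^+ maxn n M.
  by rewrite gerBl exprn_ge0 // ltW.
elim: n => [|n IH]; first by rewrite big_ord0 mul0r max0n subrr.
rewrite big_ord_recr /= mulrDl IH; case: (boolP (M <= n)%N) => nM.
  rewrite (maxn_idPl nM) (maxn_idPl (leqW nM)) exprS /=; ring.
by rewrite -ltnNge in nM; rewrite (maxn_idPr (ltnW nM)) (maxn_idPr nM) !mul0r addr0.
Qed.

(** For lengths i and k the candidates come from at most D e^(ih/2) prefixes, D e^(kh/2) suffixes,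
    e^((n+r-i-k+t)h) images of words of G and Q^2 pairs of border blocks; the product is a constant
    times e^(nh) x^(i+k). *)
Lemma cover_bound : exists2 K, 0 < K & forall P n,
  cnt R (fun y => `[< cover P n y >]) n <=
  K * expR (n%:R * h) * \sum_(i < (n + r).+1) \sum_(k < (n + r).+1) (P i k)%:R * (x ^+ i * x ^+ k).
Proof.
have [D' D'P] := small (divr_gt0 h_gt0 (ltr0n _ 2)).
pose D := Num.max 1 D'.
have D1 : 1 <= D by rewrite le_max lexx.
have D0 : 0 < D by apply: lt_le_trans D1.
have sizeC C n : (forall w, C w -> Cp w \/ Cs w) ->
    (size (piece C n))%:R <= D * expR (n%:R * (h / 2)).
  move=> CC; apply: le_trans (_ : _ <= D' * expR (n%:R * (h / 2))) _; last first.
    by rewrite ler_wpM2r ?expR_ge0 // le_max lexx orbT.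
  apply: le_trans (D'P n); rewrite /piece size_filter /cnt ler_nat.
  by apply: sub_count => w /asboolP /CC ?; apply/asboolP.
pose Q : R := (size short).+1%:R.
exists (D ^+ 2 * Q ^+ 2 * expR ((r + t)%:R * h)) => [|P n].
  by rewrite !mulr_gt0 ?exprn_gt0 ?expR_gt0.
pose cand i k := if P i k && (i + k <= n + r)%N then
  [seq decode (c, d) | c <- [seq (uw, z) | uw <- [seq (u, w) | u <- piece Cp i, w <- piece Cs k],
                                          z <- imG (n + r - i - k)],
                       d <- [seq (a, b) | a <- short, b <- short]] else [::].
have [m mE] : exists m, (n + r).+1 = m by eexists.
rewrite mE.
have szc i k : (size (cand i k))%:R <= (P i k)%:R * (x ^+ i * x ^+ k) *
    (D ^+ 2 * Q ^+ 2 * expR ((r + t)%:R * h) * expR (n%:R * h)).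
  rewrite /cand; case: (P i k); last by rewrite andFb !mul0r.
  rewrite andTb mul1r; case: (boolP (i + k <= n + r)%N) => ik; last first.
    by do ?[apply: mulr_ge0]; rewrite ?exprn_ge0 ?expR_ge0 // ltW.
  rewrite size_allpairs [X in (X * _)%N]size_allpairs [X in (X * _ * _)%N]size_allpairs.
  rewrite [X in (_ * X)%N]size_allpairs !natrM.
  have s1 := @sizeC Cp i (fun w Cw => or_introl Cw).
  have s2 := @sizeC Cs k (fun w Cw => or_intror Cw).
  have s3 := imG_bound (n + r - i - k).
  have s4 : (size short)%:R <= Q by rewrite ler_nat.
  have -> : x ^+ i * x ^+ k * (D ^+ 2 * Q ^+ 2 * expR ((r + t)%:R * h) * expR (n%:R * h)) =
     D * expR (i%:R * (h / 2)) * (D * expR (k%:R * (h / 2)))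
     * expR ((n + r - i - k + t)%:R * h) * (Q * Q).
    rewrite /x -!expRM_natl.
    transitivity (D ^+ 2 * Q ^+ 2 * (expR (i%:R * - (h / 2)) * expR (k%:R * - (h / 2)) *
      expR ((r + t)%:R * h) * expR (n%:R * h))); first by ring.
    transitivity (D ^+ 2 * Q ^+ 2 * (expR (i%:R * (h / 2)) * expR (k%:R * (h / 2)) *
      expR ((n + r - i - k + t)%:R * h))); last by ring.
    rewrite -!expRD; congr (_ * expR _).
    have E : (n + r + t = n + r - i - k + t + i + k)%N by lia.
    have -> : (n + r - i - k + t)%:R = n%:R + r%:R + t%:R - i%:R - k%:R :> R.
      by rewrite -!natrD E !natrD; ring.
    by rewrite natrD; field.
  by apply: ler_pM; rewrite ?mulr_ge0 //; apply: ler_pM; rewrite ?mulr_ge0 //; apply: ler_pM.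
have : cnt R (fun y => `[< cover P n y >]) n <=
    (size (flatten [seq flatten [seq cand i k | k <- iota 0 m] | i <- iota 0 m]))%:R.
  rewrite /cnt -size_filter ler_nat; apply: uniq_leq_size.
    by rewrite filter_uniq // words_uniq.
  move=> y; rewrite mem_filter mem_words => /andP[/asboolP[u [v [w]]]].
  move=> [[Cu Gv Cw] Puw suvw yE] sy.
  apply/flattenP; exists (flatten [seq cand (size u) k | k <- iota 0 m]).
    by apply/mapP; exists (size u) => //; rewrite mem_iota -mE; lia.
  apply/flattenP; exists (cand (size u) (size w)).
    by apply/mapP; exists (size w) => //; rewrite mem_iota -mE; lia.
  have uw : (size u + size w <= n + r)%N by lia.
  rewrite /cand Puw uw andTb; apply/allpairsP.
  have jE : (n + r - size u - size w = size v)%N by lia.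
  exists ((u, w, Phi v), (take r v, drop (size v - r) v)); split.
  - apply/allpairsP; exists ((u, w), Phi v); split => //=.
      by apply/allpairsP; exists (u, w); split; rewrite // mem_filter mem_words eqxx andbT;
        apply/asboolP.
    rewrite jE mem_filter mem_words size_block_map eqxx andbT; apply/asboolP; by exists v.
  - apply/allpairsP; exists (take r v, drop (size v - r) v); split => //; apply: mem_short.
      by rewrite size_take /=; case: ltnP => // /ltnW.
    by rewrite /= size_drop; lia.
  - rewrite /= yE size_take; case: (ltnP r (size v)) => rv.
      rewrite ltnn; have rv' := ltnW rv.
      rewrite {1}/Phi (block_map_catD _ _ (y := v ++ w)); last by rewrite size_cat; lia.
      by rewrite takel_cat // (block_map_cat _ _ rv').
    case: (ltnP (size v) r) => vr; first by rewrite take_oversize.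
    rewrite take_oversize // (_ : (size v - r = 0)%N) ?drop0; last by lia.
    rewrite {1}/Phi (block_map_catD _ _ (y := v ++ w)); last by rewrite size_cat; lia.
    rewrite takel_cat // take_oversize //.
    have -> : Phi v = [::] by apply: size0nil; rewrite size_block_map; lia.
    by [].
move=> /le_trans; apply.
rewrite size_flatten /shape -map_comp sumnE big_map natr_sum.
rewrite -(big_mkord xpredT (fun i => \sum_(k < m) (P i k)%:R * (x ^+ i * x ^+ k))).
rewrite mulr_sumr /index_iota subn0; apply: ler_sum => i _ /=.
rewrite size_flatten /shape -map_comp sumnE big_map natr_sum.
rewrite -(big_mkord xpredT (fun k => (P i k)%:R * (x ^+ i * x ^+ k))).
rewrite mulr_sumr /index_iota subn0; apply: ler_sum => k _ /=.
by rewrite mulrC; apply: szc.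
Qed.

Lemma cnt_upper : exists C, forall n, N n <= C * expR (n%:R * h).
Proof.
have [K K0 KP] := cover_bound; exists (K * (1 - x)^-1 ^+ 2) => n.
have x0 : 0 < x by apply: expR_gt0.
apply: (@le_trans _ _ (cnt R (fun y => `[< cover (fun _ _ => true) n y >]) n)).
  rewrite /N /cnt ler_nat -!size_filter; apply: uniq_leq_size.
    by rewrite filter_uniq // words_uniq.
  move=> y; rewrite !mem_filter mem_words => /andP[Ly /eqP yn]; rewrite yn eqxx andbT.
  have [z [Lz zs zE]] := Phi_LY Ly; have [u [v [w [Cu Gv Cw xE]]]] := dec Lz.
  apply/asboolP; exists u, v, w; split => //; last by rewrite -xE.
  by rewrite -yn -zs xE !size_cat addnA.
apply: le_trans (KP _ n) _; rewrite mulrAC ler_wpM2r ?expR_ge0 // ler_pM2l //.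
have g := geom 0 (n + r).+1; rewrite expr0 mul1r in g.
under eq_bigr do under eq_bigr do rewrite mul1r.
under eq_bigr do rewrite -mulr_sumr.
rewrite -mulr_suml expr2.
have E : \sum_(i < (n + r).+1) (0 <= i)%:R * x ^+ i = \sum_(i < (n + r).+1) x ^+ i.
  by apply: eq_bigr => i _; rewrite leq0n mul1r.
rewrite E in g.
by apply: ler_pM => //; apply: sumr_ge0 => i _; rewrite exprn_ge0 // ltW.
Qed.

(** If a word is not good, each splitting of a lift has a prefix or suffix longer than M, so only
    the tail of the geometric series is left. *)
Lemma good_exhaust d : 0 < d -> exists M, forall n,
  cnt R (fun w => LY w && ~~ good M w) n <= d * expR (n%:R * h).
Proof.
move=> d0; have [K K0 KP] := cover_bound.
have x1 : x < 1 by rewrite expR_lt1 oppr_lt0 divr_gt0.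
have x0 : 0 < x by apply: expR_gt0.
have y0 : 0 < (1 - x)^-1 by rewrite invr_gt0 subr_gt0.
(* The double sum will be at most 2d' / (1 - x)^2. *)
pose d' := d / (2 * K * (1 - x)^-1 ^+ 2).
have d'0 : 0 < d' by rewrite divr_gt0 // !mulr_gt0 // exprn_gt0.
have [M MP] : exists M, x ^+ M <= d'.
  have [M MP] := nat_above (- ln d' / (h / 2)); exists M.
  rewrite -(lnK d'0) /x -expRM_natl ler_expR.
  by move: MP; rewrite ler_pdivrMr ?divr_gt0 //; lra.
exists M => n; pose P i k := (M < i)%N || (M < k)%N.
apply: (@le_trans _ _ (cnt R (fun y => `[< cover P n y >]) n)).
  rewrite /cnt ler_nat -!size_filter; apply: uniq_leq_size.
    by rewrite filter_uniq // words_uniq.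
  move=> y; rewrite !mem_filter mem_words => /andP[/andP[Ly /goodP ngy] /eqP yn].
  rewrite yn eqxx andbT.
  have [z [Lz zs zE]] := Phi_LY Ly; have [u [v [w [Cu Gv Cw xE]]]] := dec Lz.
  apply/asboolP; exists u, v, w; split => //; last by rewrite -xE.
    rewrite /P; case: (leqP (size u) M) => uM //=; rewrite ltnNge; apply/negP => wM.
    apply: ngy; exists z; split => //; last by rewrite zs leq_addl.
    by split=> //; exists u, v, w.
  by rewrite -yn -zs xE !size_cat addnA.
apply: le_trans (KP _ n) _; rewrite mulrAC ler_wpM2r ?expR_ge0 //.
set m := (n + r).+1.
have S0 : 0 <= \sum_(i < m) x ^+ i by apply: sumr_ge0 => i _; rewrite exprn_ge0 // ltW.
have S1 : \sum_(i < m) x ^+ i <= (1 - x)^-1.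
  have g := geom 0 m; rewrite expr0 mul1r in g.
  have E : \sum_(i < m) (0 <= i)%:R * x ^+ i = \sum_(i < m) x ^+ i.
    by apply: eq_bigr => i _; rewrite leq0n mul1r.
  by rewrite E in g.
have S2 : \sum_(i < m) (M < i)%:R * x ^+ i <= d' / (1 - x).
  apply: le_trans (geom M.+1 m) _; rewrite ler_wpM2r ?(ltW y0) //.
  apply: le_trans MP; rewrite exprS ler_piMl ?exprn_ge0 // ltW //.
have S3 : 0 <= \sum_(i < m) (M < i)%:R * x ^+ i.
  by apply: sumr_ge0 => i _; rewrite mulr_ge0 // exprn_ge0 // ltW.
apply: (@le_trans _ _ (K * (2 * ((\sum_(i < m) (M < i)%:R * x ^+ i) * \sum_(i < m) x ^+ i)))).
  rewrite ler_pM2l // mulr_natl mulr2n [X in _ <= _ + X]mulrC !mulr_suml -big_split /=.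
  apply: ler_sum => i _; rewrite !mulr_sumr -big_split /=; apply: ler_sum => k _.
  have ? : 0 <= x ^+ i * x ^+ k by rewrite mulr_ge0 ?exprn_ge0 // ltW.
  by rewrite /P; case: (M < i)%N; case: (M < k)%N; rewrite /= ?mul0r ?mulr0 ?mul1r; lra.
apply: (@le_trans _ _ (K * (2 * (d' / (1 - x) * (1 - x)^-1)))).
  by rewrite ler_pM2l // ler_pM2l //; apply: ler_pM.
rewrite /d' le_eqVlt; apply/orP; left; apply/eqP; field.
by rewrite !gt_eqF // subr_gt0.
Qed.

End Positive.

(** The alternative records where periodic points come from: in entropy zero all of Y is periodic,
    otherwise a good word lies in the image of a slightly longer word of G. *)
Lemma factor_gluing_language :
  (forall e : R, 0 < e -> exists D : R, forall n,
    cnt R (fun w => `[< Cp w \/ Cs w >]) n <= D * expR (n%:R * e)) ->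
  exists2 good', gluing_language LY good' h &
    (exists2 l, (0 < l)%N & forall y, LY y -> forall (b : B) i, (i + l < size y)%N ->
       nth b y (i + l) = nth b y i) \/
    forall M, exists T, forall y, good' M y -> exists g j,
      [/\ G g, (size g <= size y + T)%N, (j <= T)%N, (j + size y + r <= size g)%N &
        y = take (size y) (drop j (Phi g))].
Proof.
move=> small; have := entropy_rate_ge0 R LY_nonempty.
rewrite le_eqVlt => /orP[/eqP h0|h0].
  exists (fun=> LY); first by apply: zero_entropy_gluing; rewrite /h -h0.
  by left; apply: zero_entropy_periodic; rewrite /h -h0.
exists good; last by right; exact: good_in_G.
split; [exact: cnt_lower | exact: cnt_upper | exact: good_LY | exact: good_exhaust |].
exact: good_glue.
Qed.

End Factor.

(** * Windows and the topology of the full shift *)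

Section Windows.
Variables (s : sidedness) (p : nat).
Implicit Types (x y : fullshift s p) (i : position s).

Lemma size_subword x i n : size (subword x i n) = n.
Proof. exact: size_mkseq. Qed.

Lemma nth_subword a x i n k : (k < n)%N -> nth a (subword x i n) k = x (i + k%:R).
Proof. exact: nth_mkseq. Qed.

Lemma subword_cat x i m n :
  subword x i (m + n) = subword x i m ++ subword x (i + m%:R) n.
Proof.
rewrite /subword /mkseq iotaD map_cat add0n; congr (_ ++ _).
rewrite -{1}[m]addn0 iotaDl -map_comp; apply: eq_map => k /=.
by rewrite natrD addrA.
Qed.

Lemma iter_shiftE x k i : iter k left_shift x i = x (i + k%:R).
Proof.
elim: k i => [|k IH] i; first by rewrite addr0.
by rewrite /= {1}/left_shift IH -natr1 -addrA [1 + _]addrC.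
Qed.

Lemma subword_iter_shift x k i n :
  subword (iter k left_shift x) i n = subword x (i + k%:R) n.
Proof.
by apply: eq_mkseq => j; rewrite iter_shiftE addrAC.
Qed.

Lemma take_subword x i m n : (m <= n)%N -> take m (subword x i n) = subword x i m.
Proof. by move=> /subnKC <-; rewrite subword_cat take_size_cat ?size_subword. Qed.

Lemma drop_subword x i m n : drop m (subword x i n) = subword x (i + m%:R) (n - m).
Proof.
have [mn|/ltnW nm] := leqP m n.
  by rewrite -{1}(subnKC mn) subword_cat drop_size_cat ?size_subword.
by rewrite drop_oversize ?size_subword // (eqP (nm : n - m == 0)%N).
Qed.

Lemma subword1 x i : subword x i 1 = [:: x i].
Proof. by rewrite -[RHS]/([:: x i]) -{2}(addr0 i). Qed.

(* The windows exhaust the coordinates: [0, n) for nat, and [-n/2, n - n/2) for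
   int, so that [window_start] of an enlarged window is the old one or one less. *)
Definition window_start (n : nat) : position s :=
  match s return position s with one_sided => 0%N | two_sided => - (n./2)%:Z end.

Definition window x n := subword x (window_start n) n.

Lemma size_window x n : size (window x n) = n.
Proof. exact: size_subword. Qed.

Definition grows_left (n : nat) : bool := if s is two_sided then odd n else false.

Lemma window_startS n :
  window_start n = window_start n.+1 + (grows_left n)%:R.
Proof.
rewrite /window_start /grows_left; case: s => //=.
rewrite uphalf_half; case: (odd n) => /=; last by rewrite add0n addr0.
by rewrite add1n -addn1 PoszD opprD addrNK.
Qed.

Lemma windowS x n : window x n.+1 =
  if grows_left n then x (window_start n.+1) :: window x n
  else rcons (window x n) (x (window_start n + n%:R)).
Proof.
rewrite /window (window_startS n); case: (grows_left n).
  by rewrite -add1n subword_cat subword1.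
by rewrite addr0 -addn1 subword_cat subword1 cats1.
Qed.

Lemma window_le x y m n : (m <= n)%N -> window x n = window y n -> window x m = window y m.
Proof.
move=> /subnKC <-; elim: (n - m)%N => [|k IH]; first by rewrite addn0.
rewrite addnS !windowS; case: grows_left => [[_ /IH//]|].
by move/eqP; rewrite eqseq_rcons => /andP[/eqP /IH].
Qed.

Lemma window_covers i : exists n k, (k < n)%N /\ i = window_start n + k%:R.
Proof.
rewrite /window_start; case: s i => i; first by exists i.+1, i; split=> //=; rewrite natn add0r.
case: i => i; [exists (i.+1).*2, (i.*2.+1) | exists (i.+1).*2, 0%N].
  split; first by rewrite -!muln2; lia.
  rewrite doubleK /= natz; lia.
by split => //; rewrite doubleK addr0.
Qed.

Definition wcyl n (w : word p) : set (fullshift s p) := [set x | window x n = w].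

Lemma coord_open i (a : 'I_p.+1) : open [set x : fullshift s p | x i = a].
Proof.
pose K (_ : position s) : topologicalType := discrete_topology 'I_p.+1.
have [H _] := @continuousP (prod_topology K) (K i) (@proj (position s) K i).
by apply: (H _ [set a]); [exact: proj_continuous | exact: discrete_open].
Qed.

Lemma subword_open i n w : open [set x : fullshift s p | subword x i n = w].
Proof.
elim: n i w => [|n IH] i [|a w].
- by rewrite (_ : [set _ | _] = setT); [exact: openT | apply/seteqP; split].
- by rewrite (_ : [set _ | _] = set0); [exact: open0 | apply/seteqP; split].
- by rewrite (_ : [set _ | _] = set0); [exact: open0 | apply/seteqP; split].
have -> : [set x : fullshift s p | subword x i n.+1 = a :: w] =
    [set x | x i = a] `&` [set x | subword x (i + 1%:R) n = w].
  apply/seteqP; split=> x; rewrite /mkset -(add1n n) subword_cat subword1.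
    by move=> /= [-> ->].
  by move=> /= [-> ->].
exact: openI (coord_open i a) (IH _ _).
Qed.

Lemma wcyl_open n w : open (wcyl n w).
Proof. exact: subword_open. Qed.

(** The supersets of window cylinders around x form a filter. It converges to x in each coordinate,
    because each coordinate lies in some window, hence in the product topology. *)
Lemma nbhs_window x (U : set (fullshift s p)) : nbhs x U -> exists n, wcyl n (window x n) `<=` U.
Proof.
pose F : set_system (fullshift s p) := [set V | exists n, wcyl n (window x n) `<=` V].
have FF : Filter F.
  split.
  - by exists 0%N.
  - move=> V V' [n nV] [n' nV']; exists (maxn n n') => y /= yx; split.
      by apply: nV; apply: window_le yx; exact: leq_maxl.
    by apply: nV'; apply: window_le yx; exact: leq_maxr.
  - by move=> V V' VV' [n nV]; exists n; apply: subset_trans VV'.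
suff H : F --> x by move/H.
apply/cvg_sup => i; move=> V /= [V' [[W oW <-] xW] V'V].
have [n [k [kn iE]]] := window_covers i.
exists n => y yx; apply: V'V => /=.
have -> : y i = x i; last exact: xW.
by rewrite iE -!(@nth_subword ord0 _ _ n k kn) -/(window y n) yx.
Qed.

Lemma openP (U : set (fullshift s p)) :
  open U <-> forall x, U x -> exists n, wcyl n (window x n) `<=` U.
Proof.
split=> [oU x Ux|H]; first by apply: nbhs_window; apply: open_nbhs_nbhs.
rewrite openE => x /H [n nU]; apply: filterS nU _.
by apply: open_nbhs_nbhs; split; [exact: wcyl_open|].
Qed.

Lemma fullshift_compact : compact [set: fullshift s p].
Proof.
have := @tychonoff (position s) (fun=> discrete_topology 'I_p.+1) (fun=> setT) _.
rewrite (_ : [set f : forall _ : position s, discrete_topology 'I_p.+1 | _ ] = setT).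
  apply=> i; apply: finite_compact; exact: finite_finset.
by apply/seteqP; split.
Qed.

(* Compactness in the form of Koenig's lemma. *)
Lemma window_uniform (Y : set (fullshift s p)) (P : fullshift s p -> fullshift s p -> Prop) :
  closed Y ->
  (forall x, Y x -> exists n, forall y z, Y y -> Y z -> window y n = window x n ->
     window z n = window x n -> P y z) ->
  exists n, forall y z, Y y -> Y z -> window y n = window z n -> P y z.
Proof.
move=> cY H.
have cmpt : compact Y by apply: (subclosed_compact cY fullshift_compact).
have /choice[f fP] : forall x, exists n, Y x -> forall y z, Y y -> Y z ->
    window y n = window x n -> window z n = window x n -> P y z.
  by move=> x; case: (pselect (Y x)) => [/H [n nP]|nY]; [exists n | exists 0%N => /nY].
move: cmpt; rewrite compact_cover => /(_ _ Y (fun x => wcyl (f x) (window x (f x)))).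
case=> [x _|x Yx|D DY YD]; [exact: wcyl_open | by exists x |].
exists (\max_(x <- finmap.enum_fset D) f x)%N => y z Yy Yz yz.
have [x /= xD yx] := YD y Yy.
have fx : (f x <= \max_(x <- finmap.enum_fset D) f x)%N by apply: leq_bigmax_seq.
apply: (fP x _ y z Yy Yz yx); first by have := DY x xD; rewrite inE.
by rewrite -yx; apply/esym/(window_le fx yz).
Qed.

End Windows.

(** * Measures of cylinders *)

Section FiniteMeasure.
Context {R : realType} {d : measure_display} {T : measurableType d}.
Variable mu : {measure set T -> \bar R}.
Hypothesis muT : (mu setT < +oo)%E.
Implicit Types A B : set T.

(** The section treats finite measures, since [per_measure] is the zero measure when there is no
    periodic point. *)
Definition pr A : R := fine (mu A).

Lemma prK A : measurable A -> (pr A)%:E = mu A.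
Proof.
move=> mA; rewrite fineK // ge0_fin_numE ?measure_ge0 //.
by apply: le_lt_trans muT; apply: le_measure; rewrite ?inE.
Qed.

Lemma pr_ge0 A : 0 <= pr A.
Proof. by rewrite fine_ge0 ?measure_ge0. Qed.

Lemma le_pr A B : measurable A -> measurable B -> A `<=` B -> pr A <= pr B.
Proof.
by move=> mA mB AB; rewrite -lee_fin !prK //; apply: le_measure; rewrite ?inE.
Qed.

Lemma pr0 : pr set0 = 0.
Proof. by rewrite /pr measure0. Qed.

Lemma prU A B : measurable A -> measurable B -> A `&` B = set0 ->
  pr (A `|` B) = pr A + pr B.
Proof.
move=> mA mB AB; apply: EFin_inj; rewrite EFinD !prK ?measureU //.
exact: measurableU.
Qed.

Lemma pr_split A B : measurable A -> measurable B -> pr A = pr (A `&` B) + pr (A `\` B).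
Proof.
move=> mA mB; rewrite -{1}(setUIDK A B) prU //.
- exact: measurableI.
- exact: measurableD.
- by rewrite setDE setIACA setICr setI0.
Qed.

Lemma prU_le A B : measurable A -> measurable B -> pr (A `|` B) <= pr A + pr B.
Proof.
move=> mA mB; have -> : A `|` B = A `|` (B `\` A).
  apply/seteqP; split=> x; last by move=> [|[]]; [left|right].
  by case: (pselect (A x)) => Ax [|] ?; [left|left|left|right].
rewrite prU //; last by rewrite setDE setICA setICr setI0.
- by rewrite lerD2l; apply: le_pr => //; exact: measurableD.
- exact: measurableD.
Qed.

Lemma measurable_mem_seq (U : eqType) (r : seq U) (f : T -> U) :
  {in r, forall u, measurable [set x | f x = u]} -> measurable [set x | f x \in r].
Proof.
elim: r => [|u r IH] H.
  by rewrite (_ : [set _ | _] = set0) //; apply/seteqP; split.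
rewrite (_ : [set _ | _] = [set x | f x = u] `|` [set x | f x \in r]).
  apply: measurableU; first by apply: H; rewrite inE eqxx.
  by apply: IH => v vr; apply: H; rewrite inE vr orbT.
apply/seteqP; split=> x /=; rewrite inE.
  by move=> /orP[/eqP|]; [left|right].
by move=> [->|->]; rewrite ?eqxx ?orbT.
Qed.

Lemma pr_sum (U : eqType) (r : seq U) (f : T -> U) B : uniq r -> measurable B ->
  {in r, forall u, measurable [set x | f x = u]} ->
  pr (B `&` [set x | f x \in r]) = \sum_(u <- r) pr (B `&` [set x | f x = u]).
Proof.
elim: r => [|u r IH] /= ur mB H.
  rewrite big_nil (_ : _ `&` _ = set0) ?pr0 //.
  by apply/seteqP; split=> x // -[_ /=]; rewrite in_nil.
move: ur => /andP[nur ur].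
have Hr : {in r, forall u, measurable [set x | f x = u]}.
  by move=> v vr; apply: H; rewrite inE vr orbT.
rewrite big_cons -IH // -prU.
- congr pr; apply/seteqP; split=> x /=.
    by move=> [Bx]; rewrite inE => /orP[/eqP|]; [left|right].
  by move=> [[Bx ->]|[Bx xr]]; split; rewrite // inE ?eqxx ?xr ?orbT.
- by apply: measurableI => //; apply: H; rewrite inE eqxx.
- by apply: measurableI => //; apply: measurable_mem_seq.
- by apply/seteqP; split=> x // [[_ /= xu] [_ /=]]; rewrite xu (negbTE nur).
Qed.

Lemma pr_sum_all (U : eqType) (r : seq U) (f : T -> U) B : uniq r -> measurable B ->
  {in r, forall u, measurable [set x | f x = u]} -> (forall x, f x \in r) ->
  pr B = \sum_(u <- r) pr (B `&` [set x | f x = u]).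
Proof.
move=> ur mB H fr; rewrite -pr_sum //; congr pr; apply/seteqP; split=> [x Bx|x [//]].
by split=> //; apply: fr.
Qed.

End FiniteMeasure.

Section ShiftMeasure.
Context {R : realType} {s : sidedness} {p : nat}.
Local Notation T := (fullshift s p).

Lemma borelE : @measurable _ T = <<s @open T >>.
Proof. by []. Qed.

Lemma open_measurable_fs (U : set T) : open U -> measurable U.
Proof. by move=> oU; apply: (@sub_sigma_algebra _ setT (@open T)). Qed.

Lemma measurable_subword i n w : measurable [set x : T | subword x i n = w].
Proof. by apply: open_measurable_fs; apply: subword_open. Qed.

Lemma measurable_wcyl n w : measurable (@wcyl s p n w).
Proof. exact: measurable_subword. Qed.

Lemma measurable_subword_pred i n (P : pred (word p)) :
  measurable [set x : T | P (subword x i n)].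
Proof.
pose r := [seq w <- words 'I_p.+1 n | P w].
rewrite (_ : [set x | _] = [set x : T | subword x i n \in r]).
  by apply: measurable_mem_seq => w _; apply: measurable_subword.
apply/seteqP; split=> x /=; rewrite mem_filter mem_words size_subword eqxx andbT //.
Qed.

Lemma measurable_closed (Y : set T) : closed Y -> measurable Y.
Proof.
by move=> cY; rewrite -(setCK Y); apply: measurableC; apply: open_measurable_fs; apply: closed_openC.
Qed.

Lemma open_bigcup_wcyl (U : set T) : open U ->
  U = \bigcup_n [set x | `[< wcyl n (window x n) `<=` U >]].
Proof.
move=> oU; apply/seteqP; split=> x.
  by move=> Ux; have [n nU] := (openP U).1 oU x Ux; exists n => //=; apply/asboolP.
by move=> [n _ /= /asboolP]; apply.
Qed.

(** Windows are nested, so two of these sets are nested or disjoint: the family is a pi-system. *)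
Let cyls : set (set T) := [set C | C = set0 \/ exists n w, C = wcyl n w].

Let cylsE : @measurable _ T = <<s cyls >>.
Proof.
apply/seteqP; split.
  rewrite borelE; apply: smallest_sub; first exact: smallest_sigma_algebra.
  move=> U oU; rewrite (open_bigcup_wcyl oU).
  have [_ _ cup] := smallest_sigma_algebra setT cyls.
  apply: cup => n; set P := fun w => `[< wcyl n w `<=` U >].
  have H (r : seq (word p)) : <<s cyls >> [set x : T | (window x n \in r)].
    elim: r => [|w r IH].
      rewrite (_ : [set _ | _] = set0); first by case: (smallest_sigma_algebra setT cyls).
      by apply/seteqP; split=> x //=; rewrite in_nil.
    rewrite (_ : [set _ | _] = wcyl n w `|` [set x | window x n \in r]).
      apply: (@measurableU _ (g_sigma_algebraType cyls)) => //.
      by apply: sub_sigma_algebra; right; exists n, w.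
    apply/seteqP; split=> x /=; rewrite inE.
      by move=> /orP[/eqP|]; [left|right].
    by move=> [->|->]; rewrite ?eqxx ?orbT.
  rewrite (_ : [set x | _] = [set x : T | window x n \in [seq w <- words 'I_p.+1 n | P w]]).
    exact: H.
  by apply/seteqP; split=> x /=; rewrite mem_filter mem_words size_window eqxx andbT.
apply: smallest_sub; first exact: sigma_algebra_measurable.
by move=> C [->|[n [w ->]]]; [exact: measurable0 | exact: measurable_wcyl].
Qed.

Lemma wcyl_setI : setI_closed cyls.
Proof.
have main m n w v : (m <= n)%N -> cyls (wcyl m w `&` wcyl n v).
  move=> mn; case: (pselect (wcyl m w `&` wcyl n v = set0 :> set T)) => [->|]; first by left.
  move/eqP/set0P => [x [/= xw xv]].
  right; exists n, v; apply/seteqP; split=> y /=; first by case.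
  by move=> yv; split=> //; rewrite -xw; apply: (window_le mn); rewrite yv.
move=> _ _ [->|[m [w ->]]] [->|[n [v ->]]]; rewrite ?setI0 ?set0I; try by left.
by case/orP: (leq_total m n) => /main H; [exact: H | rewrite setIC; exact: H].
Qed.

Lemma measure_unique_wcyl (mu nu : {measure set T -> \bar R}) :
  (mu setT < +oo)%E ->
  (forall n w, size w = n -> mu (wcyl n w) = nu (wcyl n w)) ->
  forall B, measurable B -> mu B = nu B.
Proof.
move=> muT H; have H' n w : mu (wcyl n w) = nu (wcyl n w).
  have [/H //|nw] := eqVneq (size w) n.
  rewrite (_ : wcyl n w = set0) ?measure0 //.
  by apply/seteqP; split=> // x /= xw; rewrite -xw size_window eqxx in nw.
have wT : wcyl 0 [::] = [set: T] by apply/seteqP; split.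
apply: (measure_unique cyls (fun=> wcyl 0 [::]) cylsE wcyl_setI).
- by move=> _; right; exists 0%N, [::].
- by rewrite wT; apply/seteqP; split=> // x _; exists 0%N.
- by move=> C [->|[n [w ->]]]; rewrite ?measure0 ?H'.
- by move=> _; rewrite wT.
Qed.

Section Approx.
Variable mu : {measure set T -> \bar R}.
Hypothesis muT : (mu setT < +oo)%E.

Let symd (A B : set T) := (A `\` B) `|` (B `\` A).

Let symdM A B : measurable A -> measurable B -> measurable (symd A B).
Proof. by move=> mA mB; apply: measurableU; apply: measurableD. Qed.

Let approx B := measurable B /\ forall e, 0 < e -> exists n (P : pred (word p)),
  pr mu (symd B [set x | P (window x n)]) <= e.

Let approx_incr (F : nat -> set T) : (forall n, approx (F n)) -> 
  {homo F : n m / (n <= m)%N >-> (n <= m)%O} -> approx (\bigcup_n F n).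
Proof.
move=> aF hF; have mF n : measurable (F n) by case: (aF n).
have mU : measurable (\bigcup_n F n) by exact: bigcup_measurable.
split=> // e e0.
have cv := nondecreasing_cvg_mu mF mU hF (mu := mu).
have e20 : 0 < e / 2 by rewrite divr_gt0.
have [k kP] : exists k, pr mu (\bigcup_n F n) - e / 2 <= pr mu (F k).
  have cv' : mu (F n) @[n --> \oo] --> (pr mu (\bigcup_n F n))%:E by rewrite prK.
  have /cvgrPdist_le /(_ _ e20) [N _ /(_ N (leqnn _)) /= H] := fine_cvg (FF := eventually_filter) cv'.
  by exists N; move: H; rewrite ler_norml => /andP[_]; rewrite /pr; lra.
have [_ /(_ _ e20) [n [P nP]]] := aF k.
exists n, P; set C := [set x | _] in nP *.
have mC : measurable C by exact: measurable_subword_pred.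
have Fk : F k `<=` \bigcup_n F n by exact: bigcup_sup.
have D : pr mu (\bigcup_n F n `\` F k) <= e / 2.
  by have := pr_split muT mU (mF k); rewrite (setIidr Fk); lra.
apply: le_trans (_ : _ <= pr mu ((\bigcup_n F n `\` F k) `|` symd (F k) C)) _.
  apply: le_pr => //; [exact: symdM|apply: measurableU; [exact: measurableD|exact: symdM]|].
  move=> x [[Ux nCx]|[Cx nUx]].
    by case: (pselect (F k x)) => Fx; [right; left | left].
  by right; right; split => // /Fk.
apply: le_trans (prU_le muT _ _) _; [exact: measurableD|exact: symdM|lra].
Qed.

Let approx0 : approx set0.
Proof.
split=> // e e0; exists 0%N, pred0; rewrite (_ : symd _ _ = set0) ?pr0 ?ltW //.
by apply/seteqP; split=> x // [] [].
Qed.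

Let approxC B : approx B -> approx (~` B).
Proof.
move=> [mB aB]; split; first exact: measurableC.
move=> e /aB [n [P nP]]; exists n, (predC P); apply: le_trans nP.
rewrite le_eqVlt; apply/orP; left; apply/eqP; congr pr; rewrite /symd.
apply/seteqP; split=> x /=.
  by move=> [[nB /negP/negPn Px]|[/negP nP /contrapT Bx]]; [right|left].
by move=> [[Bx /negP nP]|[Px nBx]]; [right; split => // | left; split => //]; 
  try (by apply/negP; rewrite negbK); move=> /negP; apply; rewrite negbK.
Qed.

Let approxU A B : approx A -> approx B -> approx (A `|` B).
Proof.
move=> [mA aA] [mB aB]; split; first exact: measurableU.
move=> e e0; have e20 : 0 < e / 2 by rewrite divr_gt0.
have [m [P mP]] := aA _ e20; have [n [Q nQ]] := aB _ e20.
pose k := maxn m n.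
have red l : (l <= k)%N -> forall O : pred (word p), exists O' : pred (word p),
    forall x : T, O' (window x k) = O (window x l).
  move=> lk O; exists (fun w => `[< exists2 x : T, window x k = w & O (window x l) >]) => x.
  apply/asboolP/idP => [[y yx Oy]|Ox]; last by exists x.
  by rewrite -(window_le lk yx).
have [P' P'P] := red m (leq_maxl _ _) P; have [Q' Q'P] := red n (leq_maxr _ _) Q.
exists k, (predU P' Q').
set C := [set x | P (window x m)] in mP; set D := [set x | Q (window x n)] in nQ.
have mC : measurable C by exact: measurable_subword_pred.
have mD : measurable D by exact: measurable_subword_pred.
rewrite (_ : [set x | _] = C `|` D); last first.
  by apply/seteqP; split=> x /=; rewrite P'P Q'P => /orP.
apply: le_trans (_ : _ <= pr mu (symd A C `|` symd B D)) _.
  apply: le_pr => //; [by apply: symdM; apply: measurableU | by apply: measurableU; apply: symdM |].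
  move=> x [[[Ax|Bx] /not_orP [nC nD]]|[[Cx|Dx] /not_orP [nA nB]]].
  - by left; left.
  - by right; left.
  - by left; right.
  - by right; right.
by apply: le_trans (prU_le muT _ _) _; [exact: symdM|exact: symdM|lra].
Qed.

(** The sets that admit such approximations form a sigma-algebra: increasing unions are handled by
    continuity from below, and any countable union is one of finite unions. An open set is an
    increasing union of sets given by windows. *)
Lemma clopen_approx B : measurable B -> forall e, 0 < e -> exists n (P : pred (word p)),
  pr mu ((B `\` [set x | P (window x n)]) `|` ([set x | P (window x n)] `\` B)) <= e.
Proof.
move=> mB; suff [] : approx B by [].
move: B mB; rewrite borelE; apply: smallest_sub.
  split=> [||F aF]; [exact: approx0 | by move=> A; rewrite setTD; exact: approxC|].
  rewrite -(bigcup_bigsetU_bigcup F); apply: approx_incr.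
    move=> n; elim: n.+1 => [|k IH]; first by rewrite big_ord0.
    by rewrite big_ord_recr; apply: approxU.
  apply/nondecreasing_seqP => n; rewrite [in leRHS]big_ord_recr /=.
  by apply/subsetPset; exact: subsetUl.
move=> U oU; rewrite (open_bigcup_wcyl oU); apply: approx_incr => [n|].
  split.
    exact: (measurable_subword_pred _ n (fun w => `[< wcyl n w `<=` U >])).
  move=> e e0; exists n, (fun w => `[< wcyl n w `<=` U >]).
  rewrite (_ : symd _ _ = set0) ?pr0 ?ltW //.
  by rewrite /symd setDv setU0.
apply/nondecreasing_seqP => n; apply/subsetPset => x /asboolP H; apply/asboolP.
apply: subset_trans H => y; exact: (window_le (leqnSn n)).
Qed.

End Approx.

Definition word_weight (mu : {measure set T -> \bar R}) (w : word p) : R :=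
  pr mu [set x | subword x 0 (size w) = w].

Lemma subword_preimage i n w :
  left_shift @^-1` [set x : T | subword x i n = w] = [set x | subword x (i + 1) n = w].
Proof.
by apply/seteqP; split=> x /=; have /= := subword_iter_shift x 1 i n => ->.
Qed.

End ShiftMeasure.

(** Replaces the distinction between nat and int: a position is reached from 0, or reaches 0, by
    steps to the right. *)
Lemma position_shift (s : sidedness) (i : position s) :
  exists k, i = k%:R \/ i + k%:R = 0.
Proof.
case: s i => /= i; first by exists i; left; rewrite natn.
case: i => i; [exists i; left; by rewrite natz | exists i.+1; right].
by rewrite natz NegzE addNr.
Qed.

Section Invariant.
Context {R : realType} {s : sidedness} {p : nat}.
Local Notation T := (fullshift s p).
Variable mu : {measure set T -> \bar R}.
Hypothesis muT : mu setT = 1%E.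
Hypothesis inv : forall B, measurable B -> mu (left_shift @^-1` B) = mu B.

Let muTfin : (mu setT < +oo)%E. Proof. by rewrite muT ltry. Qed.

(** From a negative position, invariance is applied forwards up to 0, so no inverse of the shift is
    involved. *)
Lemma pr_subword i w : pr mu [set x | subword x i (size w) = w] = word_weight mu w.
Proof.
rewrite /word_weight.
have step j : mu [set x | subword x (j + 1) (size w) = w] = mu [set x | subword x j (size w) = w].
  by rewrite -subword_preimage inv //; apply: measurable_subword.
have steps j k : mu [set x | subword x (j + k%:R) (size w) = w] = mu [set x | subword x j (size w) = w].
  by elim: k => [|k IH]; [rewrite addr0 | rewrite -natr1 addrA step].
rewrite /pr; congr fine; have [k [->|ik]] := position_shift i.
  by rewrite -[k%:R]add0r steps.
by rewrite -(steps i k) ik.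
Qed.

Lemma pr_subword_n i n w : size w = n -> pr mu [set x | subword x i n = w] = word_weight mu w.
Proof. by move=> <-; apply: pr_subword. Qed.

Lemma word_weight_wmeasure : wmeasure (word_weight mu).
Proof.
have enumP n (x : T) i : subword x i n \in words 'I_p.+1 n by rewrite mem_words size_subword.
split=> [w||w|w].
- exact: pr_ge0.
- rewrite /word_weight (_ : [set _ | _] = setT); first by rewrite /pr muT.
  by apply/seteqP; split.
- rewrite -[RHS](pr_subword 0) (pr_sum_all muTfin (f := fun x => x (0 + (size w)%:R)) (r := enum 'I_p.+1)).
  + rewrite big_enum /=; apply: eq_bigr => a _; rewrite -(pr_subword 0); congr pr.
    apply/seteqP; split=> x /=; rewrite size_rcons -(addn1 (size w)) subword_cat subword1 cats1.
      by move=> /eqP; rewrite eqseq_rcons => /andP[/eqP -> /eqP ->].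
    by move=> [-> ->].
  + exact: enum_uniq.
  + exact: measurable_subword.
  + by move=> a _; apply: open_measurable_fs; apply: coord_open.
  + by move=> x; rewrite mem_enum.
- rewrite -[RHS](pr_subword (0 + 1%:R)) (pr_sum_all muTfin (f := fun x => x 0) (r := enum 'I_p.+1)).
  + rewrite big_enum /=; apply: eq_bigr => a _; rewrite -(pr_subword 0); congr pr.
    apply/seteqP; split=> x /=; rewrite -(add1n (size w)) subword_cat subword1.
      by move=> /= [-> ->].
    by move=> /= [-> ->].
  + exact: enum_uniq.
  + exact: measurable_subword.
  + by move=> a _; apply: open_measurable_fs; apply: coord_open.
  + by move=> x; rewrite mem_enum.
Qed.

End Invariant.

(** * Invariant measures from weights *)

Section Points.
Variables (s : sidedness) (p : nat).
Local Notation T := (fullshift s p).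
Implicit Types (w : word p).

Definition extend n w a : word p := if grows_left s n then a :: w else rcons w a.

Lemma size_extend n w a : size (extend n w a) = (size w).+1.
Proof. by rewrite /extend; case: ifP => // _; rewrite size_rcons. Qed.

Lemma extend_inj n w a w' a' : extend n w a = extend n w' a' -> w = w' /\ a = a'.
Proof.
rewrite /extend; case: ifP => _; first by case=> -> ->.
by move=> /eqP; rewrite eqseq_rcons => /andP[/eqP -> /eqP ->].
Qed.

Lemma extend_surj n w k : size w = k.+1 -> exists v a, size v = k /\ w = extend n v a.
Proof.
rewrite /extend; case: (grows_left s n); first by case: w => // a v [vk]; exists v, a.
by case/lastP: w => [//|v a]; rewrite size_rcons => -[vk]; exists v, a.
Qed.

Lemma window_extend (x : T) n : exists a, window x n.+1 = extend n (window x n) a.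
Proof. by rewrite windowS /extend; case: (grows_left s n); eexists. Qed.

Lemma window_decides (i : position s) :
  exists n, forall x y : T, window x n = window y n -> x i = y i.
Proof.
have [n [k [kn ->]]] := window_covers i; exists n => x y H.
by rewrite -!(@nth_subword _ _ ord0 _ _ n k kn) -/(window x n) H.
Qed.

Lemma exists_window w : exists x : T, window x (size w) = w.
Proof.
have [f fP] : exists f : position s -> nat,
    forall k, f (window_start s (size w) + k%:R) = k.
  rewrite /window_start; case: (s); first by exists id => k; rewrite /= natn add0r.
  by exists (fun j => absz (j + ((size w)./2)%:Z)) => k; rewrite addrAC addNr add0r natz.
exists (fun i => nth ord0 w (f i)).
apply: (@eq_from_nth _ ord0); rewrite size_window // => k kw.
by rewrite nth_subword // fP.
Qed.

(** Each coordinate is read in a window large enough to decide it; coherence makes the choice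
    immaterial. *)
Lemma exists_point (W : nat -> word p) : size (W 0%N) = 0%N ->
  (forall n, exists a, W n.+1 = extend n (W n) a) ->
  exists x : T, forall n, window x n = W n.
Proof.
move=> W0 WS; have sW n : size (W n) = n.
  by elim: n => // n IH; have [a ->] := WS n; rewrite size_extend IH.
have /choice[y yP] n : exists y : T, window y n = W n.
  by rewrite -{1}(sW n); apply: exists_window.
have coh n k : window (y (k + n)%N) n = W n.
  elim: k => [|k IH]; first by rewrite add0n yP.
  rewrite -IH; apply: (window_le (leq_addl k n)); rewrite addSn yP.
  have [a aE] := WS (k + n)%N; have [b bE] := window_extend (y (k + n).+1) (k + n).
  by move: bE; rewrite yP aE => /extend_inj [-> _].
have /choice[N NP] := window_decides.
exists (fun i => y (N i) i) => n.
rewrite -[RHS](yP n); apply: (@eq_from_nth _ ord0); rewrite !size_window // => k kn.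
rewrite !nth_subword //; set i := _ + _.
transitivity (y (N i + n)%N i); last first.
  rewrite /i -!(@nth_subword _ _ ord0 _ _ n k kn) -/(window _ n) coh.
  by rewrite -/(window (y n) n) yP.
by apply: NP; rewrite yP addnC coh.
Qed.

Lemma window_contains (i : position s) n : exists a b,
  window_start s (a + (n + b)) + a%:R = i.
Proof.
rewrite /window_start; case: s i => i; first by exists i, 0%N; rewrite /= natn add0r.
have H (i0 : int) : exists a b, - ((a + (n + b))./2)%:Z + a%:R = i0.
  pose K := (absz i0 + n)%N; pose j := i0 + K%:Z; pose a := absz j.
  have aE : a%:Z = i0 + K%:Z by rewrite /a /j /K; lia.
  exists a, (K.*2 - a - n)%N; have -> : (a + (n + (K.*2 - a - n)))%N = K.*2.
    by rewrite -!muln2; move: aE; rewrite /K; lia.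
  by rewrite doubleK natz aE addrC addrK.
exact: H.
Qed.

End Points.

(** * A measure with given weights, by the quantile map *)

Section Quantile.
Context {R : realType} {s : sidedness} {p : nat}.
Local Notation T := (fullshift s p).
Variables (m : word p -> R) (mP : wmeasure m).

Let m0 w : 0 <= m w. Proof. by case: mP. Qed.

Let ext n w a := @extend s p n w a.

Let wm_ext n w : \sum_a m (ext n w a) = m w.
Proof. by case: mP => _ _ mr ml; rewrite /ext /extend; case: (grows_left s n). Qed.

Let S n w (k : nat) : R := \sum_(a : 'I_p.+1 | (a < k)%N) m (ext n w a).

Let S0 n w : S n w 0 = 0.
Proof. by rewrite /S big_pred0. Qed.

Let SS n w (a : 'I_p.+1) : S n w a.+1 = S n w a + m (ext n w a).
Proof.
rewrite /S (bigD1 a) //= addrC; congr (_ + _); apply: eq_bigl => b.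
by rewrite ltnS andbC ltn_neqAle -val_eqE.
Qed.

Let S_full n w : S n w p.+1 = m w.
Proof. by rewrite -(wm_ext n w); apply: eq_bigl => a; rewrite ltn_ord. Qed.

Let S_mono n w j k : (j <= k)%N -> S n w j <= S n w k.
Proof.
move=> jk; rewrite /S [leLHS]big_mkcond [leRHS]big_mkcond; apply: ler_sum => a _.
case: (ltnP a j) => [aj|_]; first by rewrite (leq_trans aj jk).
by case: ifP.
Qed.

Let pick_letter n w l u : 'I_p.+1 :=
  odflt ord0 [pick a : 'I_p.+1 | l + S n w a <= u < l + S n w a.+1].

Let pick_letterP n w l u a : l <= u < l + m w ->
  (pick_letter n w l u == a) = (l + S n w a <= u < l + S n w a.+1).
Proof.
move=> /andP[lu um]; rewrite /pick_letter; case: pickP => [b /andP[b1 b2]|none] /=.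
  apply/idP/idP => [/eqP <-|/andP[a1 a2]]; first by rewrite b1 b2.
  rewrite -val_eqE; case: (ltngtP b a) => [||//] /(S_mono n w) H.
    by have := le_lt_trans a1 b2; rewrite ltrD2l ltNge H.
  by have := le_lt_trans b1 a2; rewrite ltrD2l ltNge H.
suff H k : (k <= p.+1)%N -> l + S n w k <= u.
  by have := H p.+1 (leqnn _); rewrite S_full leNgt um.
elim: k => [|k IH] kp; first by rewrite S0 addr0.
have := none (Ordinal kp) => /=; rewrite (IH (ltnW kp)) /= => /negbT.
by rewrite -leNgt.
Qed.

(** The window of length n attached to u, with the left end of its interval. The interval of a word
    is cut, in the order of the letters, into the intervals of its extensions on the side where the
    window grows. *)
Fixpoint quantile_state (u : R) n : word p * R :=
  if n is k.+1 then
    let wl := quantile_state u k in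
    let a := pick_letter k wl.1 wl.2 u in (ext k wl.1 a, wl.2 + S k wl.1 a)
  else ([::], 0).

Let st := quantile_state.

Let st_interval n w : size w = n -> exists l, [/\ 0 <= l, l + m w <= 1 &
  forall u, 0 <= u < 1 -> ((st u n).1 = w <-> l <= u < l + m w) /\
                       ((st u n).1 = w -> (st u n).2 = l)].
Proof.
elim: n w => [|n IH] w wn.
  rewrite (size0nil wn); exists 0; case: mP => _ -> _ _; split; rewrite ?add0r //.
have [v [a [vn wE]]] := @extend_surj s p n w n wn.
have [l [l0 l1 lP]] := IH v vn.
have Sa : l + S n v a + m w = l + S n v a.+1 by rewrite SS wE addrA.
exists (l + S n v a); split.
- by rewrite addr_ge0 // -(S0 n v) S_mono.
- rewrite Sa; apply: le_trans l1; rewrite lerD2l -(S_full n v); exact: S_mono.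
move=> u u01; have [H1 H2] := lP u u01; rewrite Sa /=.
set w0 := (quantile_state u n).1 in H1 H2 *; set l0' := (quantile_state u n).2 in H2 *.
rewrite wE; split.
  split=> [/extend_inj [e1 e2]|/andP[la lb]].
    have luv := H1.1 e1; rewrite -(pick_letterP n a luv) -e2 e1 H2 ?e1 //.
  have luv : l <= u < l + m v.
    rewrite -(S_full n v) (lt_le_trans lb) ?lerD2l; last exact: S_mono (ltn_ord a).
    by rewrite (le_trans _ la) // lerDl -(S0 n v) S_mono.
  have e1 : w0 = v by apply/H1.
  by rewrite e1 H2 //; congr ext; apply/eqP; rewrite pick_letterP // la lb.
by move=> /extend_inj [e1 e2]; rewrite H2 ?e1 // -e2 e1 H2.
Qed.

Let clamp (u : R) : R := if 0 <= u < 1 then u else 0.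

Let exists_quantile : exists f : R -> T, forall u n, window (f u) n = (st (clamp u) n).1.
Proof.
suff /choice[f fP] : forall u, exists x : T, forall n, window x n = (st (clamp u) n).1.
  by exists f.
by move=> u; apply: exists_point => // n; eexists.
Qed.

(** The image of the uniform law: the points u whose window is w form a half-open interval of length
    m w. Outside [0, 1), where the law has no mass, u is replaced by 0. *)
Lemma exists_probability_windows : exists mu : probability T R,
  forall n w, size w = n -> pr mu (wcyl n w) = m w.
Proof.
have [f' f'P] := exists_quantile.
pose f : measurableTypeR R -> T := f'.
have fP (u : measurableTypeR R) n : window (f u) n = (st (clamp u) n).1 := f'P u n.
have mfw n w : size w = n -> measurable (f @^-1` (wcyl n w)).
  move=> wn; have [l [l0 l1 lP]] := st_interval wn.
  have clamp01 u : 0 <= clamp u < 1 by rewrite /clamp; case: ifP => // _; rewrite lexx ltr01.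
  have -> : f @^-1` (wcyl n w) =
      (`[0, 1[ `&` `[l, l + m w[) `|` (~` `[0, 1[ `&` [set _ | l <= 0 < l + m w]) .
    apply/seteqP; split=> u /=; rewrite /wcyl /= fP !in_itv /=.
      move=> /(lP _ (clamp01 u)).1; rewrite /clamp; case: ifP => u01 H; first by left.
      by right; split => //; rewrite u01.
    move=> H; apply/(lP _ (clamp01 u)).1; rewrite /clamp.
    by case: H => [[-> H]|[/negP/negbTE -> H]].
  have mI (x y : R) : measurable (`[x, y[%classic : set (measurableTypeR R)) by exact: measurable_itv.
  apply: measurableU; apply: measurableI; [exact: mI|exact: mI|apply: measurableC; exact: mI|].
  case: (l <= 0 < l + m w).
    by rewrite (_ : [set _ | _] = setT); [exact: measurableT|apply/seteqP; split].
  by rewrite (_ : [set _ | _] = set0); [exact: measurable0|apply/seteqP; split].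
have mf : measurable_fun setT f.
  apply: (measurability (@open T)) => // _ [U oU <-].
  rewrite setTI (open_bigcup_wcyl oU) preimage_bigcup; apply: bigcup_measurable => n _.
  set P := fun w => `[< wcyl n w `<=` U >].
  rewrite (_ : f @^-1` _ = [set u | window (f u) n \in [seq w <- words 'I_p.+1 n | P w]]).
    apply: measurable_mem_seq => w; rewrite mem_filter mem_words => /andP[_ /eqP].
    exact: mfw.
  by apply/seteqP; split=> u /=; rewrite mem_filter mem_words size_window eqxx andbT.
pose F : {mfun measurableTypeR R >-> T} := HB.pack f (isMeasurableFun.Build _ _ _ _ f mf).
pose mu : probability T R := distribution (uniform_prob (@ltr01 R)) F.
have muT : (mu setT < +oo)%E by rewrite probability_setT ltry.
exists mu.
(* An inequality is enough, as both families of weights sum to 1 over the words of length n. *)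
have lower n w : size w = n -> m w <= pr mu (wcyl n w).
  move=> wn; have [l [l0 l1 lP]] := st_interval wn.
  have E : uniform_prob (@ltr01 R) `[l, l + m w[ = (m w)%:E.
    rewrite /uniform_prob (eq_integral (fun=> 1%:E)); last first.
      move=> u; rewrite inE /= in_itv /= => /andP[lu um].
      rewrite /uniform_pdf ifT ?subr0 ?invr1 //; apply/andP; split; lra.
    rewrite integral_cst; last exact: measurable_itv.
    rewrite mul1e; transitivity (lebesgue_measure (`[l, l + m w[%classic : set R)); first by [].
    rewrite lebesgue_measure_itv /= lte_fin ltrDl lt_neqAle m0 andbT eq_sym.
    by case: eqVneq => [->|_] //=; rewrite -EFinB addrC addKr.
  rewrite -lee_fin prK //; last exact: measurable_wcyl.
  rewrite -E; apply: le_measure.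
  - by rewrite inE; exact: measurable_itv.
  - by rewrite inE; exact: mfw.
  move=> u /=; rewrite in_itv /= => H; rewrite /wcyl /= fP.
  have u01 : 0 <= u < 1 by apply/andP; split; lra.
  rewrite /clamp u01; exact/(lP u u01).1.
move=> n w wn; apply/eqP; rewrite eq_le lower // andbT leNgt; apply/negP => lt.
have : 1 < 1 :> R.
  rewrite -{1}(wm_sum1 mP n).
  have -> : 1 = \sum_(v <- words 'I_p.+1 n) pr mu (wcyl n v).
    transitivity (pr mu setT).
      by rewrite -[LHS]/(fine 1%:E) -(probability_setT mu).
    rewrite (pr_sum_all muT (f := fun x => window x n) (words_uniq _ n)) //.
    + by apply: eq_bigr => v _; rewrite setTI.
    + by move=> v _; apply: measurable_wcyl.
    + by move=> x; rewrite mem_words size_window.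
  rewrite (bigD1_seq w) ?words_uniq ?mem_words ?wn //= [ltRHS](bigD1_seq w) ?words_uniq ?mem_words ?wn //=.
  apply: ltr_leD => //; rewrite big_seq_cond [leRHS]big_seq_cond; apply: ler_sum => v.
  by rewrite mem_words => /andP[/eqP vn _]; exact: lower.
by rewrite ltxx.
Qed.

End Quantile.

Section ExistsInvariant.
Context {R : realType} {s : sidedness} {p : nat}.
Local Notation T := (fullshift s p).

Lemma window_left_shift (x : T) n :
  window (left_shift x) n = subword x (window_start s n + 1) n.
Proof. exact: (subword_iter_shift x 1). Qed.

Lemma measurable_left_shift : measurable_fun [set: T] left_shift.
Proof.
apply: (measurability (@open T)) => // _ [U oU <-].
rewrite setTI (open_bigcup_wcyl oU) preimage_bigcup; apply: bigcup_measurable => n _.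
set P := fun w => `[< wcyl n w `<=` U >].
rewrite (_ : left_shift @^-1` _ = [set x : T | P (subword x (window_start s n + 1) n)]).
  exact: measurable_subword_pred.
by apply/seteqP; split=> x /=; rewrite window_left_shift.
Qed.

(** Any block lies in a window, where [wE_occ] gives it the weight m w whatever its place. Hence
    shifting does not change the mass of window cylinders, which determine the measure. *)
Lemma exists_invariant_probability (m : word p -> R) : wmeasure m ->
  exists mu : probability T R, shift_invariant_measure mu /\
    forall w, word_weight mu w = m w.
Proof.
move=> mP; have [mu muw] := @exists_probability_windows R s p m mP.
have muT : (mu setT < +oo)%E by rewrite probability_setT ltry.
have sub i w : pr mu [set x | subword x i (size w) = w] = m w.
  have [a [b iE]] := window_contains i (size w).
  set N := (a + (size w + b))%N in iE.
  rewrite (pr_sum_all muT (f := fun x => window x N) (words_uniq _ N)).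
  - rewrite -(wE_occ mP (i := a) (s := w) (n := N)); last by rewrite leq_add2l leq_addr.
    apply: eq_big_words => z zN; rewrite /occf.
    have E x : window x N = z -> take (size w) (drop a z) = subword x i (size w).
      by move=> <-; rewrite /window drop_subword iE take_subword // /N; lia.
    rewrite /occ; case: eqP => H /=; rewrite ?mulr1 ?mulr0.
      rewrite -(muw N z zN); congr pr; apply/seteqP; split=> x /=; first by case.
      by move=> xz; split => //; rewrite -(E x xz) H.
    rewrite (_ : _ `&` _ = set0) ?pr0 //.
    by apply/seteqP; split=> x //= [xw xz]; case: H; rewrite (E x xz).
  - exact: measurable_subword.
  - by move=> z _; apply: measurable_wcyl.
  - by move=> x; rewrite mem_words size_window.
exists mu; split=> [|w]; last exact: sub.
pose L : {mfun T >-> T} := HB.pack (left_shift : T -> T)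
  (isMeasurableFun.Build _ _ _ _ left_shift measurable_left_shift).
have LT : (distribution mu L setT < +oo)%E by rewrite probability_setT ltry.
move=> B mB; apply: (@measure_unique_wcyl R s p (distribution mu L) mu LT) => // n w wn.
have E : (distribution mu L (wcyl n w)) = mu [set x | subword x (window_start s n + 1) n = w].
  congr (mu _); apply/seteqP; split=> x /=; by rewrite /wcyl /= window_left_shift.
transitivity (mu [set x | subword x (window_start s n + 1) n = w]); first exact: E.
rewrite -(prK muT (measurable_wcyl n w)).
rewrite -(prK muT (measurable_subword (window_start s n + 1) n w)).
by congr EFin; have := sub (window_start s n + 1) w; rewrite wn => ->; rewrite muw.
Qed.

End ExistsInvariant.

(** * Entropy of invariant measures *)

Section Limits.
Variable R : realType.

(* A divergent sequence has limn equal to the default point 0. *)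
Lemma limn_le (u : (\bar R)^nat) (b : R) : 0 <= b ->
  (forall e, 0 < e -> exists n0, forall n, (n0 <= n)%N -> (u n <= (b + e)%:E)%E) ->
  (limn u <= b%:E)%E.
Proof.
move=> b0 H; case: (pselect (cvgn u)) => [cu|/dvgP ->]; last by rewrite lee_fin.
apply/lee_addgt0Pr => e /H [n0 n0P]; apply: lime_le => //.
by exists n0 => // n /= /n0P; rewrite EFinD.
Qed.

Lemma squeeze_rate (u : nat -> R) (h C : R) :
  (forall n, n%:R * h - C <= u n <= n%:R * h + C) ->
  (fun n => (n%:R^-1 * u n)%:E) @ \oo --> h%:E.
Proof.
move=> uP; apply: cvg_EFin; first exact: nearW.
apply/cvgrPdist_le => e e0.
have [n0 n0P] := nat_above (C / e).
exists (maxn n0 1) => // n /=; rewrite geq_max => /andP[nn0 n1].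
have n0' : 0 < n%:R :> R by rewrite ltr0n.
have -> : h - n%:R^-1 * u n = n%:R^-1 * (n%:R * h - u n) by field; rewrite gt_eqF.
rewrite normrM gtr0_norm ?invr_gt0 // ler_pdivrMl //.
apply: le_trans (_ : _ <= C) _.
  by have /andP[? ?] := uP n; rewrite ler_norml; apply/andP; split; lra.
move: n0P; rewrite ler_pdivrMr // => /le_trans; apply.
by rewrite ler_wpM2r ?ler_nat // ltW.
Qed.

Lemma ln_prod (I : Type) (r : seq I) (F : I -> R) : (forall i, 0 < F i) ->
  ln (\prod_(i <- r) F i) = \sum_(i <- r) ln (F i).
Proof.
move=> F0; elim: r => [|i r IH]; first by rewrite !big_nil ln1.
by rewrite !big_cons lnM ?posrE ?IH //; apply: prodr_gt0.
Qed.

End Limits.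

Section RandomVariables.
Context {R : realType} {d : measure_display} {T : measurableType d}.
Variable mu : {measure set T -> \bar R}.
Hypothesis muT : (mu setT < +oo)%E.

Lemma pr_bigU_le (I : Type) (r : seq I) (F : I -> set T) (e : R) :
  (forall i, measurable (F i)) -> (forall i, pr mu (F i) <= e) ->
  measurable (\big[setU/set0]_(i <- r) F i) /\
  pr mu (\big[setU/set0]_(i <- r) F i) <= (size r)%:R * e.
Proof.
move=> mF Fe; elim: r => [|i r [mIH IH]]; first by rewrite big_nil pr0 mul0r.
rewrite big_cons; split; first exact: measurableU.
by apply: le_trans (prU_le muT _ _) _ => //=; rewrite -natr1 mulrDl mul1r addrC lerD.
Qed.

Variables (U : eqType) (r : seq U) (X : T -> U).
Hypothesis ur : uniq r.
Hypothesis mX : {in r, forall u, measurable [set x | X x = u]}.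
Hypothesis Xr : forall x, X x \in r.

Lemma measurable_rv (P : pred U) : measurable [set x | P (X x)].
Proof.
rewrite (_ : [set _ | _] = [set x | X x \in [seq u <- r | P u]]).
  by apply: measurable_mem_seq => u; rewrite mem_filter => /andP[_ /mX].
by apply/seteqP; split=> x /=; rewrite mem_filter Xr andbT.
Qed.

Lemma pr_rv (P : pred U) : pr mu [set x | P (X x)] = \sum_(u <- r | P u) pr mu [set x | X x = u].
Proof.
rewrite (_ : [set _ | _] = setT `&` [set x | X x \in [seq u <- r | P u]]).
  rewrite pr_sum ?filter_uniq //.
    by rewrite big_filter; apply: eq_bigr => u _; rewrite setTI.
  by move=> u; rewrite mem_filter => /andP[_ /mX].
by rewrite setTI; apply/seteqP; split=> x /=; rewrite mem_filter Xr andbT.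
Qed.

Lemma sum_rv_comp (V : eqType) (r' : seq V) (f : U -> V) (g : V -> R) : uniq r' ->
  {in r, forall u, f u \in r'} ->
  \sum_(u <- r) pr mu [set x | X x = u] * g (f u) =
  \sum_(v <- r') pr mu [set x | f (X x) = v] * g v.
Proof.
move=> ur' fr'.
transitivity (\sum_(u <- r) \sum_(v <- r') (if f u == v then pr mu [set x | X x = u] * g v else 0)).
  rewrite big_seq [RHS]big_seq; apply: eq_bigr => u /fr' fu.
  rewrite (bigD1_seq (f u)) //= eqxx big1 ?addr0 // => v.
  by rewrite eq_sym => /negbTE ->.
rewrite exchange_big; apply: eq_bigr => v _ /=.
rewrite -big_mkcond /= -mulr_suml; congr (_ * _).
rewrite -(pr_rv (fun u => f u == v)); congr pr.
by apply/seteqP; split=> x /= /eqP.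
Qed.

End RandomVariables.

Section MeasureEntropy.
Context {R : realType} {s : sidedness} {p : nat}.
Local Notation T := (fullshift s p).
Variable mu : probability T R.
Hypothesis inv : shift_invariant_measure mu.

Let muT : (mu setT < +oo)%E. Proof. by rewrite probability_setT ltry. Qed.
Let m := word_weight mu.
Let mP : wmeasure m.
Proof. by apply: word_weight_wmeasure => //; exact: probability_setT. Qed.

Lemma inv_iter k B : measurable B -> measurable (iter k left_shift @^-1` B) /\
  pr mu (iter k left_shift @^-1` B) = pr mu B.
Proof.
move=> mB; elim: k => [//|k [mIH IH]].
have -> : iter k.+1 left_shift @^-1` B = left_shift @^-1` (iter k left_shift @^-1` B).
  by apply/seteqP; split=> x; rewrite /preimage /= -iterSr.
split; last by rewrite -IH /pr; congr fine; apply: inv.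
by rewrite -[X in measurable X]setTI; apply: measurable_left_shift.
Qed.

Section Partition.
Variables (k : nat) (P : 'I_k -> set T).
Hypothesis partP : finite_partition P.

Let mPi i : measurable (P i). Proof. by case: partP. Qed.

Let exists_label : exists lab : T -> 'I_k, forall x i, lab x = i <-> P i x.
Proof.
case: partP => _ triv cov.
have /choice[lab labP] : forall x, exists i, P i x.
  by move=> x; have : setT x by []; rewrite -cov => -[i _ Pi]; exists i.
exists lab => x i; split=> [<-//|Pi].
by apply: triv => //; exists x.
Qed.

(** Each cell is approximated by a set given by a window; a point with the wrong guess Q lies in one
    of the k symmetric differences, each of mass at most e / k. *)
Let approx_partition e : 0 < e -> exists N (Q : word p -> 'I_k),
  forall lab : T -> 'I_k, (forall x i, lab x = i <-> P i x) ->
  measurable [set x | lab x != Q (window x N)] /\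
  pr mu [set x | lab x != Q (window x N)] <= e.
Proof.
move=> e0; have [lab0 _] := exists_label.
have k0 : (0 < k)%N by apply: leq_ltn_trans (ltn_ord (lab0 point)).
have /choice[f fP] : forall i : 'I_k, exists nP : nat * pred (word p),
    pr mu ((P i `\` [set x | nP.2 (window x nP.1)]) `|`
           ([set x | nP.2 (window x nP.1)] `\` P i)) <= e / k%:R.
  move=> i; have [|n [V VP]] := clopen_approx muT (mPi i) (e := e / k%:R).
    by rewrite divr_gt0 ?ltr0n.
  by exists (n, V).
pose N := (\max_i (f i).1)%N.
have fN i : ((f i).1 <= N)%N by rewrite /N; apply: (leq_bigmax i).
pose O i w := `[< exists2 x : T, window x N = w & (f i).2 (window x (f i).1) >].
have OP i (x : T) : O i (window x N) = (f i).2 (window x (f i).1).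
  apply/asboolP/idP => [[y yx Oy]|Ox]; last by exists x.
  by rewrite -(window_le (fN i) yx).
pose Q w := odflt (Ordinal k0) [pick i | O i w].
exists N, Q => lab labP.
have mBad : measurable [set x | lab x != Q (window x N)].
  pose X x := (lab x, window x N).
  rewrite (_ : [set _ | _] = [set x | (fun u : 'I_k * word p => u.1 != Q u.2) (X x)]) //.
  apply: (measurable_rv (r := [seq (i, w) | i <- enum 'I_k, w <- words 'I_p.+1 N])
    (X := X) _ _ (fun u => u.1 != Q u.2)).
    move=> [i w] _; rewrite (_ : [set _ | _] = P i `&` wcyl N w).
      by apply: measurableI => //; exact: measurable_wcyl.
    apply/seteqP; split=> x /=; first by move=> [/labP ? ?].
    by move=> [/labP <- <-].
  move=> x; apply/allpairsP; exists (X x); rewrite mem_enum mem_words size_window eqxx.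
  by split.
split=> //.
pose D i := (P i `\` [set x | (f i).2 (window x (f i).1)]) `|`
           ([set x | (f i).2 (window x (f i).1)] `\` P i).
have mD i : measurable (D i).
  by apply: measurableU; apply: measurableD => //; apply: measurable_subword_pred.
have [mU UD] := pr_bigU_le muT (enum 'I_k) mD fP.
apply: le_trans (_ : _ <= pr mu (\big[setU/set0]_(i <- enum 'I_k) D i)) _; last first.
  apply: le_trans UD _; rewrite size_enum_ord mulrCA divff ?mulr1 // pnatr_eq0 -lt0n //.
apply: le_pr => // x /= bad; apply: contrapT => nD.
have {}nD i : ~ D i x.
  move=> Di; apply: nD; rewrite (bigD1_seq i) ?mem_enum ?enum_uniq //=; by left.
have PO i : P i x <-> O i (window x N).
  rewrite OP; split=> [Pi|Oi]; apply: contrapT => nn; apply: (nD i).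
    by left.
  by right.
move/negP: bad; apply; apply/eqP; apply/labP/PO.
rewrite /Q; case: pickP => //= none.
have /PO := (labP x (lab x)).1 erefl.
by rewrite none.
Qed.

Section Estimate.
Variables (lab : T -> 'I_k) (n N : nat) (Q : word p -> 'I_k) (eta eps : R).
Hypothesis labP : forall x i, lab x = i <-> P i x.
Hypothesis eta01 : 0 < eta < 1.
Hypothesis mBad : measurable [set x | lab x != Q (window x N)].
Hypothesis Bad_le : pr mu [set x | lab x != Q (window x N)] <= eps.

Let k0 : (0 < k)%N. Proof. exact: leq_ltn_trans (ltn_ord (lab point)). Qed.
Let start := window_start s N.
Let J x : {ffun 'I_n -> 'I_k} := [ffun j : 'I_n => lab (iter j left_shift x)].
Let Y x : word p := subword x start (n + N).
Let rJ := enum {ffun 'I_n -> 'I_k}.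
Let rY := words 'I_p.+1 (n + N).
Let r := [seq (a, y) | a <- rJ, y <- rY].
Let X x := (J x, Y x).
Let pJY (u : {ffun 'I_n -> 'I_k} * word p) := pr mu [set x | X x = u].

Let join_cellE a : join_cell P a = [set x | J x = a].
Proof.
apply/seteqP; split=> x /=.
  by move=> H; apply/ffunP => j; rewrite ffunE; apply/labP; exact: H.
by move=> <- j _ /=; rewrite ffunE; apply/labP.
Qed.

Let mJ a : measurable [set x | J x = a].
Proof.
rewrite -join_cellE; apply: fin_bigcap_measurable; first exact: finite_finset.
by move=> j _; case: (inv_iter j (mPi (a j))).
Qed.

Let mY y : measurable [set x | Y x = y]. Proof. exact: measurable_subword. Qed.

Let ur : uniq r.
Proof.
apply: allpairs_uniq; [exact: enum_uniq|exact: words_uniq|].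
by move=> [? ?] [? ?] _ _ /= [-> ->].
Qed.

Let mX u : measurable [set x | X x = u].
Proof.
case: u => a y; rewrite (_ : [set _ | _] = [set x | J x = a] `&` [set x | Y x = y]).
  exact: measurableI.
by apply/seteqP; split=> x; [move=> [<- <-] | move=> [<- <-]].
Qed.

Let Xr x : X x \in r.
Proof.
apply/allpairsP; exists (X x); rewrite mem_enum /rY mem_words size_subword eqxx.
by split.
Qed.

(** Guess of the label from the window: Q z has weight 1 - eta, and the remaining eta is spread
    evenly so that no label has weight 0. *)
Let theta (c : 'I_k) (z : word p) : R := (1 - eta) * (c == Q z)%:R + eta / k%:R.

Let theta_gt0 c z : 0 < theta c z.
Proof.
have /andP[e0 e1] := eta01; rewrite ltr_wpDl ?divr_gt0 ?ltr0n //.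
by rewrite mulr_ge0 // subr_ge0 ltW.
Qed.

Let sum_theta z : \sum_c theta c z = 1.
Proof.
rewrite big_split /= -mulr_sumr (bigD1 (Q z)) //= eqxx big1 ?addr0 ?mulr1; last first.
  by move=> c /negbTE ->.
by rewrite sumr_const card_ord -[X in _ + X]mulr_natr divfK ?subrK // pnatr_eq0 -lt0n.
Qed.

Let sub (j : nat) (y : word p) := take N (drop j y).

Let cost (c : 'I_k) z : R := - ln (1 - eta) + (c != Q z)%:R * ln (k%:R / eta).

Let ln_theta c z : - ln (theta c z) <= cost c z.
Proof.
have /andP[e0 e1] := eta01.
have k1 : 0 < k%:R :> R by rewrite ltr0n.
rewrite /theta /cost; case: eqP => _ /=.
  rewrite mulr1 mul0r addr0 lerN2 ler_ln ?posrE; last 2 first.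
  - by rewrite subr_gt0.
  - by rewrite addr_gt0 ?subr_gt0 ?divr_gt0.
  by rewrite lerDl divr_ge0 // ltW.
rewrite mulr0 add0r mul1r -lnV ?posrE ?divr_gt0 // invf_div lerDr oppr_ge0 ln_le0 //.
by rewrite gerBl ltW.
Qed.

Let q (u : {ffun 'I_n -> 'I_k} * word p) : R := m u.2 * \prod_(j < n) theta (u.1 j) (sub j u.2).

Let sum_r (F : {ffun 'I_n -> 'I_k} * word p -> R) :
  \sum_(u <- r) F u = \sum_(a <- rJ) \sum_(y <- rY) F (a, y).
Proof. by rewrite big_allpairs_dep. Qed.

Let sum_q : \sum_(u <- r) q u = 1.
Proof.
rewrite sum_r exchange_big /= -[RHS](wm_sum1 mP (n + N)); apply: eq_bigr => y _.
rewrite /q /= -mulr_sumr big_enum /= -(bigA_distr_bigA (fun (j : 'I_n) c => theta c (sub j y))) /=.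
by rewrite big1 ?mulr1 // => j _; exact: sum_theta.
Qed.

Let sum_p : \sum_(u <- r) pJY u = 1.
Proof.
rewrite -(pr_rv muT ur (fun u _ => mX u) Xr xpredT).
transitivity (pr mu setT); first by congr pr; apply/seteqP; split.
by rewrite -[RHS]/(fine 1%:E) -(probability_setT mu).
Qed.

Let pJY_le_m u : pJY u <= m u.2.
Proof.
case: (boolP (size u.2 == n + N)%N) => [/eqP sz|sz].
  have -> : m u.2 = pr mu [set x | Y x = u.2] by apply/esym/pr_subword_n.
  by apply: le_pr => // x /= <-.
rewrite /pJY (_ : [set _ | _] = set0) ?pr0; last first.
  by apply/seteqP; split=> // x /= Xu; move: sz; rewrite -Xu /= size_subword eqxx.
by case: mP.
Qed.

(** A form of Fano's inequality. The entropy of the labels J is at most that of (J, Y), where Y is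
    the word covering the n windows, and Gibbs is applied against q, for which Y has law m and the
    labels are independent given Y with laws theta. Each label costs at most - ln (1 - eta), plus ln
    (k / eta) when the guess fails, which has probability at most eps. *)
Lemma join_entropy_le : partition_entropy mu (@join_cell s p k P n) <=
  wH m (n + N) + n%:R * (- ln (1 - eta) + eps * ln (k%:R / eta)).
Proof.
have /andP[e0 e1] := eta01.
have m0 w : 0 <= m w by case: mP.
have lnk : 0 <= ln (k%:R / eta).
  by rewrite ln_ge0 // ler_pdivlMr // mul1r; apply: le_trans (ltW e1) _; rewrite ler1n.
have pa a : pr mu [set x | J x = a] = \sum_(y <- rY) pJY (a, y).
  rewrite (pr_sum_all muT (f := Y) (words_uniq _ (n + N)) (mJ a)); last 2 first.
  - by move=> y _; apply: mY.
  - by move=> x; rewrite mem_words size_subword.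
  by apply: eq_bigr => y _; congr pr; apply/seteqP; split=> x; [move=> [<- <-] | move=> [<- <-]].
have p0 u : 0 <= pJY u by apply: pr_ge0.
apply: le_trans (_ : _ <= \sum_(u <- r) - (pJY u * ln (pJY u))) _.
  rewrite /partition_entropy -sumrN sum_r [leRHS]big_enum /=; apply: ler_sum => a _.
  rewrite join_cellE -/(pr mu _) {1}pa mulr_suml -sumrN; apply: ler_sum => y _.
  rewrite lerN2; have [->|pn0] := eqVneq (pJY (a, y)) 0; first by rewrite !mul0r.
  apply: ler_wpM2l => //; have pp : 0 < pJY (a, y) by rewrite lt_neqAle eq_sym pn0 p0.
  have le1 : pJY (a, y) <= pr mu [set x | J x = a].
    by apply: le_pr => //; move=> x [].
  by rewrite ler_ln ?posrE // (lt_le_trans pp).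
apply: le_trans (@gibbs_sum _ _ r pJY q p0 _ _) _.
- by move=> u; rewrite mulr_ge0 // prodr_ge0 // => j _; apply: ltW.
- move=> u /eqP; rewrite mulf_eq0 => /orP[/eqP mu0|/eqP pr0'].
    by apply/eqP; rewrite eq_le p0 andbT -mu0 pJY_le_m.
  have : 0 < \prod_(j < n) theta (u.1 j) (sub j u.2) by apply: prodr_gt0.
  by rewrite pr0' ltxx.
rewrite sum_q sum_p addrK.
apply: le_trans (_ : _ <= \sum_(u <- r) (pJY u * (- ln (m u.2)) +
    \sum_(j < n) pJY u * cost (u.1 j) (sub j u.2))) _.
  apply: ler_sum => u _.
  have [->|pn0] := eqVneq (pJY u) 0.
    by rewrite !mul0r oppr0 add0r big1 // => j _; rewrite mul0r.
  have pp : 0 < pJY u by rewrite lt_neqAle eq_sym pn0 p0.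
  have mp : 0 < m u.2 by apply: lt_le_trans (pJY_le_m u).
  rewrite /q lnM ?posrE //; last by apply: prodr_gt0.
  rewrite -mulrN opprD mulrDr lerD2l -mulr_sumr; apply: ler_wpM2l => //.
  have -> : ln (\prod_(j < n) theta (u.1 j) (sub j u.2)) =
      \sum_(j < n) ln (theta (u.1 j) (sub j u.2)).
    by apply: ln_prod.
  by rewrite -sumrN; apply: ler_sum => j _.
rewrite big_split /=; apply: lerD.
  rewrite (sum_rv_comp muT ur (fun u _ => mX u) Xr (r' := rY) (f := snd) (fun y => - ln (m y))) ?words_uniq //.
    rewrite /wH; apply: ler_sum_words => y yn.
    have -> : pr mu [set x | (X x).2 = y] = m y by apply: pr_subword_n.
    by rewrite mulrN.
  by move=> u /allpairsP [[a y] /= [_ yr ->]].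
rewrite exchange_big /= -[X in _ <= X * _](_ : \sum_(j < n) (1 : R) = _); last first.
  by rewrite sumr_const card_ord.
rewrite mulr_suml; apply: ler_sum => j _; rewrite mul1r /cost.
under eq_bigr do rewrite mulrDr.
rewrite big_split /= -mulr_suml sum_p mul1r lerD2l.
under eq_bigr do rewrite mulrA.
rewrite -mulr_suml; apply: ler_wpM2r => //.
apply: le_trans Bad_le; have [mB <-] := inv_iter j mBad.
rewrite -/(preimage _ _).
apply: le_trans (_ : _ <= \sum_(u <- r | u.1 j != Q (sub j u.2)) pJY u) _.
  rewrite [leRHS]big_mkcond; apply: ler_sum => u _.
  by case: ifP => _; rewrite ?mulr1 ?mulr0.
rewrite -(pr_rv muT ur (fun u _ => mX u) Xr (fun u => u.1 j != Q (sub j u.2))).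
apply: le_pr => //.
  exact: (measurable_rv (fun u _ => mX u) Xr (fun u => u.1 j != Q (sub j u.2))).
move=> x /=; rewrite /J ffunE /sub /Y drop_subword take_subword; last first.
  by have := ltn_ord j; lia.
by rewrite /window subword_iter_shift.
Qed.

End Estimate.
(** [join_entropy_le] compares the partition with words of length n + N, and [wH_down] brings these
    to length l; both errors are small per step for large n. *)
Lemma entropy_wrt_le l : (0 < l)%N -> (entropy_wrt mu P <= (wH m l / l%:R)%:E)%E.
Proof.
move=> l0; have l0' : 0 < l%:R :> R by rewrite ltr0n.
have A0 : (0 < #|'I_p.+1|)%N by rewrite card_ord.
have Hl0 : 0 <= wH m l by apply: wH_ge0.
apply: limn_le => [|e e0]; first by rewrite divr_ge0 // ltW.
have [lab labP] := exists_label.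
have k0 : (0 < k)%N by apply: leq_ltn_trans (ltn_ord (lab point)).
(* Chosen so that - ln (1 - eta) = e / 4; wrong guesses will add at most another e / 4. *)
pose eta : R := 1 - expR (- (e / 4)).
have eta01 : 0 < eta < 1.
  by rewrite /eta subr_gt0 expR_lt1 oppr_lt0 divr_gt0 //= gtrBl expR_gt0.
have /andP[eta0 eta1] := eta01.
pose c := ln (k%:R / eta).
have c0 : 0 <= c.
  by rewrite ln_ge0 // ler_pdivlMr // mul1r; apply: le_trans (ltW eta1) _; rewrite ler1n.
have c1 : 0 < c + 1 by rewrite ltr_wpDl.
have [|N [Q QP]] := @approx_partition (e / 4 / (c + 1)); first by rewrite !divr_gt0.
have [mB Ble] := QP lab labP.
have H n := @join_entropy_le lab n N Q eta _ labP eta01 mB Ble.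
have cost_le : - ln (1 - eta) + e / 4 / (c + 1) * c <= e / 2.
  rewrite /eta subKr expRK opprK.
  suff : e / 4 / (c + 1) * c <= e / 4 by lra.
  by rewrite -mulrA ler_piMr ?divr_ge0 ?(ltW e0) // ler_pdivrMl // mulr1; lra.
(* The part of the cost that does not depend on n: the N extra letters and the cut into blocks of
   length l. *)
pose D := N%:R * wH m l / l%:R + l%:R * ln #|'I_p.+1|%:R.
have [n0 n0P] := nat_above (D / (e / 2)).
exists (maxn n0 1) => n; rewrite geq_max => /andP[nn0 n1].
have n0' : 0 < n%:R :> R by rewrite ltr0n.
rewrite lee_fin ler_pdivrMl //.
apply: le_trans (H n) _.
have down := wH_down (n + N) mP A0 l0.
have down' : wH m (n + N) <= n%:R * (wH m l / l%:R) + D.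
  rewrite -(ler_pM2l l0'); apply: le_trans down _; rewrite natrD /D.
  rewrite le_eqVlt; apply/orP; left; apply/eqP; field; rewrite gt_eqF //.
have Dn : D <= n%:R * (e / 2).
  move: n0P; rewrite ler_pdivrMr ?divr_gt0 // => /le_trans; apply.
  by rewrite ler_wpM2r ?ler_nat // divr_ge0 // ltW.
have : n%:R * (- ln (1 - eta) + e / 4 / (c + 1) * c) <= n%:R * (e / 2).
  by rewrite ler_wpM2l.
rewrite -/c mulrDr; move: down' Dn; set W := wH m (n + N); lra.
Qed.

End Partition.

Lemma measure_entropy_le l : (0 < l)%N -> (measure_entropy mu <= (wH m l / l%:R)%:E)%E.
Proof.
move=> l0; apply: ge_ereal_sup => _ [k [P [partP ->]]].
exact: entropy_wrt_le.
Qed.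

Lemma sum_ffun_words n (F : seq 'I_p.+1 -> R) :
  \sum_(a : {ffun 'I_n -> 'I_p.+1}) F [seq a j | j <- enum 'I_n] = \sum_(w <- words 'I_p.+1 n) F w.
Proof.
rewrite -[LHS](big_map (fun a : {ffun 'I_n -> 'I_p.+1} => [seq a j | j <- enum 'I_n]) xpredT F).
apply: perm_big; apply: uniq_perm; rewrite ?words_uniq //.
  rewrite map_inj_uniq ?index_enum_uniq // => a b /eq_in_map H.
  by apply/ffunP => j; apply: H; rewrite mem_enum.
move=> w; rewrite mem_words; apply/mapP/eqP => [[a _ ->]|wn].
  by rewrite size_map size_enum_ord.
exists [ffun j : 'I_n => nth ord0 w j]; first by rewrite mem_index_enum.
apply: (@eq_from_nth _ ord0) => [|k]; first by rewrite wn size_map size_enum_ord.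
rewrite wn => kn; by rewrite (nth_map (Ordinal kn)) ?size_enum_ord // ffunE nth_enum_ord.
Qed.

(** The joins of the partition by the letter at 0 are cylinders, so its entropies are those of
    words. The two-sided bound makes the rate converge, so that its [limn] is h. *)
Lemma measure_entropy_ge h C : (forall n, n%:R * h - C <= wH m n <= n%:R * h + C) ->
  (h%:E <= measure_entropy mu)%E.
Proof.
move=> mh; pose P (a : 'I_p.+1) := [set x : T | x 0 = a].
have partP : finite_partition P.
  split.
  - by move=> a; apply: open_measurable_fs; apply: coord_open.
  - by move=> a b _ _ [x [/= <- <-]].
  - by apply/seteqP; split=> // x _; exists (x 0).
have -> : h%:E = entropy_wrt mu P; last by apply: ereal_sup_ubound; exists p.+1, P.
rewrite /entropy_wrt.
rewrite (_ : (fun n => _) = (fun n => (n%:R^-1 * wH m n)%:E)).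
  by apply/esym/cvg_lim => //; exact: squeeze_rate mh.
apply/funext => n; congr (_ * _)%:E.
rewrite /wH -sum_ffun_words /partition_entropy -sumrN; apply: eq_bigr => a _.
have -> : join_cell P a = [set x : T | subword x 0 n = [seq a j | j <- enum 'I_n]].
  apply/seteqP; split=> x /=.
    move=> H; apply: (@eq_from_nth _ ord0) => [|k].
      by rewrite size_subword size_map size_enum_ord.
    rewrite size_subword => kn; rewrite nth_subword // (nth_map (Ordinal kn)) ?size_enum_ord //.
    have -> : nth (Ordinal kn) (enum 'I_n) k = Ordinal kn by apply: val_inj; rewrite /= nth_enum_ord.
    by rewrite -(H (Ordinal kn)) //= iter_shiftE.
  move=> H j _ /=; rewrite /P /= iter_shiftE.
  have := congr1 (fun w => nth ord0 w j) H; rewrite nth_subword // => ->.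
  rewrite (nth_map j) ?size_enum_ord //; congr (a _); apply: val_inj; rewrite /= nth_enum_ord //.
have sz : size [seq a j | j <- enum 'I_n] = n by rewrite size_map size_enum_ord.
have -> : fine (mu [set x : T | subword x 0 n = [seq a j | j <- enum 'I_n]]) =
    m [seq a j | j <- enum 'I_n] by apply: (pr_subword_n inv).
by [].
Qed.

End MeasureEntropy.

(** * Measures of maximal entropy *)

Lemma window_start_shift s n : exists k, window_start s n + k%:R = 0.
Proof.
case: s => /=; first by exists 0%N.
by exists n./2; rewrite natz addNr.
Qed.

Lemma left_shift_in s p (Y : set (fullshift s p)) x :
  shift_space Y -> Y x -> Y (left_shift x).
Proof.
move=> [_ _]; case: s Y x => Y x /=; first by move=> H Yx; apply: H; exists x.
by move=> H Yx; rewrite -H; exists x.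
Qed.

Lemma iter_shift_in s p (Y : set (fullshift s p)) k x :
  shift_space Y -> Y x -> Y (iter k left_shift x).
Proof. by move=> sY Yx; elim: k => //= k; apply: left_shift_in. Qed.

(* For two-sided shifts the last identity forces a shift backwards, which is
   possible inside Y; for one-sided ones it says i = 0. *)
Lemma subword_at0 s p (Y : set (fullshift s p)) x i k n :
  shift_space Y -> Y x -> i + k%:R = 0 ->
  exists2 y, Y y & subword y 0 n = subword x i n.
Proof.
case: s Y x i => Y x i /= sY Yx ik.
  have i0 : i = 0%N by move: ik; rewrite natn => /eqP; rewrite addn_eq0 => /andP[/eqP].
  by exists x; rewrite ?i0.
have [y Yy <-] : exists2 y, Y y & iter k left_shift y = x.
  elim: k x Yx {ik} => [|k IH] x Yx; first by exists x.
  have [_ _ /= YE] := sY; have : (left_shift @` Y) x by rewrite YE.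
  by move=> [y /IH [z Yz <-] <-]; exists z.
by exists y => //; rewrite subword_iter_shift ik.
Qed.

Section Language.
Context {s : sidedness} {p : nat}.
Local Notation T := (fullshift s p).
Variable Y : set T.
Hypothesis shiftY : shift_space Y.

Definition lang : pred (seq 'I_p.+1) := fun w => `[< language Y w >].

Lemma langP w : reflect (language Y w) (lang w).
Proof. exact: asboolP. Qed.

Lemma lang_subword x i n : Y x -> lang (subword x i n).
Proof. by move=> Yx; apply/langP; exists x => //; exists i; rewrite size_subword. Qed.

Lemma lang_sub u v w : lang (u ++ v ++ w) -> lang v.
Proof.
move=> /langP [x Yx [i xi]].
have := xi; rewrite !size_cat !subword_cat => /eqP.
rewrite eqseq_cat ?size_subword // => /andP[_].
rewrite eqseq_cat ?size_subword // => /andP[/eqP <- _].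
exact: lang_subword.
Qed.

Lemma lang_at0 w : lang w -> exists2 x, Y x & subword x 0 (size w) = w.
Proof.
move=> /langP [x Yx [i <-]]; rewrite size_subword.
have [k [->|ik]] := position_shift i; last exact: subword_at0 ik.
exists (iter k left_shift x); first exact: iter_shift_in.
by rewrite subword_iter_shift add0r.
Qed.

Lemma lang_at_window n w : lang w ->
  exists2 x, Y x & subword x (window_start s n) (size w) = w.
Proof.
move=> /lang_at0 [x Yx xw]; have [k nk] := window_start_shift s n.
exists (iter k left_shift x); first exact: iter_shift_in.
by rewrite subword_iter_shift nk.
Qed.

Lemma lang_nonempty n : exists2 w, size w = n & lang w.
Proof.
have [[x Yx] _ _] := shiftY.
by exists (subword x 0 n); rewrite ?size_subword //; apply: lang_subword.
Qed.

Lemma lang_window x : (forall n, lang (window x n)) -> Y x.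
Proof.
move=> H; apply: contrapT => nYx.
have [_ cY _] := shiftY; have oY : open (~` Y) by apply: closed_openC.
have [n nY] := (openP _).1 oY x nYx.
have [y Yy yx] := lang_at_window n (H n).
by apply: (nY y) => //; rewrite /wcyl /= -yx size_window.
Qed.

Lemma setC_bigcup_windows : ~` Y = \bigcup_n [set x | ~~ lang (window x n)].
Proof.
apply/seteqP; split=> x.
  move=> nYx; apply: contrapT => H; apply: nYx; apply: lang_window => n.
  by apply/negPn/negP => nL; apply: H; exists n.
by move=> [n _ /negP H] Yx; apply: H; apply: lang_subword.
Qed.

Section Count.
Variable R : realType.

Lemma count_wordsE (D : set (word p)) n :
  count_words D n = count (fun w => `[< D w >]) (words 'I_p.+1 n).
Proof.
rewrite /count_words cardE /enum_mem size_filter -enumT.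
rewrite (eq_count (a2 := preim (@tval n 'I_p.+1) (fun w => `[< D w >]))) //.
rewrite -count_map; apply/permP/uniq_perm; rewrite ?words_uniq //.
  by rewrite map_inj_uniq ?enum_uniq //; apply: val_inj.
move=> w; rewrite mem_words; apply/mapP/eqP => [[t _ ->]|wn]; first exact: size_tuple.
by exists (Tuple (introT eqP wn)); rewrite ?mem_enum.
Qed.

Lemma topological_entropyE (h C : R) :
  (forall n, expR (n%:R * h) <= cnt R lang n) ->
  (forall n, cnt R lang n <= C * expR (n%:R * h)) ->
  topological_entropy Y = h%:E.
Proof.
move=> low up; rewrite /topological_entropy /word_entropy.
have C0 : 0 < C.
  have := lt_le_trans (expR_gt0 _) (le_trans (low 0%N) (up 0%N)).
  by rewrite mul0r expR0 mulr1.
apply: (cvg_limn_einf_sup _).2.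
rewrite (_ : (fun n => _) = (fun n => (n%:R^-1 * ln (cnt R lang n))%:E)); last first.
  by apply/funext => n; rewrite count_wordsE.
apply: (@squeeze_rate R _ h `|ln C|) => n.
have N0 : 0 < cnt R lang n by apply: lt_le_trans (low n); exact: expR_gt0.
apply/andP; split.
  apply: (@le_trans _ _ (n%:R * h)); first by rewrite gerBl.
  by rewrite -[leLHS]expRK ler_ln ?posrE ?expR_gt0.
apply: (@le_trans _ _ (ln (C * expR (n%:R * h)))).
  by rewrite ler_ln ?posrE ?mulr_gt0 ?expR_gt0.
by rewrite lnM ?posrE ?expR_gt0 // expRK addrC lerD2l ler_norm.
Qed.

Variable mu : probability T R.
Hypothesis inv : shift_invariant_measure mu.

Let muT : (mu setT < +oo)%E. Proof. by rewrite probability_setT ltry. Qed.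
Let measY : measurable Y. Proof. by apply: measurable_closed; case: shiftY. Qed.

Lemma weight_support : mu Y = 1%E -> forall w, ~~ lang w -> word_weight mu w = 0.
Proof.
move=> muY w nLw; apply/eqP; rewrite eq_le pr_ge0 andbT.
have mC : measurable (~` Y) by apply: measurableC.
have C0 : pr mu (~` Y) = 0.
  have := prU muT measY mC (setICr Y); rewrite setUv.
  have -> : pr mu setT = 1 by rewrite -[RHS]/(fine 1%:E) -(probability_setT mu).
  have -> : pr mu Y = 1 by exact: (congr1 fine muY).
  lra.
rewrite -C0; apply: le_pr => //; first exact: measurable_subword.
by move=> x /= xw Yx; move/negP: nLw; apply; rewrite -xw; apply: lang_subword.
Qed.

Lemma support_full : (forall w, ~~ lang w -> word_weight mu w = 0) -> mu Y = 1%E.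
Proof.
move=> H; have mP := word_weight_wmeasure (probability_setT mu) inv.
have mE n : measurable [set x : T | ~~ lang (window x n)].
  exact: (measurable_subword_pred _ n (fun w => ~~ lang w)).
have E0 n : mu [set x : T | ~~ lang (window x n)] = 0%E.
  rewrite -prK //; congr EFin.
  rewrite (pr_sum_all muT (f := fun x => window x n) (words_uniq _ n)) //; last 2 first.
  - by move=> w _; apply: measurable_wcyl.
  - by move=> x; rewrite mem_words size_window.
  rewrite big_seq big1 // => w; rewrite mem_words => /eqP wn.
  case: (boolP (lang w)) => Lw.
    rewrite (_ : _ `&` _ = set0) ?pr0 //.
    by apply/seteqP; split=> x // [/= H1 H2]; rewrite H2 Lw in H1.
  apply/eqP; rewrite eq_le pr_ge0 andbT -(H w Lw) -(pr_subword_n inv (window_start s n) wn).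
  apply: le_pr => //; last exact: measurable_subword.
  by apply: measurableI => //; apply: measurable_wcyl.
have C0 : mu (~` Y) = 0%E.
  apply/eqP; rewrite eq_le measure_ge0 andbT setC_bigcup_windows.
  apply: le_trans (measure_sigma_subadditive mu mE _ (subset_refl _)) _.
    exact: bigcup_measurable.
  by [].
  by rewrite le_eqVlt; apply/orP; left; apply/eqP; apply: eseries0 => n _ _; exact: E0.
rewrite -[Y]setCK probability_setC ?C0 ?sube0 //; exact: measurableC.
Qed.

End Count.
End Language.

Section MaximalEntropy.
Context {R : realType} {s : sidedness} {p : nat}.
Local Notation T := (fullshift s p).
Variable Y : set T.
Hypothesis shiftY : shift_space Y.
Variables (good : nat -> pred (seq 'I_p.+1)) (h : R).
Hypothesis glueY : gluing_language (lang Y) good h.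

Lemma exists_unique_mme : exists mu : probability T R,
  unique_max_entropy_measure Y mu /\
  forall w e, 0 < e -> exists2 l, (0 < l)%N & forall nu, wmeasure nu ->
    (forall v, ~~ lang Y v -> nu v = 0) -> l%:R * h - 1 <= wH nu l ->
    `|nu w - word_weight mu w| <= e.
Proof.
have [low up gL gex ggl] := glueY.
have [m [mP msupp mup mlow mlow2]] :=
  exists_wmeasure (lang_sub (Y := Y)) low up gL ggl.
have uniq := wm_unique up gex mP msupp mup mlow mlow2.
have [mu [inv muw]] := @exists_invariant_probability R s p m mP.
exists mu.
have wwE : word_weight mu = m by apply/funext => w; exact: muw.
have [C UC] := up.
have topE := topological_entropyE low UC.
have C0 : 0 < C.
  have := lt_le_trans (expR_gt0 _) (le_trans (low 0%N) (UC 0%N)).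
  by rewrite mul0r expR0 mulr1.
(* Block entropies stay within a constant of nh: the lower bound holds because no word weighs more
   than D e^(-nh), the upper one because at most C e^(nh) words have weight (Gibbs against the
   uniform weight on them). *)
have mH : exists K, forall n, n%:R * h - K <= wH m n <= n%:R * h + K.
  have [D' mD'] := mup; pose D := Num.max 1 D'.
  have D1 : 1 <= D by rewrite le_max lexx.
  have D0 : 0 < D by apply: lt_le_trans D1.
  have m0 w : 0 <= m w by case: mP.
  have mD w : m w <= D * expR (- ((size w)%:R * h)).
    by apply: le_trans (mD' w) _; rewrite ler_wpM2r ?expR_ge0 // le_max lexx orbT.
  exists (`|ln C| + ln D) => n; apply/andP; split.
    apply: (@le_trans _ _ (n%:R * h - ln D)); first by rewrite lerD2l lerN2 lerDr.
    rewrite -[leLHS]mul1r -[X in X * _](wm_sum1 mP n) mulr_suml; apply: ler_sum_words => w wn.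
    rewrite -mulrN; have [->|mw] := eqVneq (m w) 0; first by rewrite !mul0r.
    have mw0 : 0 < m w by rewrite lt_neqAle eq_sym mw m0.
    apply: ler_wpM2l => //; rewrite lerNr opprB.
    apply: (@le_trans _ _ (ln (D * expR (- (n%:R * h))))).
      by rewrite ler_ln ?posrE ?mulr_gt0 ?expR_gt0 // -wn mD.
    by rewrite lnM ?posrE ?expR_gt0 // expRK.
  pose N := cnt R (lang Y) n.
  have N0 : 0 < N by apply: lt_le_trans (low n); exact: expR_gt0.
  apply: (@le_trans _ _ (ln N)).
    apply: (@le_trans _ _ (\sum_(w <- words 'I_p.+1 n)
        - (m w * ln ((if lang Y w then N^-1 else 0) : R)))).
      apply: (@wH_le _ _ m (fun w => if lang Y w then N^-1 else 0) n mP).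
      - by move=> w; case: ifP => // _; rewrite invr_ge0 ltW.
      - move=> w; case: ifPn => [_ /eqP|/msupp //]; by rewrite invr_eq0 gt_eqF.
      rewrite -big_mkcond /= (_ : \sum_(_ <- _ | _) _ = N^-1 * N).
        by rewrite mulVf ?gt_eqF.
      have -> : N = \sum_(w <- words 'I_p.+1 n | lang Y w) 1 by rewrite /N cntE.
      by rewrite mulr_sumr; apply: eq_bigr => w _; rewrite mulr1.
    rewrite -[leRHS]mul1r -[X in X * _](wm_sum1 mP n) mulr_suml; apply: ler_sum => w _.
    case: ifPn => [_|/msupp ->]; last by rewrite !mul0r oppr0.
    by rewrite lnV ?posrE // mulrN opprK.
  apply: (@le_trans _ _ (ln (C * expR (n%:R * h)))).
    by rewrite ler_ln ?posrE ?mulr_gt0 ?expR_gt0 // UC.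
  rewrite lnM ?posrE ?expR_gt0 // expRK addrC lerD2l.
  by apply: le_trans (ler_norm _) _; rewrite lerDl ln_ge0.
have [K mK] := mH.
have mue : measure_entropy mu = h%:E.
  apply/eqP; rewrite eq_le; apply/andP; split; last first.
    by apply: (measure_entropy_ge inv (C := K)); rewrite wwE.
  apply/lee_addgt0Pr => e e0.
  have [n nP] := nat_above (K / e).
  apply: le_trans (measure_entropy_le inv (ltn0Sn n)) _.
  rewrite wwE -EFinD lee_fin ler_pdivrMr // mulrDl.
  have /andP[_ ub] := mK n.+1.
  move: nP; rewrite ler_pdivrMr // => nP.
  apply: le_trans ub _; apply: lerD; first by rewrite mulrC.
  by apply: le_trans nP _; rewrite mulrC ler_wpM2l ?(ltW e0) // ler_nat.
split; last by move=> w e e0; rewrite wwE; apply: uniq.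
split.
  split=> //; last by rewrite mue topE.
  by apply: (support_full shiftY inv) => w; rewrite wwE; exact: msupp.
move=> nu [nuY nuinv nue].
have nuP := word_weight_wmeasure (probability_setT nu) nuinv.
have nusupp := weight_support shiftY nuY.
(* The entropy is at most wH l / l for every l, so a measure of maximal entropy meets the hypothesis
   of quantitative uniqueness at each l, that is for each e. *)
have nuH l : (0 < l)%N -> l%:R * h <= wH (word_weight nu) l.
  move=> l0; have := measure_entropy_le nuinv l0.
  by rewrite nue topE lee_fin ler_pdivlMr ?ltr0n // mulrC.
have nuT : (nu setT < +oo)%E by rewrite probability_setT ltry.
have muT : (mu setT < +oo)%E by rewrite probability_setT ltry.
move=> B mB; apply: (measure_unique_wcyl nuT) => // n w wn.
rewrite -(prK nuT (measurable_wcyl n w)) -(prK muT (measurable_wcyl n w)); congr EFin.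
have -> : pr nu (wcyl n w) = word_weight nu w by apply: (pr_subword_n nuinv).
have -> : pr mu (wcyl n w) = word_weight mu w by apply: (pr_subword_n inv).
rewrite muw; apply/eqP; rewrite -subr_eq0 -normr_le0; apply/ler_addgt0Pr => e e0.
rewrite add0r; have [l l0 lP] := uniq w e e0; apply: lP => //.
by apply: le_trans (nuH l l0); rewrite gerBl.
Qed.

End MaximalEntropy.

(** * Subshift factors *)

Lemma within_window s p (X : set (fullshift s p)) (U : topologicalType)
    (f : fullshift s p -> U) x (V : set U) :
  {within X, continuous f} -> X x -> nbhs (f x) V ->
  exists n, forall y, X y -> window y n = window x n -> V (f y).
Proof.
move=> cf Xx fV; have : within X (nbhs x) (f @^-1` V).
  by rewrite nbhs_subspace_in //; apply: cf.
by move=> /nbhs_window [n nV]; exists n => y Xy yx; apply: nV.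
Qed.

(** Curtis-Hedlund-Lyndon: by compactness a single window decides the letter at 0 of the image, and
    commutation with the shift gives the other letters. [phi] reads that letter off any point of X
    with the given window. *)
Lemma block_code s p q (X : set (fullshift s p)) (pi : fullshift s p -> fullshift s q) :
  shift_space X -> {within X, continuous pi} ->
  (forall x, X x -> pi (left_shift x) = left_shift (pi x)) ->
  exists r (phi : seq 'I_p.+1 -> 'I_q.+1), forall x k n, X x ->
    block_map r phi (subword x (window_start s r.+1 + k%:R) n) = subword (pi x) k%:R (n - r).
Proof.
move=> sX cpi pis; have [_ cX _] := sX.
have [x Xx|r rP] := @window_uniform _ _ X (fun y z => pi y 0 = pi z 0) cX.
  have [|n nP] := @within_window _ _ _ _ _ x [set y : fullshift s q | y 0 = pi x 0] cpi Xx.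
    by apply: open_nbhs_nbhs; split=> //; apply: coord_open.
  by exists n => y z Yy Yz yx zx; rewrite (nP y Yy yx) (nP z Yz zx).
(* The window is enlarged by one letter to fit blocks of r.+1 letters. *)
have {}rP y z : X y -> X z -> window y r.+1 = window z r.+1 -> pi y 0 = pi z 0.
  by move=> Xy Xz yz; apply: rP => //; apply: window_le yz.
pose phi w := pi (xget point [set x | X x /\ window x r.+1 = w]) 0.
have phiE x : X x -> phi (window x r.+1) = pi x 0.
  move=> Xx; have [Xy yx] : [set y | X y /\ window y r.+1 = window x r.+1]
      (xget point [set y | X y /\ window y r.+1 = window x r.+1]).
    by apply: (@xgetPex _ point); exists x.
  exact: rP.
have piE k x : X x -> pi (iter k left_shift x) = iter k left_shift (pi x).
  by move=> Xx; elim: k => //= k <-; apply: pis; apply: iter_shift_in.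
exists r, phi => x k n Xx.
rewrite /block_map size_subword /subword /mkseq; apply/eq_in_map => i.
rewrite mem_iota add0n leq0n /= => ir.
rewrite -/(subword x (window_start s r.+1 + k%:R) n) drop_subword take_subword; last by lia.
rewrite -addrA -natrD -subword_iter_shift -/(window _ r.+1) phiE; last exact: iter_shift_in.
by rewrite piE // iter_shiftE add0r natrD.
Qed.

Lemma glue_coded p t (w : word p) (vs ws : seq (word p)) :
  size vs = size ws -> (forall v, v \in vs -> size v = t) ->
  coded t (fun g x => x = g) ws w (Defs.glue w vs ws).
Proof.
elim: ws w vs => [|w' ws IH] w [|v vs] //=; first by rewrite /Defs.glue /= cats0.
move=> [vw] vt; exists w, v, (Defs.glue w' vs ws); split=> //; first by apply: vt; rewrite mem_head.
- by rewrite /Defs.glue /= -!catA.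
- by apply: IH => // v' v'vs; apply: vt; rewrite inE v'vs orbT.
Qed.

Lemma limn_esup_lt (R : realType) (u : (\bar R)^nat) (a : \bar R) :
  (limn_esup u < a)%E -> exists N, forall k, (N <= k)%N -> (u k < a)%E.
Proof.
rewrite limn_esup_lim (cvg_lim (@ereal_hausdorff R) (@cvg_esups_inf _ u)).
move=> /ereal_inf_lt [_ [N _ <-] Na]; exists N => k Nk; apply: le_lt_trans Na.
by apply: ereal_sup_ubound; exists k.
Qed.

(** A zero limsup bounds all but finitely many lengths; the others are absorbed by the constant. *)
Lemma small_count (R : realType) p (D : set (word p)) (e : R) :
  word_entropy R D = 0%E -> 0 < e ->
  exists C : R, forall n, cnt R (fun w => `[< D w >]) n <= C * expR (n%:R * e).
Proof.
move=> D0 e0; have [|N NP] := @limn_esup_lt R _ e%:E (_ : (word_entropy R D < e%:E)%E).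
  by rewrite D0 lte_fin.
pose c n := cnt R (fun w => `[< D w >]) n.
have c0 n : 0 <= c n by rewrite /c /cnt ler0n.
exists (1 + \sum_(i < N) c i) => n; rewrite -/(c n).
have S0 : 0 <= \sum_(i < N) c i by apply: sumr_ge0 => i _; exact: c0.
have ne : 0 <= n%:R * e by rewrite mulr_ge0 // ltW.
have e1 : 1 <= expR (n%:R * e) by rewrite -[leLHS]expR0 ler_expR.
have [nN|Nn] := ltnP n N.
  apply: (@le_trans _ _ (\sum_(i < N) c i)).
    by rewrite (bigD1 (Ordinal nN)) //= lerDl sumr_ge0.
  apply: (@le_trans _ _ (1 + \sum_(i < N) c i)); first by rewrite lerDr.
  by rewrite ler_peMr // addr_ge0.
apply: (@le_trans _ _ (expR (n%:R * e))); last by rewrite ler_peMl ?expR_ge0 // lerDl.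
(* Taken apart since [ln 0 = 0]. *)
have [cn|cn] := eqVneq (c n) 0; first by rewrite cn; apply: expR_ge0.
have cn0 : 0 < c n by rewrite lt_neqAle eq_sym cn /=; exact: c0.
(* At length 0 the normalised logarithm is 0 whatever the count, but there is only the empty
   word. *)
have [n0|n0] := posnP n.
  rewrite /c /cnt; apply: le_trans e1; rewrite n0.
  by rewrite (_ : 1 = 1%:R) // ler_nat; apply: leq_trans (count_size _ _) _.
have := NP n Nn; rewrite lte_fin count_wordsE -/(cnt R _ n) -/(c n).
rewrite mulrC ltr_pdivrMr ?ltr0n // => H.
by rewrite -[leLHS](lnK cn0) ler_expR mulrC ltW.
Qed.

(** [cylinder] reads words from coordinate 1 and the block code from [window_start]; this relates
    the two. *)
Lemma window_start1 s n : exists k, 1 = window_start s n + k%:R.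
Proof.
case: s => /=; first by exists 1%N.
by exists (n./2).+1; rewrite natz -addn1 PoszD addKr.
Qed.

Lemma periodic_points_of_language s p (Y : set (fullshift s p)) l y :
  shift_space Y -> (forall y, lang Y y -> forall b i, (i + l < size y)%N ->
    nth b y (i + l) = nth b y i) ->
  Y y -> iter l left_shift y = y.
Proof.
move=> sY per Yy; apply/funext => i; rewrite iter_shiftE.
have := per _ (lang_subword i l.+1 Yy) ord0 0%N.
rewrite size_subword add0n ltnSn => /(_ isT).
by rewrite !nth_subword // addr0.
Qed.

Definition good_words_periodic s p (Y : set (fullshift s p)) (good : nat -> pred (seq 'I_p.+1)) :=
  forall M, exists T, forall w, good M w -> (0 < size w)%N -> exists y k,
    [/\ Y y, (1 <= k <= size w + T)%N, iter k left_shift y = y & subword y 0 (size w) = w].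

Section SubshiftFactor.
Variables (R : realType) (s : sidedness) (p : nat).
Variables (X : set (fullshift s p)) (Cp G Cs : set (word p)).
Hypotheses (shiftX : shift_space X) (dec : decomposition (language X) Cp G Cs).
Hypotheses (specI : S_specification (language X) G)
  (smallII : word_entropy R (Cp `|` Cs) = 0%E).
Hypothesis extIII : forall M : nat, exists tau : nat,
  forall v, thickening (language X) Cp G Cs M v ->
    exists u w, [/\ (size u <= tau)%N, (size w <= tau)%N & G (u ++ v ++ w)].
Variables (q : nat) (Y : set (fullshift s q)).
Hypothesis factorY : subshift_factor X Y.

Lemma subshift_factor_gluing : exists good, exists2 h : R, gluing_language (lang Y) good h &
  (Per_specification X G -> good_words_periodic Y good).
Proof.
have [shiftY [pi [cpi piX pis]]] := factorY.
have [r [phi code]] := block_code shiftX cpi pis.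
have piXY x : X x -> Y (pi x) by move=> Xx; rewrite -piX; exists x.
have piE k x : X x -> pi (iter k left_shift x) = iter k left_shift (pi x).
  by move=> Xx; elim: k => //= k <-; apply: pis; apply: iter_shift_in.
have code0 x n : X x ->
    block_map r phi (subword x (window_start s r.+1) n) = subword (pi x) 0 (n - r).
  by move=> Xx; rewrite -[window_start _ _]addr0; apply: (code x 0%N).
have LX_sub u v w : language X (u ++ v ++ w) -> language X v.
  by move=> /langP /lang_sub /langP.
have LX_ne n : exists2 w, size w = n & language X w.
  by have [w wn /langP Lw] := lang_nonempty shiftX n; exists w.
have LY_Phi x : language X x -> lang Y (block_map r phi x).
  move=> /langP /(lang_at_window shiftX r.+1) [z Xz <-]; rewrite code0 //.
  by apply: lang_subword; apply: piXY.
have Phi_LY y : lang Y y -> exists x,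
    [/\ language X x, size x = (size y + r)%N & block_map r phi x = y].
  move=> /(lang_at0 shiftY) [y']; rewrite -{1}piX => -[x Xx <-] xy.
  exists (subword x (window_start s r.+1) (size y + r)).
  split; first by apply/langP; apply: lang_subword.
    by rewrite size_subword.
  by rewrite code0 // addnK.
have [t tP] := specI.
have spec w ws : {in w :: ws, forall g, G g} ->
    exists2 z, language X z & coded t (fun g x => x = g) ws w z.
  move=> /tP [vs [vw vt Lz]]; exists (Defs.glue w vs ws) => //.
  by apply: glue_coded => // v /vt [].
have [_ GL _ decP] := dec.
have small (e : R) := @small_count R p (Cp `|` Cs) e smallII.
have [good glueY perY] := factor_gluing_language LX_sub LX_ne (lang_sub (Y := Y)) LY_Phi
  Phi_LY decP spec extIII small.
exists good, (entropy_rate R (lang Y)) => // -[t' t'P] M; case: perY => [[l l0 lP]|/(_ M) [T TP]].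
  exists l => w gw w0; have [_ _ gL _ _] := glueY.
  have [y Yy yw] := lang_at0 shiftY (gL _ _ gw).
  exists y, l; split => //; first by rewrite l0 leq_addl.
  exact: (periodic_points_of_language shiftY lP).
exists (T + t')%N => w gw w0; have [g [j [Gg gT jT jg wE]]] := TP w gw.
(* (Per)-specification for the single word g: there is no gap inside, and x has period |g| + t'. *)
have [|_ [/size0nil -> _ _ [x [Xx xg] xp]]] := t'P g [::]; first by move=> ?; rewrite inE => /eqP ->.
rewrite /Defs.glue /= cats0 in xg xp.
have [c cE] := window_start1 s r.+1.
(* In [pi x] the image of g starts at coordinate c, and w at place j of this image; the shift brings
   w to coordinate 0. *)
exists (pi (iter (c + j) left_shift x)), (size g + t')%N; split.
- by apply: piXY; apply: iter_shift_in.
- rewrite addnA leq_add2r gT andbT addn_gt0 (leq_trans _ jg) //.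
  by rewrite addnAC addn_gt0 w0 orbT.
- rewrite -piE; last exact: iter_shift_in.
  by rewrite -iterD addnC iterD xp.
have gE : block_map r phi g = subword (pi x) c%:R (size g - r).
  by rewrite -code // -cE xg.
rewrite [RHS]wE gE drop_subword take_subword; last by lia.
by rewrite piE // subword_iter_shift add0r natrD.
Qed.

End SubshiftFactor.

Section Integral.
Variables (R : realType) (s : sidedness) (p : nat).
Local Notation T := (fullshift s p).
Variables (Y : set T) (f : T -> R).
Hypotheses (cY : closed Y) (cf : {within Y, continuous f}).

Let mY : measurable Y. Proof. exact: measurable_closed. Qed.

Lemma within_continuous_measurable : measurable_fun Y f.
Proof.
apply: (measurability _ (measurable_realfun.RGenOpens.measurableE R)).
move=> _ [_ [a [b ->] <-]]; pose U := `]a, b[%classic : set R.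
have oU : open U by apply: interval_open.
pose V : set T := [set x | exists n, forall y, Y y -> window y n = window x n -> U (f y)].
have oV : open V.
  apply/openP => x [n nV]; exists n => y yx; exists n => z Yz zy; apply: nV => //.
  by rewrite zy.
rewrite (_ : _ `&` _ = Y `&` V); first by apply: measurableI => //; apply: open_measurable_fs.
apply/seteqP; split=> x [Yx Ux]; split=> //.
  by apply: (within_window cf Yx); apply: open_nbhs_nbhs.
by case: Ux => n; apply.
Qed.

Section Measure.
Variable mu : {measure set T -> \bar R}.
Hypothesis muT : (mu setT < +oo)%E.

Let muY : (mu Y < +oo)%E.
Proof. by apply: le_lt_trans muT; apply: le_measure; rewrite ?inE. Qed.

Lemma integrable_indic_in (A : set T) : measurable A ->
  mu.-integrable Y (EFin \o (\1_A : T -> R)).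
Proof.
move=> mA; apply: measurable_bounded_integrable => //.
exists 1; split=> // M M1 x _ /=; rewrite indicE.
by case: (_ \in _); rewrite /= ?normr1 ?normr0; apply: ltW; rewrite // (lt_trans _ M1).
Qed.

Lemma simple_Rintegral n (g : word p -> R) (r : seq (word p)) :
  let G x := \sum_(w <- r) g w * \1_(wcyl n w) x in
  mu.-integrable Y (EFin \o G) /\
  \int[mu]_(x in Y) G x = \sum_(w <- r) g w * pr mu (Y `&` wcyl n w).
Proof.
elim: r => [|w r [IH1 IH2]] G.
  have -> : G = fun=> 0 by apply/funext => x; rewrite /G big_nil.
  split; first exact: integrable0.
  by rewrite big_nil Rintegral_cst // mul0r.
pose G' (x : T) := \sum_(w <- r) g w * \1_(wcyl n w) x.
have GE : G = fun x => g w * \1_(wcyl n w) x + G' x.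
  by apply/funext => x; rewrite /G big_cons.
have i1 := integrable_indic_in (measurable_wcyl n w).
have i2 : mu.-integrable Y (EFin \o (fun x => g w * \1_(wcyl n w) x)).
  exact: (integrableZl mY (g w) i1).
split; first by rewrite GE; exact: (integrableD mY i2 IH1).
rewrite GE RintegralD // IH2 RintegralZl // big_cons; congr (_ * _ + _).
rewrite /Rintegral integral_indic //; last exact: measurable_wcyl.
by rewrite setIC.
Qed.

End Measure.

(** The window length and the step function do not depend on the measure, so one discretisation
    serves for the limit and for all uniform measures on Per(n). *)
Lemma Rintegral_by_windows e : 0 < e -> exists n g,
  forall mu : {measure set T -> \bar R}, (mu setT < +oo)%E ->
  `|\int[mu]_(x in Y) f x - \sum_(w <- words 'I_p.+1 n) g w * pr mu (Y `&` wcyl n w)|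
    <= e * pr mu Y.
Proof.
move=> e0.
have [x Yx|n nP] := @window_uniform _ _ Y (fun y z => `|f y - f z| <= e) cY.
  have [|n nP] := @within_window _ _ _ _ _ x (ball (f x) (e / 2)) cf Yx.
    by apply: nbhsx_ballx; rewrite divr_gt0.
  exists n => y z Yy Yz yx zx; have := nP y Yy yx; have := nP z Yz zx.
  rewrite /ball /= => H1 H2; rewrite -(subrKA (f x)).
  apply: le_trans (ler_normD _ _) _; rewrite distrC (splitr e).
  by apply: lerD; apply: ltW.
pose g w := f (xget point [set x | Y x /\ window x n = w]).
have gP x : Y x -> `|f x - g (window x n)| <= e.
  move=> Yx; have [Yy yx] : [set y | Y y /\ window y n = window x n]
      (xget point [set y | Y y /\ window y n = window x n]).
    by apply: (@xgetPex _ point); exists x.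
  by apply: nP.
exists n, g => mu muT; have [iG GE] := simple_Rintegral muT n g (words 'I_p.+1 n).
set G := fun x => _ in iG GE; rewrite -GE.
have Gw x : G x = g (window x n).
  have wn : window x n \in words 'I_p.+1 n by rewrite mem_words size_window.
  rewrite /G (bigD1_seq (window x n)) ?words_uniq //= indicE mem_set // mulr1.
  rewrite big1 ?addr0 // => w wx; rewrite indicE memNset ?mulr0 // => /= xw.
  by rewrite xw eqxx in wx.
have muY : (mu Y < +oo)%E by apply: le_lt_trans muT; apply: le_measure; rewrite ?inE.
pose K := e + \sum_(w <- words 'I_p.+1 n) `|g w|.
have fK x : Y x -> `|f x| <= K.
  move=> Yx; rewrite -(subrK (g (window x n)) (f x)); apply: le_trans (ler_normD _ _) _.
  apply: lerD; first exact: gP.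
  have wn : window x n \in words 'I_p.+1 n by rewrite mem_words size_window.
  by rewrite (bigD1_seq (window x n)) ?words_uniq //= lerDl sumr_ge0.
have iF : mu.-integrable Y (EFin \o f).
  apply: measurable_bounded_integrable => //; first exact: within_continuous_measurable.
  by exists K; split; rewrite ?num_real // => M KM x /= Yx; apply: le_trans (ltW KM); exact: fK.
rewrite -RintegralB //.
have iB : mu.-integrable Y (EFin \o (fun x => f x - G x)) by exact: (integrableB mY iF iG).
apply: le_trans (le_normr_Rintegral mY iB) _.
rewrite /pr -Rintegral_cst //; apply: le_Rintegral => //.
- exact: (integrable_norm iB).
- by apply: measurable_bounded_integrable => //; exists e; split; rewrite ?num_real // => M eM x _ /=; rewrite gtr0_norm // ltW.
- by move=> x Yx; rewrite Gw; apply: gP.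
Qed.

End Integral.

(** * Periodic points *)

Section PeriodicPoints.
Variables (s : sidedness) (p : nat).
Local Notation T := (fullshift s p).
Variable Y : set T.
Hypothesis shiftY : shift_space Y.

Lemma iter_period k m (x : T) : iter k left_shift x = x -> iter (m * k) left_shift x = x.
Proof. by move=> xk; elim: m => //= m IH; rewrite mulSn iterD IH. Qed.

Lemma periodic_ext k (x y : T) : (0 < k)%N -> iter k left_shift x = x ->
  iter k left_shift y = y -> subword x 0 k = subword y 0 k -> x = y.
Proof.
move=> k0 xk yk xy.
have nat_eq n : x n%:R = y n%:R.
  rewrite (divn_eq n k) addnC natrD -!iter_shiftE !iter_period //.
  have nk : (n %% k < k)%N by rewrite ltn_mod.
  by rewrite -[(n %% k)%:R]add0r -!(nth_subword ord0 _ _ nk) xy.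
apply/funext => i; have [n [->|ni]] := position_shift i; first exact: nat_eq.
(* A negative coordinate is carried by n periods to n * k - n, which is nonnegative. *)
have iE : i + (n * k)%:R = (n * k - n)%:R.
  by rewrite -{1}(@subnK n (n * k)) ?leq_pmulr // addnC natrD addrA ni add0r.
by rewrite -[x](iter_period n xk) -[y](iter_period n yk) !iter_shiftE iE.
Qed.

Lemma Per_period n x : Per Y n x -> iter n`! left_shift x = x.
Proof.
move=> [_ [k [kn xk]]]; have /dvdnP [m ->] : (k %| n`!)%N by apply: dvdn_fact.
exact: iter_period.
Qed.

Lemma Per_finite n : finite_set (Per Y n).
Proof.
pose g w := xget point [set x | Per Y n x /\ subword x 0 n`! = w].
apply: (@sub_finite_set _ _ (g @` [set` words 'I_p.+1 n`!])); last first.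
  by apply: finite_image; apply: finite_seq.
move=> x Px; exists (subword x 0 n`!); first by rewrite /= mem_words size_subword.
have [Py yx] : [set y | Per Y n y /\ subword y 0 n`! = subword x 0 n`!] (g (subword x 0 n`!)).
  by apply: (@xgetPex _ point); exists x.
by apply: (periodic_ext (fact_gt0 n) (Per_period Py) (Per_period Px)).
Qed.

Definition perseq n : seq T := finmap.enum_fset (fset_set (Per Y n)).

Lemma mem_perseq n x : reflect (Per Y n x) (x \in perseq n).
Proof.

by rewrite in_fset_set ?inE; [exact: asboolP|exact: Per_finite].
Qed.

Lemma perseq_uniq n : uniq (perseq n).
Proof. exact: finmap.fset_uniq. Qed.

Lemma Per_shift n x : Per Y n x -> Per Y n (left_shift x).
Proof.
move=> [Yx [k [kn xk]]]; split; first exact: left_shift_in.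
by exists k; split=> //; rewrite -iterSr iterS xk.
Qed.

(** On Per(n) the n!-th iterate of the shift is the identity, so the shift is injective there and
    permutes this finite set. *)
Lemma left_shift_perm n : perm_eq (map left_shift (perseq n)) (perseq n).
Proof.
have us : uniq (map left_shift (perseq n)).
  rewrite map_inj_in_uniq ?perseq_uniq // => x y /mem_perseq Px /mem_perseq Py xy.
  rewrite -(Per_period Px) -(Per_period Py).
  by rewrite -[n`!](@prednK _ (fact_gt0 n)) !iterSr xy.
apply: uniq_perm => //; first exact: perseq_uniq.
apply: (uniq_min_size us _ _).2; last by rewrite size_map.
by move=> _ /mapP [x /mem_perseq Px ->]; apply/mem_perseq/Per_shift.
Qed.

Variable R : realType.

Lemma per_measureE n (A : set T) : per_measure R Y n A =
  ((count (fun x => `[< A x >]) (perseq n))%:R / (size (perseq n))%:R)%:E.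
Proof.
transitivity (((size (perseq n))%:R^-1 : R)%:E *
  \sum_(k < size (perseq n)) \d_(nth point (perseq n) k) A)%E => //.
rewrite (eq_bigr (fun i : 'I__ => ((`[< A (nth point (perseq n) i) >])%:R : R)%:E)); last first.
  by move=> i _; rewrite diracE.
rewrite sumEFin -EFinM mulrC; congr (_ / _)%:E.
rewrite (_ : count _ _ = \sum_(i < size (perseq n)) `[< A (nth point (perseq n) i) >])%N.
  by rewrite natr_sum.
rewrite -sum1_count big_mkcond (big_nth point) big_mkord.
by apply: eq_bigr => i _; case: `[< _ >].
Qed.

Lemma per_measure_invariant n B : per_measure R Y n (left_shift @^-1` B) = per_measure R Y n B.
Proof.
rewrite !per_measureE; congr (_%:R / _)%:E.
by rewrite -[RHS](permP (left_shift_perm n)) count_map.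
Qed.

Lemma per_measure_full n A : (0 < size (perseq n))%N -> Y `<=` A -> per_measure R Y n A = 1%E.
Proof.
move=> n0 YA; rewrite per_measureE (_ : count _ _ = size (perseq n)).
  by rewrite divff // pnatr_eq0 -lt0n.
apply/eqP; rewrite -all_count; apply/allP => x /mem_perseq [Yx _]; apply/asboolP; exact: YA.
Qed.

End PeriodicPoints.

Section Equidistribution.
Variables (R : realType) (s : sidedness) (p : nat).
Local Notation T := (fullshift s p).
Variable Y : set T.
Hypothesis shiftY : shift_space Y.

Let weight n := word_weight (per_measure R Y n).
Let npts n : R := (size (perseq Y n))%:R.

Lemma per_weight_wmeasure n : (0 < size (perseq Y n))%N -> wmeasure (weight n).
Proof.
move=> n0; apply: word_weight_wmeasure; first exact: per_measure_full.
by move=> B _; apply: per_measure_invariant.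
Qed.

Lemma per_weightE n w : weight n w =
  (count (fun x : T => subword x 0 (size w) == w) (perseq Y n))%:R / npts n.
Proof.
rewrite /weight /word_weight /pr per_measureE /=; congr (_%:R / _).
by apply: eq_count => x; apply/asboolP/eqP.
Qed.

Lemma per_weight_support n w : ~~ lang Y w -> weight n w = 0.
Proof.
move=> nLw; rewrite per_weightE (_ : count _ _ = 0%N) ?mul0r //; apply/eqP.
rewrite -leqn0 leqNgt -has_count; apply/hasP => -[x /mem_perseq [Yx _] /eqP xw].
by move/negP: nLw; apply; rewrite -xw; apply: lang_subword.
Qed.

(* A point of period at most n is determined by its period and its first n letters. *)
Lemma per_weight_le n w : size w = n -> weight n w <= n%:R / npts n.
Proof.
move=> wn; rewrite per_weightE ler_wpM2r ?invr_ge0 ?ler0n // ler_nat -size_filter.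
rewrite -[leqRHS](size_iota 1).
pose P (x : T) : set nat := [set k | (1 <= k <= n)%N /\ iter k left_shift x = x].
have PP x : x \in perseq Y n -> P x (xget 0%N (P x)).
  by move=> /mem_perseq [_ [k kP]]; apply: (@xgetPex _ 0%N); exists k.
apply: (@size_le_inj _ _ _ _ (fun x => xget 0%N (P x))).
- by rewrite filter_uniq // perseq_uniq.
- move=> x y; rewrite !mem_filter => /andP[/eqP xw /PP [kn xk]] /andP[/eqP yw /PP [_ yk]] xy.
  rewrite -xy in yk; case/andP: kn => k0 kn; apply: (periodic_ext k0 xk yk).
  by rewrite -(take_subword x 0 kn) -(take_subword y 0 kn) -wn xw yw.
- by move=> x; rewrite mem_filter mem_iota => /andP[_ /PP [kn _]]; rewrite add1n ltnS.
Qed.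

Lemma per_weight_entropy n : (0 < n)%N -> (0 < size (perseq Y n))%N ->
  ln (npts n) - ln n%:R <= wH (weight n) n.
Proof.
move=> n0 F0; have mP := per_weight_wmeasure F0.
have m0 w : 0 <= weight n w by case: mP.
have N0 : 0 < npts n by rewrite ltr0n.
rewrite -[leLHS]mul1r -[X in X * _](wm_sum1 mP n) mulr_suml; apply: ler_sum_words => w wn.
rewrite -mulrN; have [->|mw] := eqVneq (weight n w) 0; first by rewrite !mul0r.
have mw0 : 0 < weight n w by rewrite lt_neqAle eq_sym mw m0.
apply: ler_wpM2l => //; rewrite lerNr opprB -ln_div ?posrE ?ltr0n //.
by rewrite ler_ln ?posrE ?divr_gt0 ?ltr0n // per_weight_le.
Qed.

Variables (good : nat -> pred (seq 'I_p.+1)) (h : R).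
Hypothesis glueY : gluing_language (lang Y) good h.
Hypothesis perY : good_words_periodic Y good.

Lemma periodic_points_lower : exists t, forall n, (0 < n)%N ->
  2^-1 * expR (n%:R * h) <= npts (n + t).
Proof.
have [low _ gL gex _] := glueY.
have [|M MP] := gex 2^-1; first by rewrite invr_gt0.
have [t tP] := perY M; exists t => n n0.
have split_cnt : cnt R (lang Y) n <=
    cnt R (good M) n + cnt R (fun w => lang Y w && ~~ good M w) n.
  rewrite /cnt -natrD ler_nat -count_predUI; apply: leq_trans (leq_addr _ _).
  by apply: sub_count => w Lw /=; rewrite Lw; case: (good M w).
have le_good : cnt R (good M) n <= npts (n + t).
  rewrite /cnt /npts ler_nat -size_filter.
  pose P w : set T := [set y | Per Y (n + t) y /\ subword y 0 (size w) = w].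
  have PP w : good M w -> size w = n -> P w (xget point (P w)).
    move=> gw wn; have [|y [k [Yy kn yk yw]]] := tP w gw; first by rewrite wn.
    by apply: (@xgetPex _ point); exists y; split=> //; split=> //; exists k; rewrite -wn.
  apply: (@size_le_inj _ _ _ _ (fun w => xget point (P w))).
  - by rewrite filter_uniq // words_uniq.
  - move=> w w'; rewrite !mem_filter !mem_words => /andP[gw /eqP wn] /andP[gw' /eqP w'n] E.
    have [_ <-] := PP w gw wn; have [_ <-] := PP w' gw' w'n.
    by rewrite E wn w'n.
  - move=> w; rewrite mem_filter mem_words => /andP[gw /eqP wn].
    by apply/mem_perseq; have [] := PP w gw wn.
have := low n; have := MP n; lra.
Qed.

Variable mu : probability T R.
Hypothesis quant : forall w e, 0 < e -> exists2 l, (0 < l)%N & forall nu, wmeasure nu ->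
    (forall v, ~~ lang Y v -> nu v = 0) -> l%:R * h - 1 <= wH nu l ->
    `|nu w - word_weight mu w| <= e.

Lemma per_weight_cvg w e : 0 < e -> exists N, forall n, (N <= n)%N ->
  (0 < size (perseq Y n))%N /\ `|weight n w - word_weight mu w| <= e.
Proof.
move=> /(quant w) [l l0 lP]; have [t tP] := periodic_points_lower.
have l0R : 0 < l%:R :> R by rewrite ltr0n.
(* With ln n <= n / (2l) + ln (2l), the entropy estimates add up to n * wH l >= n l h - n / 2 - K,
   and 2K <= n makes the defect at most n, that is 1 after division. *)
pose K := l%:R * (t%:R * h + ln 2 + ln (2 * l%:R)) + l%:R ^+ 2 * ln #|'I_p.+1|%:R.
have [N NP] := nat_above (2 * K); exists (maxn N t.+1) => n; rewrite geq_max => /andP[Nn tn].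
have nt : 2^-1 * expR ((n - t)%:R * h) <= npts n.
  by have := tP (n - t)%N; rewrite subnK; [apply; rewrite subn_gt0 | exact: ltnW].
have F0 : 0 < npts n by apply: lt_le_trans nt; rewrite mulr_gt0 ?invr_gt0 ?expR_gt0.
have n0 : (0 < n)%N by apply: leq_ltn_trans tn.
have S0 : (0 < size (perseq Y n))%N by rewrite -(ltr0n R).
split=> //; apply: lP; [exact: per_weight_wmeasure | exact: per_weight_support |].
have n0R : 0 < n%:R :> R by rewrite ltr0n.
have e1 := per_weight_entropy n0 S0.
have e2 : (n - t)%:R * h - ln 2 <= ln (npts n).
  apply: (@le_trans _ _ (ln (2^-1 * expR ((n - t)%:R * h)))).
    by rewrite lnM ?posrE ?invr_gt0 ?expR_gt0 // expRK lnV ?posrE // addrC.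
  by rewrite ler_ln ?posrE // mulr_gt0 ?invr_gt0 ?expR_gt0.
have e3 : ln n%:R <= n%:R / (2 * l%:R) + ln (2 * l%:R) :> R.
  rewrite -lerBlDr -ln_div ?posrE ?mulr_gt0 //; apply: ltW; apply: ln_sublinear.
  by rewrite divr_gt0 // mulr_gt0.
have A0 : (0 < #|'I_p.+1|)%N by rewrite card_ord.
have e4 := wH_down n (per_weight_wmeasure S0) A0 l0.
have e5 : 2 * K <= n%:R by apply: le_trans NP _; rewrite ler_nat.
have e6 : (n - t)%:R = n%:R - t%:R :> R by rewrite natrB // ltnW.
rewrite e6 in e2.
have e7 : l%:R * (n%:R / (2 * l%:R)) = n%:R / 2 :> R by field; rewrite gt_eqF.
have e8 : l%:R * ((n%:R - t%:R) * h - ln 2 - (n%:R / (2 * l%:R) + ln (2 * l%:R))) <=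
    l%:R * wH (weight n) n.
  by rewrite ler_pM2l //; apply: le_trans e1; apply: lerB.
rewrite -(ler_pM2l n0R); move: e4 e5 e7 e8; rewrite /K.
move: (wH (weight n) n) (wH (weight n) l) (n%:R / (2 * l%:R)) (ln 2) (ln (2 * l%:R)) (ln _).
by move=> a b c d f g; nra.
Qed.

Lemma per_measure_weak_cvg : shift_invariant_measure mu -> mu Y = 1%E ->
  weak_star_cvg Y (per_measure R Y) mu.
Proof.
move=> inv muY f cf; apply/cvgrPdist_le => e e0.
have [_ cY _] := shiftY; have mY := measurable_closed cY.
have e4 : 0 < e / 4 by rewrite divr_gt0.
have [k [g gP]] := Rintegral_by_windows cY cf e4.
have muT : (mu setT < +oo)%E by rewrite probability_setT ltry.
(* The complement of Y is null, so restricting a window cylinder to Y keeps its mass. *)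
have weightE (nu : {measure set T -> \bar R}) : nu setT = 1%E -> nu Y = 1%E ->
    (forall B, measurable B -> nu (left_shift @^-1` B) = nu B) ->
    forall w, size w = k -> pr nu (Y `&` wcyl k w) = word_weight nu w.
  move=> nuT nuY nuinv w wk; rewrite -(pr_subword_n nuinv (window_start s k) wk).
  have nuTf : (nu setT < +oo)%E by rewrite nuT ltry.
  have mW := @measurable_wcyl s p k w.
  have nuC : pr nu (~` Y) = 0.
    have := prU nuTf mY (measurableC mY) (setICr Y); rewrite setUv /pr nuT nuY /=; lra.
  apply/eqP; rewrite eq_le; apply/andP; split.
    by apply: le_pr => //; exact: measurableI.
  rewrite -[leRHS]addr0 -nuC [leLHS](pr_split nuTf mW mY) setIC lerD2l.
  by apply: le_pr => //; [exact: measurableD | exact: measurableC].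
pose S := \sum_(w <- words 'I_p.+1 k) `|g w|.
have S0 : 0 <= S by apply: sumr_ge0.
(* The two discretisations and the comparison of weights cost at most e / 4 each; S + 1 is used
   since S may be 0. *)
pose d := e / 4 / (S + 1); have d0 : 0 < d by rewrite divr_gt0 // ltr_wpDl.
have /choice [N NP] : forall w, exists N, forall n, (N <= n)%N ->
  (0 < size (perseq Y n))%N /\ `|weight n w - word_weight mu w| <= d.
  by move=> w; apply: per_weight_cvg.
exists (\max_(w <- words 'I_p.+1 k) N w + N [::])%N => // n /= Nn.
have [F0 _] := NP [::] n (leq_trans (leq_addl _ _) Nn).
have pT := per_measure_full R F0 (@subsetT _ Y).
have pY := per_measure_full R F0 (@subset_refl _ Y).
have pinv B (_ : measurable B) := per_measure_invariant shiftY R n B.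
have a1 := gP mu muT.
have a2 := gP (per_measure R Y n) (_ : (per_measure R Y n setT < +oo)%E).
rewrite pT ltry in a2; have {}a2 := a2 isT.
rewrite (eq_big_words (G := fun w => g w * word_weight mu w)) in a1; last first.
  by move=> w wk; rewrite weightE //; exact: probability_setT.
rewrite (eq_big_words (G := fun w => g w * weight n w)) in a2; last first.
  by move=> w wk; rewrite weightE.
have b1 : pr mu Y = 1 by exact: (congr1 fine muY).
have b2 : pr (per_measure R Y n) Y = 1 by rewrite /pr pY.
rewrite b1 mulr1 in a1; rewrite b2 mulr1 in a2.
have a3 : `|\sum_(w <- words 'I_p.+1 k) g w * word_weight mu w -
    \sum_(w <- words 'I_p.+1 k) g w * weight n w| <= e / 4.
  rewrite -sumrB; apply: le_trans (ler_norm_sum _ _ _) _.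
  apply: (@le_trans _ _ (S * d)).
    rewrite /S mulr_suml; apply: ler_sum_words => w wk.
    rewrite -mulrBr normrM ler_wpM2l // distrC; have [] // := NP w n _.
    apply: leq_trans Nn; apply: leq_trans (leq_addr _ _); apply: leq_bigmax_seq => //.
    by rewrite mem_words wk.
  rewrite /d mulrCA -[leRHS]mulr1 ler_pM2l // ler_pdivrMr ?ltr_wpDl // mul1r.
  by rewrite lerDl.
set I1 := \int[_]_(_ in _) _ in a1 *; set I2 := \int[_]_(_ in _) _ in a2 *.
move: a1 a2 a3; set s1 := \sum_(w <- _) _; set s2 := \sum_(w <- _) _ => a1 a2 a3.
rewrite (_ : I1 - I2 = (I1 - s1) + (s1 - s2) + (s2 - I2)); last by ring.
apply: le_trans (ler_normD _ _) _; rewrite [X in _ + X]distrC.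
have := ler_normD (I1 - s1) (s1 - s2); lra.
Qed.

End Equidistribution.

Theorem theorem4 (R : realType) (s : sidedness) (p : nat)
    (X : set (fullshift s p)) (Cp G Cs : set (word p))
    (shiftX : shift_space X)
    (dec : decomposition (language X) Cp G Cs)
    (specI : S_specification (language X) G)
    (smallII : word_entropy R (Cp `|` Cs) = 0%E)
    (extIII : forall M : nat, exists tau : nat,
      forall v, thickening (language X) Cp G Cs M v ->
        exists u w, [/\ (size u <= tau)%N, (size w <= tau)%N & G (u ++ v ++ w)]) :
  (forall (q : nat) (Y : set (fullshift s q)),
     subshift_factor X Y -> intrinsically_ergodic R Y) /\
  (Per_specification X G ->
   forall (q : nat) (Y : set (fullshift s q)), subshift_factor X Y ->
     exists mu : probability (fullshift s q) R,
       unique_max_entropy_measure Y mu /\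
       weak_star_cvg Y (per_measure R Y) mu).
Proof.
have main q (Y : set (fullshift s q)) : subshift_factor X Y ->
    exists mu : probability (fullshift s q) R, unique_max_entropy_measure Y mu /\
      (Per_specification X G -> weak_star_cvg Y (per_measure R Y) mu).
  move=> factorY; have [shiftY _] := factorY.
  have [good [h glueY perY]] := subshift_factor_gluing shiftX dec specI smallII extIII factorY.
  have [mu [muP quant]] := exists_unique_mme shiftY glueY.
  exists mu; split=> // /perY perG; have [[muY inv _] _] := muP.
  exact: (per_measure_weak_cvg shiftY glueY perG quant inv muY).
split=> [q Y /main [mu [muP _]]|PerG q Y /main [mu [muP cvg]]]; first by exists mu.
by exists mu; split=> //; apply: cvg.
Qed.
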